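(* Let $n\ge 1$ and let $C$ be an $n\times n$ complex matrix with rows and columns indexed by a set $S$ with $|S|=n$. There are a singly-generated Yang-Baxter planar algebra $\mathcal V$ and a non-symmetric spin model $\Phi:\mathcal V\to\mathrm{GPA}(\ast_n)$ with $C=C_P$, where $P$ is the generating minimal idempotent of $\mathcal V$, if and only if $C$ is the adjacency matrix of the directed 3-cycle (so $n=3$). In this case, $\mathcal V$ is isomorphic to the unique Bisch-Jones planar algebra with $\dim V_3=9$.
   Context: Directed graphs. The directed 3-cycle has vertices $v_1,v_2,v_3$ and edges $v_1\to v_2\to v_3\to v_1$. The adjacency matrix of a directed graph has $(a,b)$ entry $1$ if there is an edge from $a$ to $b$, and $0$ otherwise. Planar algebras. A shaded planar algebra $\mathcal V=\{V_{\pm i}\}_{i\ge0}$ is a family of complex vector spaces with an action of the shaded planar operad (planar tangles up to isotopy act by multilinear maps compatibly with composition). $V_{+i}$ (resp. $V_{-i}$) is attached to discs with $2i$ boundary points whose starred region is unshaded (resp. shaded); $V_3$ means $V_{+3}$. A planar algebra map is a family of linear maps intertwining the actions of all tangles (including those with no input discs). $\mathcal V$ is generated by a set $\mathcal R$ if all its elements are linear combinations of planar diagrams labelled by $\mathcal R$. $\mathcal V$ is evaluable if $\dim V_{+0}=\dim V_{-0}=1$; then the bilinear pairing on each $V_{\pm i}$ which joins all boundary points of two elements in the plane, producing a closed diagram, is scalar-valued; $\mathcal V$ is non-degenerate if no nonzero element pairs to $0$ with everything. Two-boxes. An element of $V_{+2}$ is drawn as a box with two strings on top and two on the bottom; the left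 (starred) and right regions are unshaded, the regions between the strings are shaded. $\mathrm{id}\in V_{+2}$ is two vertical strings; $e\in V_{+2}$ (cup-cap) is a cup joining the two top points together with a cap joining the two bottom points. Multiplication on $V_{+2}$ is vertical stacking. Horizontal composition $X*Y$ places $X$ to the left of $Y$ and joins the right strings of $X$ to the left strings of $Y$, enclosing an unshaded region. For $x,y,z\in V_{+2}$, $U(x,y,z)\in V_{+3}$ is the triangle-like diagram with three boxes around a central unshaded region and three exterior unshaded regions, each box separating the central region from one exterior unshaded region; $D(x,y,z)\in V_{+3}$ is the diagram with three boxes around a central shaded region, each box separating two of the three exterior unshaded regions. Yang-Baxter planar algebras. A Yang-Baxter planar algebra is a non-degenerate evaluable planar algebra in which a closed loop bounding a shaded disc equals $1$ and a closed loop bounding an unshaded disc (in a shaded region) equals a scalar $n$, generated by a subset $\mathcal R\subset V_{+2}$ such that for all $R_i,R_j,R_k\in\mathcal R\cup\{\mathrm{id},e\}$: (1a) joining the two adjacent strings on one side (top) of $R_i$ gives a scalar multiple of a single strand; (1b) joining the right top and right bottom strings of $R_i$ gives a scalar multiple of a single strand; (2a) $R_iR_j$ and (2b) $R_i*R_j$ are linear combinations of elements of $\mathcal R\cup\{\mathrm{id},e\}$; (3a) $U(R_i,R_j,R_k)$ is a linear combination of diagrams $D(R_x,R_y,R_z)$; (3b) $D(R_i,R_j,R_k)$ is a linear combination of diagrams $U(R_x,R_y,R_z)$, where $R_x,R_y,R_z\in\mathcal R\cup\{\mathrm{id},e\}$. It is singly-generated if $\mathcal R=\{R\}$ with $R\neq0$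 and $\{R,\mathrm{id},e\}$ spans $V_{+2}$. Without loss of generality the generator is a minimal idempotent $P\in V_{+2}$ orthogonal to $e$; put $Q=\mathrm{id}-e-P$, the other (minimal or zero) idempotent. Spin models. Let $\ast_n$ be the star graph with central vertex $\star$ and set $S$ of $n$ leaves. $\mathrm{GPA}(\ast_n)$ is the planar algebra in which the space of discs of a given type consists of complex functions on assignments of elements of $S$ to the unshaded boundary regions (so $V_{\pm i}\cong\mathbb C[S^i]$ for $i\geq 1$), a tangle $T$ acting by $T(f_1,\dots,f_k)(l)=\sum_\sigma\prod_i f_i(\sigma|_i)$, the sum over all assignments $\sigma$ of elements of $S$ to the unshaded regions of $T$ restricting to $l$ on the outer boundary, $\sigma|_i$ being the restriction to the boundary of the $i$-th input disc. A spin model for $\mathcal V$ is a planar algebra map $\Phi:\mathcal V\to\mathrm{GPA}(\ast_n)$ for some $n$. For $X\in V_{+2}$, $C_X=(c_X(a,b))_{a,b\in S}$ is the matrix with $\Phi(X)=\sum_{a,b}c_X(a,b)\delta_{ab}$, where $a$ labels the left and $b$ the right region. The spin model is symmetric if $c_P(a,b)=c_P(b,a)$ for all $a,b\in S$, and non-symmetric otherwise; in the non-symmetric case the 180-degree rotation of $P$ is $Q\neq P$. Bisch-Jones planar algebras. These are the singly-generated Yang-Baxter planar algebras with $\dim V_{+2}=3$ and $\dim V_3\in\{9,10,11,12\}$ on the Bisch-Jones list; there is a unique one with $\dim V_3=9$, the group planar algebra of $\mathbb Z/3$. *)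

(* Defs.v *)
From HB Require Import structures.
From Stdlib Require Import Relations.
From mathcomp Require Import all_boot all_order all_fingroup all_algebra.
From mathcomp Require Import zify reals complex.

Set Implicit Arguments.
Unset Strict Implicit.
Unset Printing Implicit Defensive.

Import GRing.Theory.
Local Open Scope ring_scope.

(* A disc type (b, i) has 2i boundary points; b = true when the starred region
   is unshaded (V_{+i}), b = false when it is shaded (V_{-i}). *)
Definition dtype := (bool * nat)%type.

Definition npt (t : dtype) : nat := (t.2).*2.

(* The boundary of a disc without boundary points is one interval. *)
Definition nint (t : dtype) : nat := maxn 1 (npt t).

(* Clockwise from the star, the boundary of a disc reads: interval 0 (starred),
   point 0, interval 1, point 1, ..., point 2i-1, and back to interval 0.
   [unsh t j] says that interval j is unshaded. *)
Definition unsh (t : dtype) (j : nat) : bool := t.1 (+) odd j.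

Definition touch (t : dtype) (p : 'I_(npt t)) (j : 'I_(nint t)) : bool :=
  ((j == p :> nat) || (j == p.+1 %% npt t :> nat))%N.

(* Discs of a tangle with input discs indexed by I: None is the outer disc. *)
Definition disc_t (I : Type) (ti : I -> dtype) (t : dtype) (d : option I) :=
  if d is Some i then ti i else t.

(* A planar tangle up to isotopy, i.e. up to orientation-preserving
   diffeomorphism fixing the outer boundary, as a combinatorial cell structure
   on the sphere: k input discs, the outer disc, the strings (arcs and closed
   loops, the latter being the strings without endpoints) and the regions.
   The data are: the string at each boundary point, the region at each boundary
   interval, and the region on the unshaded (true) and the shaded (false) side
   of each string.
   - Orient strings with the unshaded side on their left. [outward] tells
     whether a string then leaves its endpoint; each string has no endpoint, or
     one endpoint of each kind.
   - Two regions are adjacent when they are the two sides of a string; as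
     consecutive intervals of a disc are, this graph on regions is connected if
     and only if the glued surface is.
   - Cutting the sphere along discs and strings, boundary components of regions
     are the connected components of the graph [bd_adj] on boundary intervals
     and sides of strings. Gluing genus 0 regions along these, the result is a
     closed oriented surface, which is a sphere if and only if it is connected
     and has Euler characteristic 2:
       #discs - #arcs + sum_r (2 - #boundary components of r) = 2. *)
Section Tangle.
Variables (I : finType) (ti : I -> dtype) (t : dtype).
Local Notation dt := (disc_t ti t).

Definition bpoint := {d : option I & 'I_(npt (dt d))}.
Definition bint := {d : option I & 'I_(nint (dt d))}.

Definition outward (x : bpoint) : bool :=
  (tag x == None) (+) unsh (dt (tag x)) (tagged x).

Section Boundary.
Variables (str : finType) (pt : forall d, 'I_(npt (dt d)) -> str).

Definition bd_touch (a : bint) (s : str * bool) : bool :=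
  [exists p : 'I_(npt (dt (tag a))),
     touch p (tagged a) && (s == (pt p, unsh (dt (tag a)) (tagged a)))].

Definition bd_adj (x y : bint + str * bool) : bool :=
  match x, y with
  | inl a, inr s | inr s, inl a => bd_touch a s
  | _, _ => false
  end.

Variables (reg : finType) (side : str -> bool -> reg).

Definition reg_adj (r r' : reg) : bool :=
  [exists s, exists b, (r == side s b) && (r' == side s (~~ b))].

End Boundary.

Record tangle := Tangle {
  str : finType;
  reg : finType;
  reg_unsh : pred reg;
  side : str -> bool -> reg;
  pt : forall d, 'I_(npt (dt d)) -> str;
  rg : forall d, 'I_(nint (dt d)) -> reg;
  side_unsh : forall s b, reg_unsh (side s b) = b;
  rg_unsh : forall d (j : 'I_(nint (dt d))), reg_unsh (rg j) = unsh (dt d) j;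
  touch_side : forall d (p : 'I_(npt (dt d))) (j : 'I_(nint (dt d))),
    touch p j -> rg j = side (pt p) (unsh (dt d) j);
  string_ends : forall (x : bpoint) (b : bool),
    exists! y : bpoint, pt (tagged y) = pt (tagged x) /\ outward y = b;
  connected : forall r r', connect (reg_adj side) r r';
  euler : (#|I|.+1 + #|reg|.*2 =
           \sum_(d : option I) (dt d).2 + n_comp (bd_adj pt) predT + 2)%N
}.

End Tangle.

Arguments str {I ti t} _.
Arguments reg {I ti t} _.
Arguments reg_unsh {I ti t} _ _.
Arguments side {I ti t} _ _ _.
Arguments pt {I ti t} _ _ _.
Arguments rg {I ti t} _ _ _.

(* T' is T with its input discs relabelled along the bijection f. *)
Definition tangle_iso (I I' : finType) (ti : I -> dtype) (t : dtype)
    (f : I' -> I) (T : tangle ti t) (T' : tangle (ti \o f) t) : Prop :=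
  bijective f /\
  exists (fs : str T -> str T') (fr : reg T -> reg T'),
    [/\ bijective fs, bijective fr,
        (forall p, pt T' None p = fs (pt T None p)) /\
        (forall i p, pt T' (Some i) p = fs (pt T (Some (f i)) p)),
        (forall j, rg T' None j = fr (rg T None j)) /\
        (forall i j, rg T' (Some i) j = fr (rg T (Some (f i)) j)) &
        (forall s b, side T' (fs s) b = fr (side T s b)) /\
        (forall r, reg_unsh T' (fr r) = reg_unsh T r)].

Definition is_identity (t : dtype) (T : tangle (fun _ : unit => t) t) : Prop :=
  [/\ bijective (pt T None), bijective (rg T None),
      forall p, pt T (Some tt) p = pt T None p &
      forall j, rg T (Some tt) j = rg T None j].

Definition is_quotient (A B : Type) (e : relation A) (q : A -> B) : Prop :=
  (forall b, exists a, q a = b) /\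
  (forall a a', q a = q a' <-> clos_refl_sym_trans A e a a').

(* T is obtained from T0 by inserting Ts i in its i-th input disc: strings and
   regions of T are those of T0 and of the Ts i, glued along the boundaries of
   the input discs of T0. A cycle of glued arcs has no endpoint left, and is
   thus a closed loop of T. *)
Section Composite.
Variables (I : finType) (J : I -> finType).
Variables (tj : forall i, J i -> dtype) (ti : I -> dtype) (t : dtype).
Variables (T0 : tangle ti t) (Ts : forall i, tangle (@tj i) (ti i)).
Variable T : tangle (fun u : {i : I & J i} => tj (tagged u)) t.

Inductive glue_str : relation (str T0 + {i : I & str (Ts i)}) :=
  GlueStr i p :
    glue_str (inl (pt T0 (Some i) p))
             (inr (Tagged (fun i => str (Ts i)) (pt (Ts i) None p))).

Inductive glue_reg : relation (reg T0 + {i : I & reg (Ts i)}) :=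
  GlueReg i j :
    glue_reg (inl (rg T0 (Some i) j))
             (inr (Tagged (fun i => reg (Ts i)) (rg (Ts i) None j))).

Definition is_composite : Prop :=
  exists (qs : str T0 + {i : I & str (Ts i)} -> str T)
         (qr : reg T0 + {i : I & reg (Ts i)} -> reg T),
    [/\ is_quotient glue_str qs, is_quotient glue_reg qr,
        (forall p, pt T None p = qs (inl (pt T0 None p))) /\
        (forall i k p, pt T (Some (Tagged J k)) p =
           qs (inr (Tagged (fun i => str (Ts i)) (pt (Ts i) (Some k) p)))),
        (forall j, rg T None j = qr (inl (rg T0 None j))) /\
        (forall i k j, rg T (Some (Tagged J k)) j =
           qr (inr (Tagged (fun i => reg (Ts i)) (rg (Ts i) (Some k) j)))) &
        [/\ forall s b, side T (qs (inl s)) b = qr (inl (side T0 s b)),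
            forall i s b, side T (qs (inr (Tagged (fun i => str (Ts i)) s))) b =
              qr (inr (Tagged (fun i => reg (Ts i)) (side (Ts i) s b))),
            forall r, reg_unsh T (qr (inl r)) = reg_unsh T0 r &
            forall i r, reg_unsh T (qr (inr (Tagged (fun i => reg (Ts i)) r))) =
              reg_unsh (Ts i) r]].

End Composite.

Record planar_algebra (F : fieldType) := PlanarAlgebra {
  space :> dtype -> lmodType F;
  act : forall (I : finType) (ti : I -> dtype) (t : dtype),
    tangle ti t -> (forall i, space (ti i)) -> space t;
  act_multilinear : forall (I : finType) (ti : I -> dtype) t (T : tangle ti t)
      (x : forall i, space (ti i)) i (a : F) (u v : space (ti i)),
    act T (dfwith x (a *: u + v)) =
    a *: act T (dfwith x u) + act T (dfwith x v);
  act_iso : forall (I I' : finType) (ti : I -> dtype) t (f : I' -> I)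
      (T : tangle ti t) (T' : tangle (ti \o f) t)
      (x : forall i, space (ti i)),
    tangle_iso T T' -> act T' (fun i => x (f i)) = act T x;
  act_identity : forall t (T : tangle (fun _ : unit => t) t) (x : space t),
    is_identity T -> act T (fun _ => x) = x;
  act_composite : forall (I : finType) (J : I -> finType)
      (tj : forall i, J i -> dtype) (ti : I -> dtype) t
      (T0 : tangle ti t) (Ts : forall i, tangle (@tj i) (ti i))
      (T : tangle (fun u : {i : I & J i} => tj _ (tagged u)) t)
      (x : forall u : {i : I & J i}, space (tj _ (tagged u))),
    is_composite T0 Ts T ->
    act T x = act T0 (fun i => act (Ts i) (fun k => x (Tagged J k)))
}.

Arguments act {F} p {I ti t} _ _.

Record planar_map (F : fieldType) (V W : planar_algebra F) := PlanarMap {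
  pmap_fun :> forall t, {linear V t -> W t};
  pmap_act : forall (I : finType) (ti : I -> dtype) t (T : tangle ti t)
      (x : forall i, V (ti i)),
    pmap_fun t (act V T x) = act W T (fun i => pmap_fun (ti i) (x i))
}.

Definition isomorphic (F : fieldType) (V W : planar_algebra F) : Prop :=
  exists f : planar_map V W, forall t, bijective (f t).

Lemma prod_sum_fprod (R : comPzRingType) (I : finType) (T_ : I -> finType)
    (P_ : forall i, pred (T_ i)) (G : forall i, T_ i -> R) :
  \prod_i \sum_(x | P_ i x) G i x =
  \sum_(f : fprod T_ | [forall i, P_ i (f i)]) \prod_i G i (f i).
Proof.
pose H i := [ffun x : T_ i => if P_ i x then G i x else 0].
transitivity (\prod_i \sum_(x : T_ i) H i x).
  apply: eq_bigr => i _; rewrite big_mkcond.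
  by apply: eq_bigr => x _; rewrite ffunE.
rewrite [RHS]big_mkcond /=.
transitivity (\sum_(f : fprod T_) \prod_i H i (f i)); last first.
  apply: eq_bigr => f _; case: ifPn => [/forallP Pf|].
    by apply: eq_bigr => i _; rewrite ffunE Pf.
  rewrite negb_forall => /existsP[i /negPf Pi].
  by rewrite (bigD1 i) //= ffunE Pi mul0r.
rewrite big_fprod.
transitivity (\prod_i \sum_(j in tagged_with T_ i) untag 0 (H i) j).
  by apply: eq_bigr => i _; rewrite (big_tag (fun i x => H i x) i).
by rewrite bigA_distr_big_dep.
Qed.

Section SpinPlanarAlgebra.
Variables (F : fieldType) (S : finType).

(* The unshaded boundary intervals of a disc. *)
Definition ubd (t : dtype) : finType := {j : 'I_(nint t) | unsh t j}.

Definition mk_ubd t (j : 'I_(nint t)) (h : unsh t j) : ubd t := exist _ j h.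

(* The functions on assignments of elements of S to the unshaded boundary
   intervals; V_{-0} is one-dimensional and V_{+0} is F^S. *)
Definition spin_space (t : dtype) : lmodType F :=
  {ffun {ffun ubd t -> S} -> F^o}.

Section Restriction.
Variables (I : finType) (ti : I -> dtype) (t : dtype) (T : tangle ti t).

Definition ureg : finType := {r : reg T | reg_unsh T r}.

Definition mk_ureg (r : reg T) (h : reg_unsh T r) : ureg := exist _ r h.

Definition urg (d : option I) (j : ubd (disc_t ti t d)) : ureg :=
  mk_ureg (etrans (rg_unsh T (val j)) (valP j)).

Definition restr (d : option I) (s : {ffun ureg -> S}) :
    {ffun ubd (disc_t ti t d) -> S} :=
  [ffun j => s (urg j)].

End Restriction.

Definition spin_act (I : finType) (ti : I -> dtype) (t : dtype)
    (T : tangle ti t) (f : forall i, spin_space (ti i)) : spin_space t :=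
  [ffun l : {ffun ubd t -> S} =>
     \sum_(s : {ffun ureg T -> S} | restr None s == l)
       \prod_(i : I) f i (restr (Some i) s)].

Lemma spin_act_multilinear (I : finType) (ti : I -> dtype) t
    (T : tangle ti t) (x : forall i, spin_space (ti i)) i (a : F)
    (u v : spin_space (ti i)) :
  spin_act T (dfwith x (a *: u + v)) =
  a *: spin_act T (dfwith x u) + spin_act T (dfwith x v).
Proof.
apply/ffunP => l; rewrite !ffunE scaler_sumr -big_split /=.
apply: eq_bigr => s _.
rewrite !(bigD1 i (P := xpredT)) //= !dfwith_in !ffunE.
have E (w : spin_space (ti i)) : \prod_(j | j != i) dfwith x w j (restr (Some j) s)
         = \prod_(j | j != i) x j (restr (Some j) s).
  apply: eq_bigr => j ji. by rewrite dfwith_out // eq_sym.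
by rewrite !E mulrDl -mulrA.
Qed.

Lemma spin_act_iso (I I' : finType) (ti : I -> dtype) t (f : I' -> I)
    (T : tangle ti t) (T' : tangle (ti \o f) t)
    (x : forall i, spin_space (ti i)) :
  tangle_iso T T' -> spin_act T' (fun i => x (f i)) = spin_act T x.
Proof.
case=> bf [fs [fr [_ [gr frK grK] _ [rN rS] [_ ru]]]].
apply/ffunP => l; rewrite !ffunE.
have gu (r : ureg T') : reg_unsh T (gr (val r)).
  by rewrite -ru grK; apply: valP.
have fu (r : ureg T) : reg_unsh T' (fr (val r)).
  by rewrite ru; apply: valP.
pose h (s : {ffun ureg T -> S}) : {ffun ureg T' -> S} :=
  [ffun r => s (mk_ureg (gu r))].
pose h' (s : {ffun ureg T' -> S}) : {ffun ureg T -> S} :=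
  [ffun r => s (mk_ureg (fu r))].
have hK : cancel h h'.
  move=> s; apply/ffunP => r; rewrite !ffunE; congr (s _).
  by apply: val_inj; rewrite /= frK.
have h'K : cancel h' h.
  move=> s; apply/ffunP => r; rewrite !ffunE; congr (s _).
  by apply: val_inj; rewrite /= grK.
rewrite (reindex h) /=; last by exists h' => ? _.
have hN s : restr None (h s) = restr None s.
  apply/ffunP => j; rewrite !ffunE; congr (s _); apply: val_inj => /=.
  by rewrite rN frK.
have hS s i : restr (Some i) (h s) = restr (Some (f i)) s.
  apply/ffunP => j; rewrite !ffunE; congr (s _); apply: val_inj => /=.
  by rewrite rS frK.
apply: eq_big => [s|s _]; first by rewrite hN.
rewrite [RHS](reindex f) /=; last exact: onW_bij.
by apply: eq_bigr => i _; rewrite hS.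
Qed.

Lemma spin_act_identity t (T : tangle (fun _ : unit => t) t)
    (x : spin_space t) :
  is_identity T -> spin_act T (fun _ => x) = x.
Proof.
case=> _ [g fK gK] _ rS; apply/ffunP => l; rewrite !ffunE.
have gu (r : ureg T) : unsh t (g (val r)).
  by have := rg_unsh T (d := None) (g (val r)); rewrite gK => <-; apply: valP.
pose l' : {ffun ureg T -> S} := [ffun r => l (mk_ubd (gu r))].
have E s : (restr None s == l) = (s == l').
  apply/eqP/eqP => e; apply/ffunP => r.
    by rewrite ffunE -e ffunE; congr (s _); apply: val_inj; rewrite /= gK.
  by rewrite e !ffunE; congr (l _); apply: val_inj; rewrite /= fK.
rewrite (eq_bigl _ _ E) big_pred1_eq.
rewrite (bigD1 tt) //= big1 ?mulr1; last by case.
congr (x _); have /eqP <- : restr None l' == l by rewrite E.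
apply/ffunP => j; rewrite !ffunE; congr (l _); apply: val_inj => /=.
by rewrite rS.
Qed.

Section SpinComposite.
Variables (I : finType) (J : I -> finType).
Variables (tj : forall i, J i -> dtype) (ti : I -> dtype) (t : dtype).
Variables (T0 : tangle ti t) (Ts : forall i, tangle (@tj i) (ti i)).
Variable T : tangle (fun u : {i : I & J i} => tj (tagged u)) t.
Local Notation regs := (fun i => reg (Ts i)).
Variable qr : reg T0 + {i : I & reg (Ts i)} -> reg T.
Hypothesis qrP : is_quotient (@glue_reg I J tj ti t T0 Ts) qr.
Hypothesis rN : forall j, rg T None j = qr (inl (rg T0 None j)).
Hypothesis rS : forall i k j, rg T (Some (Tagged J k)) j =
  qr (inr (Tagged regs (rg (Ts i) (Some k) j))).
Hypothesis u0 : forall r, reg_unsh T (qr (inl r)) = reg_unsh T0 r.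
Hypothesis u1 : forall i r, reg_unsh T (qr (inr (Tagged regs r))) =
  reg_unsh (Ts i) r.

Definition pull0 (s : {ffun ureg T -> S}) : {ffun ureg T0 -> S} :=
  [ffun r => s (mk_ureg (etrans (u0 (val r)) (valP r)))].

Definition pull1 (s : {ffun ureg T -> S}) i : {ffun ureg (Ts i) -> S} :=
  [ffun r => s (mk_ureg (etrans (u1 (val r)) (valP r)))].

Definition state (s0 : {ffun ureg T0 -> S})
    (s1 : forall i, {ffun ureg (Ts i) -> S})
    (y : reg T0 + {i : I & reg (Ts i)}) : option S :=
  match y with
  | inl r => omap s0 (insub r)
  | inr u => omap (s1 (tag u)) (insub (tagged u))
  end.

Lemma state_glue s0 s1 :
  (forall i, restr None (s1 i) = restr (Some i) s0) ->
  forall y y', qr y = qr y' -> state s0 s1 y = state s0 s1 y'.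
Proof.
move=> c y y' /(qrP.2 y y'); elim=> {y y'} [_ _ [i j]|//|x y _ -> //|].
  rewrite /=; case: (boolP (unsh (ti i) j)) => uj; last first.
    rewrite !insubN //=.
      by rewrite (@rg_unsh _ _ _ (Ts i) None).
    by rewrite (@rg_unsh _ _ _ T0 (Some i)).
  have /ffunP/(_ (mk_ubd uj)) := c i; rewrite !ffunE.
  have -> : insub (rg T0 (Some i) j) =
      Some (urg T0 (d := Some i) (mk_ubd uj)).
    exact: (valK (urg T0 (d := Some i) (mk_ubd uj))).
  have -> : insub (rg (Ts i) None j) =
      Some (urg (Ts i) (d := None) (mk_ubd uj)).
    exact: (valK (urg (Ts i) (d := None) (mk_ubd uj))).
  by move=> /= ->.
by move=> x y z _ -> _ ->.
Qed.

Lemma state_ex s0 s1 (r : ureg T) :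
  exists v, [exists y, (qr y == val r) && (state s0 s1 y == Some v)].
Proof.
have [y qy] := qrP.1 (val r); have := valP r; rewrite -qy.
case: y qy => [a|[i a]] qy ua.
  rewrite u0 in ua; exists (s0 (mk_ureg ua)).
  apply/existsP; exists (inl a); rewrite qy eqxx /= insubT /=.
  by apply/eqP; congr (Some (s0 _)); apply: val_inj.
rewrite u1 in ua; exists (s1 i (mk_ureg ua)).
apply/existsP; exists (inr (Tagged regs a)); rewrite qy eqxx /= insubT /=.
by apply/eqP; congr (Some (s1 i _)); apply: val_inj.
Qed.

Definition push s0 s1 : {ffun ureg T -> S} :=
  [ffun r => xchoose (state_ex s0 s1 r)].

Lemma pushE s0 s1 (r : ureg T) y :
  (forall i, restr None (s1 i) = restr (Some i) s0) ->
  qr y = val r -> state s0 s1 y = Some (push s0 s1 r).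
Proof.
move=> c qy; rewrite ffunE.
have /existsP[y' /andP[/eqP qy' /eqP <-]] := xchooseP (state_ex s0 s1 r).
by apply: state_glue; rewrite ?qy ?qy'.
Qed.

Lemma pull_compat s i : restr None (pull1 s i) = restr (Some i) (pull0 s).
Proof.
apply/ffunP => j; rewrite !ffunE; congr (s _); apply: val_inj => /=.
by apply/qrP.2; apply: rst_sym; apply: rst_step; constructor.
Qed.

Lemma push_pull s s1 :
  (forall i, s1 i = pull1 s i) -> push (pull0 s) s1 = s.
Proof.
move=> e1; have c i : restr None (s1 i) = restr (Some i) (pull0 s).
  by rewrite e1 pull_compat.
apply/ffunP => r; apply/Some_inj.
have [y qy] := qrP.1 (val r).
rewrite -(pushE c qy).
have := valP r; rewrite -qy.
case: y qy => [a|[i a]] qy ua /=.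
  rewrite u0 in ua; rewrite insubT /= ffunE; congr (Some (s _)).
  exact: val_inj.
rewrite u1 in ua; rewrite insubT /= e1 ffunE; congr (Some (s _)).
exact: val_inj.
Qed.

Lemma pull0_push s0 s1 :
  (forall i, restr None (s1 i) = restr (Some i) s0) ->
  pull0 (push s0 s1) = s0.
Proof.
move=> c; apply/ffunP => r; rewrite ffunE; apply/Some_inj.
by rewrite -(pushE c (y := inl (val r))) //= valK.
Qed.

Lemma pull1_push s0 s1 i :
  (forall i, restr None (s1 i) = restr (Some i) s0) ->
  pull1 (push s0 s1) i = s1 i.
Proof.
move=> c; apply/ffunP => r; rewrite ffunE; apply/Some_inj.
by rewrite -(pushE c (y := inr (Tagged regs (val r)))) //= valK.
Qed.

Lemma spin_act_composite_aux
    (x : forall u : {i : I & J i}, spin_space (tj (tagged u))) :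
  spin_act T x =
  spin_act T0 (fun i => spin_act (Ts i) (fun k => x (Tagged J k))).
Proof.
apply/ffunP => l; rewrite !ffunE.
under [RHS]eq_bigr => s0 _.
  under eq_bigr => i _ do rewrite ffunE.
  rewrite (prod_sum_fprod
    (fun i (s1 : {ffun ureg (Ts i) -> S}) => restr None s1 == restr (Some i) s0)).
  over.
rewrite /= pair_big_dep /=.
pose fpr (s1 : fprod (fun i => {ffun ureg (Ts i) -> S})) i := s1 i.
rewrite (reindex (fun s => (pull0 s, [fprod i => pull1 s i]))) /=; last first.
  exists (fun p => push p.1 (fpr p.2)) => [s _|[s0 s1]] /=.
    by apply: push_pull => i; rewrite /fpr fprodE.
  rewrite unfold_in /= => /andP[_ /forallP c].
  have c' i : restr None (fpr s1 i) = restr (Some i) s0 by apply/eqP/c.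
  rewrite pull0_push //; congr pair; apply/fprodP => i.
  by rewrite fprodE pull1_push.
apply: eq_big => [s|s _].
  have -> : [forall i, restr None ([fprod i => pull1 s i] i) ==
                       restr (Some i) (pull0 s)].
    by apply/forallP => i; rewrite fprodE pull_compat.
  rewrite andbT; congr (_ == _); apply/ffunP => j; rewrite !ffunE.
  by congr (s _); apply: val_inj; rewrite /= rN.
rewrite sig_big_dep /=; apply: eq_big => // -[i k] _.
rewrite fprodE; congr (x _ _); apply/ffunP => j; rewrite !ffunE.
by congr (s _); apply: val_inj; rewrite /= rS.
Qed.

End SpinComposite.

End SpinPlanarAlgebra.

Lemma spin_act_composite (F : fieldType) (S I : finType) (J : I -> finType)
    (tj : forall i, J i -> dtype) (ti : I -> dtype) t
    (T0 : tangle ti t) (Ts : forall i, tangle (@tj i) (ti i))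
    (T : tangle (fun u : {i : I & J i} => tj _ (tagged u)) t)
    (x : forall u : {i : I & J i}, spin_space F S (tj _ (tagged u))) :
  is_composite T0 Ts T ->
  spin_act T x =
  spin_act T0 (fun i => spin_act (Ts i) (fun k => x (Tagged J k))).
Proof.
case=> qs [qr [_ qrP _ [rN rS] [_ _ u0 u1]]].
exact: (spin_act_composite_aux qrP rN rS u0 u1).
Qed.

(* GPA of the star graph with set of leaves S. *)
Definition GPA (F : fieldType) (S : finType) : planar_algebra F :=
  @PlanarAlgebra F (spin_space F S) (@spin_act F S)
    (@spin_act_multilinear F S) (@spin_act_iso F S)
    (@spin_act_identity F S) (@spin_act_composite F S).

(* The group planar algebra of G, as the fixed points of the action of G on
   GPA(G) induced by its left regular action. *)
Section GroupPlanarAlgebra.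
Variables (F : fieldType) (G : finGroupType).

Definition translate (A : finType) (g : G) (l : {ffun A -> G}) :
    {ffun A -> G} :=
  [ffun j => (g * l j)%g].

Definition translation_invariant (t : dtype) : {pred spin_space F G t} :=
  [pred f : {ffun {ffun ubd t -> G} -> F^o} |
     [forall g, forall l, f (translate g l) == f l]].

Lemma invP t (f : spin_space F G t) :
  reflect (forall g l, f (translate g l) = f l) (f \in @translation_invariant t).
Proof.
apply: (iffP idP) => [/forallP h g l|h]; first by have /forallP/(_ l)/eqP := h g.
by apply/forallP => g; apply/forallP => l; apply/eqP.
Qed.

Lemma translation_invariant_submod t : submod_closed (@translation_invariant t).
Proof.
split; first by apply/invP => g l; rewrite !ffunE.
move=> a u v /invP hu /invP hv; apply/invP => g l.
by rewrite !ffunE hu hv.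
Qed.

HB.instance Definition _ t := GRing.isSubmodClosed.Build F (spin_space F G t)
  (@translation_invariant t) (translation_invariant_submod t).

Record group_space_type (t : dtype) := GroupSpace {
  group_fun :> spin_space F G t;
  _ : group_fun \in @translation_invariant t
}.

HB.instance Definition _ t := [isSub for @group_fun t].
HB.instance Definition _ t := [Choice of group_space_type t by <:].
HB.instance Definition _ t :=
  [SubChoice_isSubLmodule of group_space_type t by <:].

Definition group_space (t : dtype) : lmodType F := group_space_type t.

Lemma translateK (A : finType) g :
  cancel (@translate A g) (translate (g^-1)%g).
Proof. by move=> l; apply/ffunP => j; rewrite !ffunE mulKg. Qed.

Lemma group_act_subproof (I : finType) (ti : I -> dtype) (t : dtype)
    (T : tangle ti t) (x : forall i, group_space (ti i)) :
  spin_act T (fun i => val (x i)) \in @translation_invariant t.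
Proof.
apply/invP => g l; rewrite !ffunE.
rewrite (reindex (translate g)); last first.
  apply: onW_bij; exists (translate g^-1)%g; first exact: translateK.
  by move=> s; rewrite -{1}[g]invgK translateK.
have E d s : restr (T := T) d (translate g s) = translate g (restr d s).
  by apply/ffunP => j; rewrite !ffunE.
apply: eq_big => [s|s _]; first by rewrite E (can_eq (translateK g)).
by apply: eq_bigr => i _; rewrite E; have /invP -> := valP (x i).
Qed.

Definition group_act (I : finType) (ti : I -> dtype) (t : dtype)
    (T : tangle ti t) (x : forall i, group_space (ti i)) : group_space t :=
  GroupSpace (group_act_subproof T x).

Lemma spin_act_ext (S I : finType) (ti : I -> dtype) t (T : tangle ti t)
    (x y : forall i, spin_space F S (ti i)) :
  (forall i, x i = y i) -> spin_act T x = spin_act T y.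
Proof.
move=> e; apply/ffunP => l; rewrite !ffunE; apply: eq_bigr => s _.
by apply: eq_bigr => i _; rewrite e.
Qed.

Lemma group_act_multilinear (I : finType) (ti : I -> dtype) t
    (T : tangle ti t) (x : forall i, group_space (ti i)) i (a : F)
    (u v : group_space (ti i)) :
  group_act T (dfwith x (a *: u + v)) =
  a *: group_act T (dfwith x u) + group_act T (dfwith x v).
Proof.
have E w : spin_act T (fun j => val (dfwith x w j)) =
    spin_act T (dfwith (fun j => val (x j)) (val w : spin_space F G (ti i))).
  apply: spin_act_ext => j; case: (eqVneq i j) => [<-|ij].
    by rewrite !dfwith_in.
  by rewrite !dfwith_out.
by apply: val_inj; rewrite /= !E spin_act_multilinear.
Qed.

Lemma group_act_iso (I I' : finType) (ti : I -> dtype) t (f : I' -> I)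
    (T : tangle ti t) (T' : tangle (ti \o f) t)
    (x : forall i, group_space (ti i)) :
  tangle_iso T T' -> group_act T' (fun i => x (f i)) = group_act T x.
Proof.
by move=> h; apply: val_inj; apply: (spin_act_iso (fun i => val (x i)) h).
Qed.

Lemma group_act_identity t (T : tangle (fun _ : unit => t) t)
    (x : group_space t) :
  is_identity T -> group_act T (fun _ => x) = x.
Proof. by move=> h; apply: val_inj; apply: spin_act_identity. Qed.

Lemma group_act_composite (I : finType) (J : I -> finType)
    (tj : forall i, J i -> dtype) (ti : I -> dtype) t
    (T0 : tangle ti t) (Ts : forall i, tangle (@tj i) (ti i))
    (T : tangle (fun u : {i : I & J i} => tj _ (tagged u)) t)
    (x : forall u : {i : I & J i}, group_space (tj _ (tagged u))) :
  is_composite T0 Ts T ->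
  group_act T x =
  group_act T0 (fun i => group_act (Ts i) (fun k => x (Tagged J k))).
Proof.
move=> h; apply: val_inj.
exact: (spin_act_composite (fun u => val (x u)) h).
Qed.

Definition group_planar_algebra : planar_algebra F :=
  PlanarAlgebra group_act_multilinear group_act_iso group_act_identity
    group_act_composite.

End GroupPlanarAlgebra.

Lemma bd_adj_sym (I : finType) (ti : I -> dtype) t (str : finType)
    (pt : forall d, 'I_(npt (disc_t ti t d)) -> str) :
  symmetric (bd_adj pt).
Proof. by move=> [a|s] [b|u]. Qed.

Lemma reg_adj_sym (str reg : finType) (side : str -> bool -> reg) :
  symmetric (reg_adj side).
Proof.
move=> r r'; rewrite /reg_adj; apply: eq_existsb => s.
by apply/existsP/existsP => -[b /andP[h h']]; exists (~~ b); rewrite negbK h h'.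
Qed.

Lemma n_comp_label (T : finType) (e : rel T) (B : nat) (f : T -> 'I_B)
    (g : 'I_B -> T) :
  symmetric e -> (forall x y, e x y -> f x = f y) -> cancel g f ->
  (forall x, connect e x (g (f x))) -> n_comp e predT = B.
Proof.
move=> se fe gK xg.
have ce : connect_sym e by apply: sym_connect_sym.
have fc x y : connect e x y -> f x = f y.
  by case/connectP => p; elim: p x => [|z p IH] x /=; [move=> _ -> |
    case/andP => /fe -> /IH h /h].
rewrite /n_comp_mem -[RHS]card_ord -(@card_in_image _ _ f) => [|x y].
  apply: eq_card => k; rewrite !inE; apply/imageP.
  exists (fingraph.root e (g k)).
    by rewrite !inE /= roots_root.
  by rewrite -(fc _ _ (connect_root e (g k))) gK.
rewrite !inE !andbT => /eqP rx /eqP ry fxy.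
rewrite -rx -ry; apply/(fingraph.rootP ce).
apply: connect_trans (xg x) _; rewrite fxy ce; exact: xg.
Qed.

Section Diagram.
Local Open Scope nat_scope.

Definition reach (D : eqType) (ec : rel D) (all_ : seq D) (n : nat) (x : D) :=
  iter n (fun L => undup (L ++ [seq y <- all_ | has (fun z => ec z y) L])) [:: x].

Lemma reach_connect (T : finType) (D : eqType) (code : T -> D) (e : rel T)
    (ec : rel D) (all_ : seq D) :
  injective code -> (forall c, c \in all_ -> exists y, code y = c) ->
  (forall x y, ec (code x) (code y) -> e x y) ->
  forall n x y, code y \in reach ec all_ n (code x) -> connect e x y.
Proof.
move=> ci cs ce; elim=> [|n IH] x y /=.
  by rewrite inE => /eqP/ci ->.
rewrite mem_undup mem_cat => /orP[/IH //|].
rewrite mem_filter => /andP[/hasP[c cL cy] _].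
have [z zc] : exists z, code z = c.
  elim: n c cL {IH cy} => [|n IH] c /=; first by rewrite inE => /eqP ->; exists x.
  by rewrite mem_undup mem_cat => /orP[/IH //|]; rewrite mem_filter => /andP[_ /cs].
rewrite -zc in cL cy.
exact: connect_trans (IH _ _ cL) (connect1 (ce _ _ cy)).
Qed.

(* A tangle with k input discs of the same type, given by tables: disc 0 is the
   outer disc, disc i.+1 is the i-th input disc; regions r < u are the unshaded
   ones.
   - pts: for each disc, the strings at points 0, 1, ...
   - rgs: for each disc, the regions at intervals 0, 1, ...
   - sds: for each string, its unshaded and its shaded region.
   - lab: an enumeration of the boundary components of regions. *)
Variables (k : nat) (tin t : dtype).
Variables (u : nat) (nreg : nat).
Variables (pts rgs : seq (seq nat)) (sds : seq (nat * nat)).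
Variables (B : nat) (lab : nat * nat + nat * bool -> nat).

Let P d p := nth 0%N (nth [::] pts d) p.
Let R d j := nth 0%N (nth [::] rgs d) j.
Let Sd s (b : bool) := let x := nth (0, 0)%N sds s in if b then x.1 else x.2.
Let nstr := size sds.
Let dtn d := if d is 0 then t else tin.
Let touchn d p j := (j == p) || (j == (p.+1 %% npt (dtn d))%N).
Let points := [seq (d, p) | d <- iota 0 k.+1, p <- iota 0 (npt (dtn d))].
Let ints := [seq (d, j) | d <- iota 0 k.+1, j <- iota 0 (nint (dtn d))].
Let bools := [:: true; false].
Let outn (x : nat * nat) := (x.1 == 0)%N (+) unsh (dtn x.1) x.2.
Let bnodes : seq (nat * nat + nat * bool) :=
  [seq inl x | x <- ints] ++
  [seq inr (s, b) | s <- iota 0 nstr, b <- bools].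
Let bdn_touch (a : nat * nat) (s : nat * bool) :=
  has (fun p => touchn a.1 p a.2 && (s == (P a.1 p, unsh (dtn a.1) a.2)))
    (iota 0 (npt (dtn a.1))).
Let bdn_adj (x y : nat * nat + nat * bool) :=
  match x, y with
  | inl a, inr s | inr s, inl a => bdn_touch a s
  | _, _ => false
  end.
Let regn_adj r r' :=
  has (fun s => has (fun b => (r == Sd s b) && (r' == Sd s (~~ b))) bools)
    (iota 0 nstr).
Let rep l := nth (inl (0, 0)%N) bnodes (find (fun x => lab x == l) bnodes).

Definition diagram_ok : bool :=
  [&& all (fun x => P x.1 x.2 < nstr) points,
      all (fun x => R x.1 x.2 < nreg) ints,
      all (fun s => all (fun b =>
        (Sd s b < nreg) && ((Sd s b < u) == b)) bools) (iota 0 nstr),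
      all (fun x => (R x.1 x.2 < u) == unsh (dtn x.1) x.2) ints,
      all (fun x => all (fun j => touchn x.1 x.2 j ==>
        (R x.1 j == Sd (P x.1 x.2) (unsh (dtn x.1) j)))
        (iota 0 (nint (dtn x.1)))) points,
      all (fun x => all (fun b => has (fun y =>
        (P y.1 y.2 == P x.1 x.2) && (outn y == b)) points) bools) points,
      all (fun x => all (fun y => (P y.1 y.2 == P x.1 x.2) &&
        (outn y == outn x) ==> (y == x)) points) points,
      all (fun r => r \in reach regn_adj (iota 0 nreg) nreg 0%N) (iota 0 nreg),
      all (fun x => lab x < B) bnodes,
      all (fun x => all (fun y => bdn_adj x y ==> (lab x == lab y)) bnodes)
        bnodes,
      all (fun l => has (fun x => lab x == l) bnodes) (iota 0 B),
      all (fun x => x \in reach bdn_adj bnodes (size bnodes) (rep (lab x)))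
        bnodes &
      (k.+1 + nreg.*2 == t.2 + k * tin.2 + B + 2)%N].

Hypothesis ok : diagram_ok.

Local Notation ti := (fun _ : 'I_k => tin).
Local Notation dt := (disc_t ti t).

Definition dnum (d : option 'I_k) : nat := if d is Some i then i.+1 else 0%N.

Lemma dnum_inj : injective dnum.
Proof. by move=> [i|] [j|] //= [/val_inj ->]. Qed.

Lemma dnum_lt d : dnum d < k.+1. Proof. by case: d => //= i; rewrite ltnS. Qed.

Lemma dtnE d : dtn (dnum d) = dt d. Proof. by case: d. Qed.

Lemma dnum_ex n : (n < k.+1)%N -> exists d, dnum d = n.
Proof.
by case: n => [|n] h; [exists None | exists (Some (Ordinal (h : n < k)%N))].
Qed.

Lemma in_points d (p : 'I_(npt (dt d))) : (dnum d, val p) \in points.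
Proof.
apply/flatten_mapP; exists (dnum d); first by rewrite mem_iota dnum_lt.
by apply/mapP; exists (val p); rewrite // mem_iota dtnE /=.
Qed.

Lemma in_ints d (p : 'I_(nint (dt d))) : (dnum d, val p) \in ints.
Proof.
apply/flatten_mapP; exists (dnum d); first by rewrite mem_iota dnum_lt.
by apply/mapP; exists (val p); rewrite // mem_iota dtnE /=.
Qed.

Lemma points_ex x : x \in points ->
  exists y : bpoint ti t, (dnum (tag y), val (tagged y)) = x.
Proof.
case/flatten_mapP => n hn /mapP[p hp ->]; move: hn hp.
rewrite !mem_iota !add0n => /dnum_ex[d <-].
by rewrite dtnE => hp; exists (Tagged (fun d => 'I_(npt (dt d))) (Ordinal hp)).
Qed.

Lemma ints_ex x : x \in ints ->
  exists y : bint ti t, (dnum (tag y), val (tagged y)) = x.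
Proof.
case/flatten_mapP => n hn /mapP[p hp ->]; move: hn hp.
rewrite !mem_iota !add0n => /dnum_ex[d <-].
by rewrite dtnE => hp; exists (Tagged (fun d => 'I_(nint (dt d))) (Ordinal hp)).
Qed.

Lemma in_bools (b : bool) : b \in bools. Proof. by case: b. Qed.

Lemma ptP d (p : 'I_(npt (dt d))) : P (dnum d) p < nstr.
Proof. by case/andP: ok => /allP/(_ _ (in_points p)). Qed.

Lemma rgP d (p : 'I_(nint (dt d))) : R (dnum d) p < nreg.
Proof. by case/and3P: ok => _ /allP/(_ _ (in_ints p)). Qed.

Lemma sdP (s : 'I_nstr) b : (Sd s b < nreg) && ((Sd s b < u) == b).
Proof.
case/and4P: ok => _ _ + _ => /allP/(_ (val s)).
by rewrite mem_iota ltn_ord => /(_ isT) /allP; apply; apply: in_bools.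
Qed.

Definition dpt d (p : 'I_(npt (dt d))) : 'I_nstr := Ordinal (ptP p).
Definition drg d (p : 'I_(nint (dt d))) : 'I_nreg := Ordinal (rgP p).
Definition dside (s : 'I_nstr) b : 'I_nreg := Ordinal (proj1 (andP (sdP s b))).

Lemma dside_unsh s b : (val (dside s b) < u) = b.
Proof. by case/andP: (sdP s b) => _ /eqP. Qed.

Lemma drg_unsh d (j : 'I_(nint (dt d))) : (val (drg j) < u) = unsh (dt d) j.
Proof.
case/and5P: ok => _ _ _ /allP/(_ _ (in_ints j))/eqP /= -> _.
by rewrite dtnE.
Qed.

Lemma dtouch_side d (p : 'I_(npt (dt d))) (j : 'I_(nint (dt d))) :
  touch p j -> drg j = dside (dpt p) (unsh (dt d) j).
Proof.
move=> tpj; apply: val_inj => /=.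
case/and5P: ok => _ _ _ _ /andP[/allP/(_ _ (in_points p))/allP/(_ (val j)) + _].
rewrite mem_iota /= dtnE ltn_ord => /(_ isT)/implyP.
by rewrite /touchn dtnE => /(_ tpj)/eqP.
Qed.

Lemma outnE (x : bpoint ti t) : outn (dnum (tag x), val (tagged x)) = outward x.
Proof. by rewrite /outn /outward /= dtnE; case: x => -[]. Qed.

Lemma dstring_ends (x : bpoint ti t) (b : bool) :
  exists! y : bpoint ti t, dpt (tagged y) = dpt (tagged x) /\ outward y = b.
Proof.
case/and5P: ok => _ _ _ _ /and4P[_ e1 e2 _].
have := allP e1 _ (in_points (tagged x)) => /allP/(_ _ (in_bools b))/hasP[c].
case/points_ex => y <- /andP[/eqP h1 /eqP h2].
have py : dpt (tagged y) = dpt (tagged x) by apply: val_inj.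
exists y; split=> [|z [pz oz]]; first by split=> //; rewrite -outnE.
have := allP e2 _ (in_points (tagged y)) => /allP/(_ _ (in_points (tagged z))).
rewrite -[P _ _]/(val (dpt (tagged z))) -[P (dnum (tag y)) _]/(val (dpt (tagged y))).
rewrite pz py eqxx /= !outnE oz -outnE h2 eqxx => /eqP [] e1' e2'.
case: y z e1' e2' {h1 h2 py pz oz} => [d p] [d' p'] /= /dnum_inj e; subst d'.
by move/val_inj ->.
Qed.

Lemma dreg_adj (r r' : 'I_nreg) : regn_adj r r' -> reg_adj dside r r'.
Proof.
case/hasP => s; rewrite mem_iota add0n => /andP[_ hs] /hasP[b _ h].
by apply/existsP; exists (Ordinal hs); apply/existsP; exists b; exact: h.
Qed.

Lemma dconnected r r' : connect (reg_adj dside) r r'.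
Proof.
have cs := reg_adj_sym dside.
have ce : connect_sym (reg_adj dside).
  by apply: sym_connect_sym.
case/and5P: ok => _ _ _ _ /and5P[_ _ _ /allP h _].
have n0 : (0 < nreg)%N by apply: leq_ltn_trans (ltn_ord r).
have h' x : connect (reg_adj dside) (Ordinal n0) x.
  apply: (@reach_connect _ _ val _ regn_adj (iota 0 nreg) _ _ _ nreg).
  - exact: val_inj.
  - by move=> c; rewrite mem_iota add0n => hc; exists (Ordinal hc).
  - exact: dreg_adj.
  - by apply: h; rewrite mem_iota ltn_ord.
by apply: connect_trans (h' r'); rewrite ce.
Qed.

Definition code (x : bint ti t + 'I_nstr * bool) : nat * nat + nat * bool :=
  match x with
  | inl a => inl (dnum (tag a), val (tagged a))
  | inr s => inr (val s.1, s.2)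
  end.

Lemma code_inj : injective code.
Proof.
move=> [[d j]|[s b]] [[d' j']|[s' b']] //= [].
  by move=> /dnum_inj e; subst d' => /val_inj ->.
by move=> /val_inj -> ->.
Qed.

Lemma code_in x : code x \in bnodes.
Proof.
rewrite mem_cat; case: x => [a|[s b]] /=.
  by rewrite map_f // in_ints.
apply/orP; right; apply/flatten_mapP; exists (val s).
  by rewrite mem_iota /= add0n ltn_ord.
by case: b; rewrite /= !inE eqxx ?orbT.
Qed.

Lemma code_ex c : c \in bnodes -> exists x, code x = c.
Proof.
rewrite mem_cat => /orP[/mapP[a /ints_ex[y <-] ->]|/flatten_mapP[s hs /mapP[b _ ->]]].
  by exists (inl y).
by move: hs; rewrite mem_iota /= add0n => hs; exists (inr (Ordinal hs, b)).
Qed.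

Lemma code_adj x y : bdn_adj (code x) (code y) = bd_adj dpt x y.
Proof.
have H (a : bint ti t) (s : 'I_nstr * bool) :
    bdn_touch (dnum (tag a), val (tagged a)) (val s.1, s.2) =
    bd_touch dpt a s.
  apply/hasP/existsP => [[p]|[p]] /=.
    rewrite mem_iota dtnE => hp; rewrite /touchn dtnE => /andP[h1 h2].
    exists (Ordinal hp); rewrite {1}/touch h1 /=; case: s h2 => s b.
    by move=> /eqP [h3 h4]; apply/eqP; congr pair => //; apply: val_inj.
  move=> /andP[h1 /eqP ->]; exists (val p); first by rewrite mem_iota dtnE ltn_ord.
  by rewrite /touchn dtnE /=; rewrite /touch in h1; rewrite h1 eqxx.
by case: x y => [a|s] [a'|s'] //=; apply: H.
Qed.

Lemma dn_comp : n_comp (bd_adj dpt) predT = B.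
Proof.
case/and5P: ok => _ _ _ _ /and5P[_ _ _ _ /and5P[/allP h1 /allP h2 /allP h3 /allP h4 _]].
pose f x : 'I_B := Ordinal (h1 _ (code_in x)).
have hrep (l : 'I_B) : rep l \in bnodes /\ lab (rep l) = l.
  have hl : has (fun x => lab x == l) bnodes by apply: h3; rewrite mem_iota ltn_ord.
  by split; [rewrite mem_nth // -has_find | apply/eqP; exact: (nth_find _ hl)].
have rex (l : 'I_B) : exists x, code x == rep l.
  by have [/code_ex[x <-] _] := hrep l; exists x.
apply: (@n_comp_label _ _ _ f (fun l => xchoose (rex l))).
- exact: bd_adj_sym.
- move=> x y; rewrite -code_adj => xy; apply: val_inj => /=; apply/eqP.
  by have /allP/(_ _ (code_in y))/implyP := h2 _ (code_in x); apply.
- by move=> l; apply: val_inj => /=; rewrite (eqP (xchooseP (rex l))); case: (hrep l).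
move=> x.
have ce : connect_sym (bd_adj dpt).
  have cs := bd_adj_sym dpt.
  by apply: sym_connect_sym.
rewrite ce; apply: (@reach_connect _ _ code _ bdn_adj bnodes _ _ _ (size bnodes)).
- exact: code_inj.
- exact: code_ex.
- by move=> z y; rewrite code_adj.
by rewrite (eqP (xchooseP (rex _))); apply: h4; apply: code_in.
Qed.

Lemma deuler : (#|'I_k|.+1 + #|'I_nreg|.*2 =
  \sum_(d : option 'I_k) (dt d).2 + n_comp (bd_adj dpt) predT + 2)%N.
Proof.
case/and5P: ok => _ _ _ _ /and5P[_ _ _ _ /and5P[_ _ _ _ /eqP h]].
rewrite dn_comp !card_ord h; congr (_ + _ + _)%N.
rewrite (bigD1 None) //=; congr (_ + _)%N.
rewrite (eq_bigr (fun=> tin.2)) => [|[i|]] //.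
by rewrite sum_nat_const (cardC1 None) card_option card_ord.
Qed.

Definition diagram : tangle ti t :=
  Tangle (reg_unsh := fun r : 'I_nreg => val r < u) dside_unsh drg_unsh dtouch_side dstring_ends dconnected deuler.

End Diagram.


Definition region_label (rgs : seq (seq nat)) (sds : seq (nat * nat))
    (x : nat * nat + nat * bool) : nat :=
  match x with
  | inl a => nth 0%N (nth [::] rgs a.1) a.2
  | inr s => let y := nth (0, 0)%N sds s.1 in if s.2 then y.1 else y.2
  end.

Section BasicTangles.
Local Open Scope nat_scope.

(* Boxes are read clockwise from their left region: points 0, 1, 2, 3 are the
   top left, top right, bottom right and bottom left ones, and intervals
   0, 1, 2, 3 are the left, top, right and bottom ones. *)
Definition box : dtype := (true, 2).

Local Notation table k t u nreg pts rgs sds :=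
  (@diagram k box t u nreg pts rgs sds nreg (region_label rgs sds)
     ltac:(by vm_compute)) (only parsing).

Definition empty_tangle (b : bool) : tangle (fun _ : 'I_0 => box) (b, 0) :=
  @diagram 0 box (b, 0) (nat_of_bool b) 1 [:: [::]] [:: [:: 0]] [::]
    1 (fun _ => 0) ltac:(by case: b; vm_compute).

(* A closed loop in a region of shading b. *)
Definition loop_tangle (b : bool) : tangle (fun _ : 'I_0 => box) (b, 0) :=
  @diagram 0 box (b, 0) 1 2 [:: [::]] [:: [:: nat_of_bool (~~ b)]] [:: (0, 1)]
    3 (fun x => if x is inr s then (nat_of_bool s.2).+1 else 0)
    ltac:(by case: b; vm_compute).

Definition strand_tangle : tangle (fun _ : 'I_0 => box) (true, 1) :=
  table 0 (true, 1) 1 2 [:: [:: 0; 0]] [:: [:: 0; 1]] [:: (0, 1)].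

Definition id_tangle : tangle (fun _ : 'I_0 => box) box :=
  table 0 box 2 3 [:: [:: 0; 1; 1; 0]] [:: [:: 0; 2; 1; 2]]
    [:: (0, 2); (1, 2)].

Definition e_tangle : tangle (fun _ : 'I_0 => box) box :=
  table 0 box 1 3 [:: [:: 0; 0; 1; 1]] [:: [:: 0; 1; 0; 2]]
    [:: (0, 1); (0, 2)].

Definition cap_top_tangle : tangle (fun _ : 'I_1 => box) (true, 1) :=
  table 1 (true, 1) 1 3
    [:: [:: 1; 2]; [:: 0; 0; 1; 2]]
    [:: [:: 0; 2]; [:: 0; 1; 0; 2]]
    [:: (0, 1); (0, 2); (0, 2)].

Definition cap_right_tangle : tangle (fun _ : 'I_1 => box) (true, 1) :=
  table 1 (true, 1) 2 3
    [:: [:: 1; 2]; [:: 1; 0; 0; 2]]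
    [:: [:: 0; 2]; [:: 0; 2; 1; 2]]
    [:: (1, 2); (0, 2); (0, 2)].

(* The first box on top of the second one. *)
Definition stack_tangle : tangle (fun _ : 'I_2 => box) box :=
  table 2 box 2 5
    [:: [:: 0; 1; 2; 3]; [:: 0; 1; 5; 4]; [:: 4; 5; 2; 3]]
    [:: [:: 0; 2; 1; 4]; [:: 0; 2; 1; 3]; [:: 0; 3; 1; 4]]
    [:: (0, 2); (1, 2); (1, 4); (0, 4); (0, 3); (1, 3)].

(* The first box to the left of the second one. *)
Definition horizontal_tangle : tangle (fun _ : 'I_2 => box) box :=
  table 2 box 3 5
    [:: [:: 0; 1; 2; 3]; [:: 0; 4; 5; 3]; [:: 4; 1; 2; 5]]
    [:: [:: 0; 3; 1; 4]; [:: 0; 3; 2; 4]; [:: 2; 3; 1; 4]]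
    [:: (0, 3); (1, 3); (1, 4); (0, 4); (2, 3); (2, 4)].

(* Region 3 is the central one; the boxes have their left regions outside. *)
Definition U_tangle : tangle (fun _ : 'I_3 => box) (true, 3) :=
  table 3 (true, 3) 4 7
    [:: [:: 0; 1; 2; 3; 4; 5];
        [:: 0; 6; 8; 5]; [:: 2; 7; 6; 1]; [:: 4; 8; 7; 3]]
    [:: [:: 0; 4; 1; 5; 2; 6];
        [:: 0; 4; 3; 6]; [:: 1; 5; 3; 4]; [:: 2; 6; 3; 5]]
    [:: (0, 4); (1, 4); (1, 5); (2, 5); (2, 6); (0, 6);
        (3, 4); (3, 5); (3, 6)].

(* Region 6 is the central one. *)
Definition D_tangle : tangle (fun _ : 'I_3 => box) (true, 3) :=
  table 3 (true, 3) 3 7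
    [:: [:: 0; 1; 2; 3; 4; 5];
        [:: 0; 1; 6; 8]; [:: 2; 3; 7; 6]; [:: 4; 5; 8; 7]]
    [:: [:: 0; 3; 1; 4; 2; 5];
        [:: 0; 3; 1; 6]; [:: 1; 4; 2; 6]; [:: 2; 5; 0; 6]]
    [:: (0, 3); (1, 3); (1, 4); (2, 4); (2, 5); (0, 5);
        (1, 6); (2, 6); (0, 6)].

(* Two discs of type t with all boundary points joined in the plane, in mirror
   order; the starred regions of both are the outer region. *)
Section Pairing.
Variable t : dtype.
Local Notation ti := (fun _ : 'I_2 => t).
Local Notation dt := (disc_t ti (t.1, 0)).

Lemma nint_gt0 : 0 < nint t.
Proof. by rewrite /nint leq_max. Qed.

Definition mod_int (m : nat) : 'I_(nint t) := Ordinal (ltn_pmod m nint_gt0).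

Definition pairing_pt (d : option 'I_2) : 'I_(npt (dt d)) -> 'I_(npt t) :=
  match d with
  | None => fun p => False_rect _ (notF (ltn_ord p))
  | Some i => fun p => if val i == 0 then p else rev_ord p
  end.

Definition pairing_rg (d : option 'I_2) : 'I_(nint (dt d)) -> 'I_(nint t) :=
  match d with
  | None => fun _ => mod_int 0
  | Some i => fun j => if val i == 0 then j else mod_int (nint t - j)
  end.

Definition pairing_side (s : 'I_(npt t)) (b : bool) : 'I_(nint t) :=
  mod_int (if unsh t s == b then val s else (val s).+1).

Lemma nintE (s : 'I_(npt t)) : nint t = npt t.
Proof. by apply/maxn_idPr; case: s => m /=; case: (npt t). Qed.

Lemma unsh_mod (s : 'I_(npt t)) m : unsh t (m %% nint t) = unsh t m.
Proof.
by rewrite /unsh (nintE s) {2}(divn_eq m (npt t)) oddD oddM odd_double andbF.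
Qed.

Lemma pairing_side_unsh s b : unsh t (pairing_side s b) = b.
Proof.
rewrite /= (unsh_mod s); case: eqP => //.
by rewrite /unsh /=; case: (t.1) (odd s) b => [] [] [].
Qed.

Lemma pairing_rg_unsh d (j : 'I_(nint (dt d))) :
  unsh t (pairing_rg j) = unsh (dt d) j.
Proof.
case: d j => [i|] j /=.
  case: ifP => _ //.
  have [p|n0] := posnP (npt t).
    have e1 : nint t = 1 by rewrite /nint p.
    have j0 : j = 0 :> nat by have : j < nint t := ltn_ord j; lia.
    by rewrite /= j0 e1.
  have ej : nint t = npt t by apply/maxn_idPr.
  rewrite /= (unsh_mod (Ordinal n0)) /unsh oddB ?(ltnW (ltn_ord j)) //.
  have -> : odd (nint t) = false by rewrite ej odd_double.
  by [].
by rewrite mod0n; case: j => -[|m].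
Qed.

Lemma pairing_touch_side d (p : 'I_(npt (dt d))) (j : 'I_(nint (dt d))) :
  touch p j -> pairing_rg j = pairing_side (pairing_pt p) (unsh (dt d) j).
Proof.
case: d p j => [i|] p j /=; last by case: p.
rewrite /touch /= => h; apply: val_inj.
have eN := nintE p.
have vE m : val (mod_int m) = m %% npt t by rewrite /= eN.
have nE m : nint t - m = npt t - m by rewrite eN.
have hp : p < npt t := ltn_ord p.
have hj : j < npt t by rewrite -eN; exact: ltn_ord j.
have even_n : odd (npt t) = false by rewrite odd_double.
have orp : odd (npt t - p.+1) = ~~ odd p by rewrite oddB // even_n.
have bb b : (b == ~~ b) = false by case: b.
have [jp | jp] : j = p :> nat \/
    [/\ j != p :> nat, odd j = ~~ odd p & j = p.+1 %% npt t :> nat].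
- case/orP: h => /eqP h; [by left | right].
  have [e|e] := eqVneq p.+1 (npt t).
    have op : odd p by have := congr1 odd e; rewrite even_n /= => /negbFE.
    have j0 : j = 0 :> nat by rewrite h e modnn.
    by rewrite op h e modnn; split=> //; case: (val p) op.
  have lt : p.+1 < npt t by rewrite ltn_neqAle e.
  by rewrite h modn_small // gtn_eqF.
- have u1 : unsh t j = unsh t p by rewrite jp.
  rewrite /pairing_side u1 vE; case: ifP => _; first by rewrite eqxx /= jp modn_small.
  rewrite nE vE /=.
  have -> : unsh t (npt t - p.+1) = ~~ unsh t p by rewrite /unsh orp addbN.
  rewrite eq_sym bb jp; congr (_ %% _).
  by rewrite -subSn // subSS.
case: jp => _ oj jE.
have u1 : unsh t j = ~~ unsh t p by rewrite /unsh oj addbN.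
rewrite /pairing_side u1 vE; case: ifP => _; first by rewrite bb /= jE.
rewrite nE vE /=.
have -> : unsh t (npt t - p.+1) = ~~ unsh t p by rewrite /unsh orp addbN.
rewrite eqxx jE; have [e|e] := eqVneq p.+1 (npt t).
  by rewrite e modnn subn0 modnn subnn mod0n.
have lt : p.+1 < npt t by rewrite ltn_neqAle e.
by rewrite (modn_small lt).
Qed.

Lemma pairing_string_ends (x : bpoint ti (t.1, 0)) (b : bool) :
  exists! y : bpoint ti (t.1, 0),
    pairing_pt (tagged y) = pairing_pt (tagged x) /\ outward y = b.
Proof.
case: x => -[i|] p /=; last by case: p.
set s : 'I_(npt t) := if _ then _ else _.
have o_rev (q : 'I_(npt t)) : unsh t (rev_ord q) = ~~ unsh t q.
  rewrite /unsh /= oddB // odd_double /=.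
  by case: (t.1) (odd q) => [] [].
have E (y : bpoint ti (t.1, 0)) : pairing_pt (tagged y) = s -> outward y = b ->
    y = if unsh t s == b then Tagged (fun d => 'I_(npt (dt d))) (s : 'I_(npt (dt (Some ord0))))
        else Tagged (fun d => 'I_(npt (dt d))) (rev_ord s : 'I_(npt (dt (Some ord_max)))).
  case: y => -[i'|] q /=; last by case: q.
  rewrite /outward /=; case: i' q => -[|[|//]] hi q /= <- <-.
    by rewrite eqxx (val_inj (erefl : val (Ordinal hi) = val (ord0 : 'I_2))).
  have -> : Ordinal hi = ord_max :> 'I_2 by apply: val_inj.
  by rewrite o_rev rev_ordK; case: (unsh t q).
eexists; split; last by move=> y [h1 h2]; rewrite (E y h1 h2).
rewrite /outward; case: eqP => [<-|] //=.
by rewrite o_rev rev_ordK; case: (unsh t s) b {E} => [] [].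
Qed.

Lemma pairing_connected r r' : connect (reg_adj pairing_side) r r'.
Proof.
have ce := sym_connect_sym (reg_adj_sym pairing_side).
have h x : connect (reg_adj pairing_side) (mod_int 0) x.
  case: x => m; elim: m => [|m IH] hm.
    by rewrite (_ : Ordinal hm = mod_int 0) //; apply: val_inj; rewrite /= mod0n.
  apply: connect_trans (IH (ltnW hm)) (connect1 _).
  have hm' : m < npt t by move: hm; rewrite /nint; case: (npt t) => // n; lia.
  apply/existsP; exists (Ordinal hm'); apply/existsP; exists (unsh t m).
  rewrite /pairing_side /= eqxx -!val_eqE /= modn_small ?eqxx 1?ltnW //=.
  by case: (unsh t m) => /=; rewrite modn_small.
by apply: connect_trans (h r'); rewrite ce.
Qed.

Lemma pairing_euler : #|'I_2|.+1 + #|'I_(nint t)|.*2 =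
  \sum_(d : option 'I_2) (dt d).2 + n_comp (bd_adj pairing_pt) predT + 2.
Proof.
pose mk (i : 'I_2) (j : 'I_(nint t)) : bint ti (t.1, 0) :=
  Tagged (fun d => 'I_(nint (dt d))) (j : 'I_(nint (dt (Some i)))).
have h1 : 0 < nint (t.1, 0) by [].
pose mk0 : bint ti (t.1, 0) :=
  Tagged (fun d => 'I_(nint (dt d))) (Ordinal h1 : 'I_(nint (dt None))).
have mk0E j : Tagged (fun d => 'I_(nint (dt d))) (j : 'I_(nint (dt None))) = mk0.
  by congr Tagged; apply: val_inj; case: j => -[|m].
have -> : \sum_(d : option 'I_2) (dt d).2 = npt t.
  rewrite (bigD1 None) //= add0n (eq_bigr (fun=> t.2)) => [|[i|]] //.
  by rewrite sum_nat_const (cardC1 None) card_option card_ord /npt; lia.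
rewrite !card_ord.
have sym := bd_adj_sym pairing_pt.
have ce := sym_connect_sym sym.
have [n0|n0] := posnP (npt t).
  have e1 : nint t = 1 by rewrite /nint n0.
  pose f (x : bint ti (t.1, 0) + 'I_(npt t) * bool) : 'I_3 :=
    match x with
    | inl a => if tag a is Some i then lift ord0 i else ord0
    | inr _ => ord0
    end.
  pose g (l : 'I_3) : bint ti (t.1, 0) + 'I_(npt t) * bool :=
    if unlift ord0 l is Some i then inl (mk i (mod_int 0)) else inl mk0.
  rewrite (@n_comp_label _ _ 3 f g); first by rewrite n0 e1.
  - exact: sym.
  - by move=> x y; case: x y => [a|[[m hm] b]] [a'|[[m' hm'] b']] //=; exfalso; lia.
  - by move=> l; rewrite /g; case: unliftP => [i ->|->].
  move=> [[[i|] j]|[[m hm] b]] /=; last by exfalso; lia.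
    rewrite /g liftK (_ : j = mod_int 0) //; apply: val_inj => /=.
    by rewrite mod0n; case: j => m /=; rewrite e1; lia.
  by rewrite /g unlift_none -(mk0E j); exact: connect0.
have eN : nint t = npt t by apply/maxn_idPr.
pose f (x : bint ti (t.1, 0) + 'I_(npt t) * bool) : 'I_(nint t).+1 :=
  match x with
  | inl a => if tag a is Some i then lift ord0 (pairing_rg (tagged a)) else ord0
  | inr s => lift ord0 (pairing_side s.1 s.2)
  end.
pose g (l : 'I_(nint t).+1) : bint ti (t.1, 0) + 'I_(npt t) * bool :=
  if unlift ord0 l is Some r then inl (mk ord0 r) else inl mk0.
have fadj (a : bint ti (t.1, 0)) s :
    bd_touch pairing_pt a s -> f (inl a) = f (inr s).
  case: a => -[i|] j /existsP[p]; last by case: (p).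
  by move=> /andP[h /eqP ->]; rewrite /f /= -(pairing_touch_side h).
rewrite (@n_comp_label _ _ (nint t).+1 f g); first by rewrite eN; lia.
- exact: sym.
- by move=> [a|s] [a'|s'] //= h; [apply: fadj | apply/esym/fadj].
- by move=> l; rewrite /g; case: unliftP => [i ->|->].
have side0 (s : 'I_(npt t)) b : connect (bd_adj pairing_pt)
    (inr (s, b)) (inl (mk ord0 (pairing_side s b))).
  apply: connect1; rewrite /= /bd_touch; apply/existsP; exists s => /=.
  have := pairing_side_unsh s b => /= ->; rewrite eqxx andbT /touch.
  have hs := ltn_ord s.
  have vE m : val (mod_int m) = m %% npt t by rewrite /= eN.
  have vS : val (pairing_side s b) = s \/ val (pairing_side s b) = s.+1 %% npt t.
    by rewrite /pairing_side vE; case: ifP => _; [left; rewrite modn_small|right].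
  by apply/orP; case: vS => vS; [left|right]; apply/eqP; exact: vS.
move=> [[[i|] j]|[s b]].
- have hj : j < npt t by rewrite -eN; exact: ltn_ord j.
  pose p : 'I_(npt (dt (Some i))) := Ordinal hj.
  have tp : bd_touch pairing_pt (Tagged (fun d => 'I_(nint (dt d))) j)
              (pairing_pt p, unsh t j).
    by apply/existsP; exists p; rewrite /touch /= !eqxx.
  rewrite (fadj _ _ tp) /g liftK.
  by apply: connect_trans (side0 _ _); apply: connect1.
- by rewrite /g /f /= unlift_none -(mk0E j); exact: connect0.
by rewrite /g /f liftK; exact: side0.
Qed.

Definition pairing_tangle : tangle ti (t.1, 0) :=
  Tangle (reg_unsh := fun r : 'I_(nint t) => unsh t r)
    pairing_side_unsh pairing_rg_unsh pairing_touch_side pairing_string_ends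
    pairing_connected pairing_euler.

End Pairing.

End BasicTangles.

Definition in_span (F : fieldType) (W : lmodType F) (X : W -> Prop) (w : W) :
    Prop :=
  exists (m : nat) (c : 'I_m -> F) (y : 'I_m -> W),
    (forall k, X (y k)) /\ w = \sum_k c k *: y k.

Definition has_dim (F : fieldType) (W : lmodType F) (d : nat) : Prop :=
  exists b : 'I_d -> W,
    forall w, exists! c : {ffun 'I_d -> F}, w = \sum_k c k *: b k.

Section YangBaxter.
Variables (F : fieldType) (V : planar_algebra F).

Definition closed_elt (t : dtype) (T : tangle (fun _ : 'I_0 => box) t) : V t :=
  act V T (fun _ => 0).

Definition empty_elt (b : bool) : V (b, 0%N) := closed_elt (empty_tangle b).
Definition loop_elt (b : bool) : V (b, 0%N) := closed_elt (loop_tangle b).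
Definition strand_elt : V (true, 1%N) := closed_elt strand_tangle.
Definition id_elt : V box := closed_elt id_tangle.
Definition e_elt : V box := closed_elt e_tangle.

Definition cap_top (x : V box) : V (true, 1%N) :=
  act V cap_top_tangle (fun _ => x).
Definition cap_right (x : V box) : V (true, 1%N) :=
  act V cap_right_tangle (fun _ => x).
Definition stack (x y : V box) : V box :=
  act V stack_tangle (tnth [tuple x; y]).
Definition horizontal (x y : V box) : V box :=
  act V horizontal_tangle (tnth [tuple x; y]).
Definition U_elt (x y z : V box) : V (true, 3%N) :=
  act V U_tangle (tnth [tuple x; y; z]).
Definition D_elt (x y z : V box) : V (true, 3%N) :=
  act V D_tangle (tnth [tuple x; y; z]).
Definition pairing (t : dtype) (x y : V t) : V (t.1, 0%N) :=
  act V (pairing_tangle t) (tnth [tuple x; y]).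

Definition evaluable : Prop := forall b, has_dim (V (b, 0%N)) 1.

Definition nondegenerate : Prop :=
  forall t (x : V t), (forall y, pairing x y = 0) -> x = 0.

Definition generated_by (gen : V box -> Prop) : Prop :=
  forall t (x : V t),
    in_span (fun y => exists (I : finType) (T : tangle (fun _ : I => box) t)
                             (lab : I -> V box),
               (forall i, gen (lab i)) /\ y = act V T lab) x.

(* n is the value of a closed loop bounding an unshaded disc. *)
Record yang_baxter (n : F) (gen : V box -> Prop) : Prop := YangBaxter {
  yb_nondegenerate : nondegenerate;
  yb_evaluable : evaluable;
  yb_loop_shaded : loop_elt true = empty_elt true;
  yb_loop_unshaded : loop_elt false = n *: empty_elt false;
  yb_generated : generated_by gen;
  yb_relations : let gen' x := gen x \/ x = id_elt \/ x = e_elt in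
    [/\ forall x, gen' x -> exists c, cap_top x = c *: strand_elt,
        forall x, gen' x -> exists c, cap_right x = c *: strand_elt,
        forall x y, gen' x -> gen' y -> in_span gen' (stack x y),
        forall x y, gen' x -> gen' y -> in_span gen' (horizontal x y) &
        (forall x y z, gen' x -> gen' y -> gen' z ->
          in_span (fun w => exists x' y' z',
            [/\ gen' x', gen' y', gen' z' & w = D_elt x' y' z']) (U_elt x y z))
        /\
        (forall x y z, gen' x -> gen' y -> gen' z ->
          in_span (fun w => exists x' y' z',
            [/\ gen' x', gen' y', gen' z' & w = U_elt x' y' z']) (D_elt x y z))]
}.

Definition singly_generated (n : F) (P : V box) : Prop :=
  [/\ yang_baxter n (fun x => x = P), P <> 0 &
      forall x : V box, in_span (fun y => y = P \/ y = id_elt \/ y = e_elt) x].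

Definition minimal_idempotent (P : V box) : Prop :=
  [/\ P <> 0, stack P P = P &
      forall x, exists c, stack (stack P x) P = c *: P].

Definition orthogonal_to_e (P : V box) : Prop :=
  stack P e_elt = 0 /\ stack e_elt P = 0.

End YangBaxter.

Definition spin_model (F : fieldType) (V : planar_algebra F) (S : finType) :=
  planar_map V (GPA F S).

(* c_X(a, b), where a labels the left region and b the right one. *)
Definition spin_matrix (F : fieldType) (V : planar_algebra F) (S : finType)
    (Phi : spin_model V S) (X : V box) (a b : S) : F :=
  (Phi box X : {ffun {ffun ubd box -> S} -> F^o})
    [ffun j : ubd box => if val j == 0%N :> nat then a else b].

Definition symmetric_model (F : fieldType) (V : planar_algebra F) (S : finType)
    (Phi : spin_model V S) (P : V box) : Prop :=
  forall a b, spin_matrix Phi P a b = spin_matrix Phi P b a.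

(* Phi is a non-symmetric spin model for the singly-generated Yang-Baxter planar
   algebra V with generating minimal idempotent P, and C = C_P. *)
Definition nonsymmetric_realization (F : fieldType) (S : finType)
    (C : S -> S -> F) (V : planar_algebra F) (P : V box)
    (Phi : spin_model V S) : Prop :=
  [/\ exists n : F, singly_generated n P,
      minimal_idempotent P /\ orthogonal_to_e P,
      ~ symmetric_model Phi P &
      forall a b, C a b = spin_matrix Phi P a b].

(* The directed cycle 0 -> 1 -> 2 -> 0. *)
Definition directed_cycle3 : rel 'I_3 := fun i j => j == ordS i.

(* C is the adjacency matrix of the digraph E, for some identification of its
   vertices with S. *)
Definition is_adjacency_matrix (F : fieldType) (X S : finType) (E : rel X)
    (C : S -> S -> F) : Prop :=
  exists v : X -> S, bijective v /\ forall i j, C (v i) (v j) = (E i j)%:R.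

(* The unique Bisch-Jones planar algebra with 9-dimensional V_3 is the group
   planar algebra of Z/3. *)
Definition bisch_jones9 (F : fieldType) : planar_algebra F :=
  group_planar_algebra F 'Z_3.

(* Main.v *)
From HB Require Import structures.
From mathcomp Require Import all_boot all_order fingroup all_algebra.
From mathcomp Require Import zify ring reals complex.
Require Import Defs.

Set Implicit Arguments.
Unset Strict Implicit.
Unset Printing Implicit Defensive.

Import GRing.Theory Num.Theory.
Local Open Scope ring_scope.

(** A spin model Phi of V is faithful ([spin_model_inj]), so V is a planar
    subalgebra of the algebra of functions on labellings, generated by the
    matrix C of P. There, stacking is the entrywise product, id is the matrix J
    with all entries 1, e is the identity matrix I and rotation by 180 degrees
    is transposition.

    Non-symmetric models are triply regular tournaments. As P is an idempotent
    orthogonal to e, C has entries 0 and 1 and zero diagonal: it is the adjacency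
    matrix of a digraph. The transpose of C is a combination of C, I and J; as C
    is not symmetric, C + C^T = J - I, and the digraph is a tournament
    ([arc_tournament]). By the star-triangle relation the function
    U(x, y, z)(a, b, c) = sum_d x(a, d) y(b, d) z(c, d) is a combination of
    functions x(a, b) y(b, c) z(c, a); so the number of vertices d with prescribed
    arcs from a, b and c depends only on the arcs between a, b and c
    ([U_same_type]).

    Such a tournament has three vertices ([triply_regular_tournament]). Let k be
    the out-degree, lam the number of common out-neighbours of two vertices, and
    mu and tau those of a transitive and of a cyclic triple. Double counting gives
    k = 2 lam + 1, then lam = 0 or lam = 2 mu + 1, and finally a linear relation
    which in the second case reduces to 2 tau = 2 mu + 1. Hence lam = 0, k = 1 and
    there are three vertices, which form a directed cycle.

    The algebra generated by the cyclic permutation matrix consists of all the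
    functions invariant under the diagonal translations of Z/3
    ([invariant_span]). The tangle in which all unshaded boundary intervals meet
    one central region gives the indicator function of constant labellings, and a
    box inserted between a boundary interval and the rest of a diagram shifts the
    corresponding label by one; so every orbit of the translations has a diagram
    as indicator function. These diagrams show that the group planar algebra of
    Z/3 is generated by P. Its other axioms are direct: the local relations hold
    because their right-hand sides span the spaces concerned ([D_span],
    [U_span]), and x pairs to a sum of squares with the mirror image of its
    conjugate ([group_nondegenerate]). The same diagrams show that a faithful
    spin model with the matrix of the 3-cycle identifies V with the group planar
    algebra. *)

(** * Evaluation of small diagrams in a spin model *)

Section Evaluation.
Variables (F : fieldType) (S : finType).

(** Used with X a point when the boundary labels determine the state, and with
    X = S when the label of one region is left free. *)
Lemma spin_act_fiber (I : finType) (ti : I -> dtype) t (T : tangle ti t)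
    (f : forall i, spin_space F S (ti i)) (l : {ffun ubd t -> S}) (X : finType)
    (h : X -> {ffun ureg T -> S}) (k : {ffun ureg T -> S} -> X) :
  (forall x, restr None (h x) = l) -> cancel h k ->
  (forall s, restr None s = l -> h (k s) = s) ->
  spin_act T f l = \sum_x \prod_i f i (restr (Some i) (h x)).
Proof.
move=> hl hK kK; rewrite ffunE (reindex h) /=; last first.
  by exists k => s; rewrite ?inE; [rewrite hK|move/eqP/kK].
by apply: eq_bigl => x; rewrite hl eqxx.
Qed.

Section NumberedRegions.
Variables (k : nat) (tin t : dtype) (T : tangle (fun _ : 'I_k => tin) t).
Variables (u : nat) (rgs : seq (seq nat)) (num : reg T -> nat).
Hypothesis num_inj : injective num.
Hypothesis num_unsh : forall r, reg_unsh T r = (num r < u)%N.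
Hypothesis num_rg : forall d (j : 'I_(nint (disc_t (fun _ : 'I_k => tin) t d))),
  num (rg T d j) = nth 0%N (nth [::] rgs (dnum d)) j.

Definition on_boundary (r : nat) : bool :=
  has (fun j => unsh t j && (nth 0%N (nth [::] rgs 0) j == r))
    (iota 0 (nint t)).

Variable a0 : S.

Definition region_state (w : seq S) : {ffun ureg T -> S} :=
  [ffun r : ureg T => nth a0 w (num (val r))].

Lemma restr_region_state d w :
  restr d (region_state w) =
  [ffun j : ubd (disc_t (fun _ : 'I_k => tin) t d) =>
     nth a0 w (nth 0%N (nth [::] rgs (dnum d)) (val j))].
Proof. by apply/ffunP => j; rewrite !ffunE num_rg. Qed.

Lemma restr_None_eq (s : {ffun ureg T -> S}) w (r : ureg T) :
  restr None s = restr None (region_state w) -> on_boundary (num (val r)) ->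
  s r = nth a0 w (num (val r)).
Proof.
move=> e /hasP[j]; rewrite mem_iota /= add0n => jn /andP[uj /eqP rj].
have nj : num (rg T None (Ordinal jn)) = num (val r) by rewrite num_rg.
have /ffunP/(_ (mk_ubd (j := Ordinal jn) uj)) := e.
rewrite !ffunE /= nj => <-; congr (s _); apply: val_inj; apply: num_inj.
by rewrite /= nj.
Qed.

(** Every unshaded region meets the outer disc, so the boundary labels determine
    the state. *)
Lemma spin_act_closed (f : 'I_k -> spin_space F S tin) w :
  all on_boundary (iota 0 u) ->
  spin_act T f (restr None (region_state w)) =
  \prod_i f i (restr (Some i) (region_state w)).
Proof.
move=> h.
rewrite (@spin_act_fiber _ _ _ _ _ _ unit (fun=> region_state w) (fun=> tt)).
- by rewrite big_const card_unit /= addr0.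
- by [].
- by case.
move=> s e; apply/ffunP => r; rewrite ffunE.
rewrite (restr_None_eq e) //; apply: (allP h).
by rewrite mem_iota /= add0n -num_unsh; case: r.
Qed.

(** One unshaded region, the last one, avoids the outer disc; its label is
    summed over. *)
Lemma spin_act_open (f : 'I_k -> spin_space F S tin) w (r0 : reg T) :
  num r0 = size w -> u = (size w).+1 -> all on_boundary (iota 0 (size w)) ->
  ~~ on_boundary (size w) ->
  spin_act T f (restr None (region_state w)) =
  \sum_x \prod_i f i (restr (Some i) (region_state (rcons w x))).
Proof.
move=> r0E uE h hm.
have u0 : reg_unsh T r0 by rewrite num_unsh r0E uE.
apply: (@spin_act_fiber _ _ _ _ _ _ S (fun x => region_state (rcons w x))
  (fun s => s (mk_ureg u0))).
- move=> x; apply/ffunP => j; rewrite !ffunE nth_rcons.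
  case: ltngtP => // [lt|e]; first by rewrite nth_default // ltnW.
  case/hasP: hm; exists (val (val j)); first by rewrite mem_iota ltn_ord.
  by rewrite -e num_rg eqxx andbT; case: j {e}.
- by move=> x; rewrite ffunE nth_rcons /= r0E ltnn eqxx.
move=> s e; apply/ffunP => r; rewrite ffunE nth_rcons.
have ru : (num (val r) < u)%N by rewrite -num_unsh; case: r.
case: ltngtP => [lt|lt|e'].
- by rewrite (restr_None_eq e) //; apply: (allP h); rewrite mem_iota.
- by exfalso; move: lt; rewrite ltnNge -ltnS -uE ru.
by congr (s _); apply: val_inj; apply: num_inj; rewrite /= r0E.
Qed.

End NumberedRegions.

Definition strand_fun (a : S) : {ffun ubd (true, 1%N) -> S} := [ffun=> a].
Definition box_fun (a b : S) : {ffun ubd box -> S} :=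
  [ffun j : ubd box => if val j == 0%N :> nat then a else b].
Definition three_fun (a b c : S) : {ffun ubd (true, 3%N) -> S} :=
  [ffun j : ubd (true, 3%N) => nth a [:: a; a; b; b; c; c] (val j)].

Lemma box_fun_ex l : exists a b, l = box_fun a b.
Proof.
exists (l (mk_ubd (t := box) (j := Ordinal (isT : (0 < 4)%N)) isT)).
exists (l (mk_ubd (t := box) (j := Ordinal (isT : (2 < 4)%N)) isT)).
apply/ffunP => -[[[|[|[|[|//]]]] hj] uj]; rewrite ffunE //=;
by congr (l _); apply: val_inj; apply: val_inj.
Qed.

Lemma three_fun_ex l : exists a b c, l = three_fun a b c.
Proof.
exists (l (mk_ubd (t := (true, 3%N)) (j := Ordinal (isT : (0 < 6)%N)) isT)).
exists (l (mk_ubd (t := (true, 3%N)) (j := Ordinal (isT : (2 < 6)%N)) isT)).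
exists (l (mk_ubd (t := (true, 3%N)) (j := Ordinal (isT : (4 < 6)%N)) isT)).
apply/ffunP => -[[[|[|[|[|[|[|//]]]]]] hj] uj]; rewrite ffunE //=;
by congr (l _); apply: val_inj; apply: val_inj.
Qed.

Lemma strand_fun_ex l : exists a, l = strand_fun a.
Proof.
exists (l (mk_ubd (t := (true, 1%N)) (j := Ordinal (isT : (0 < 2)%N)) isT)).
apply/ffunP => -[[[|[|//]] hj] uj]; rewrite ffunE //=;
by congr (l _); apply: val_inj; apply: val_inj.
Qed.

Definition matrix_of (x : spin_space F S box) (a b : S) : F :=
  (x : {ffun {ffun ubd box -> S} -> F^o}) (box_fun a b).

Lemma matrix_of_inj x y : (forall a b, matrix_of x a b = matrix_of y a b) -> x = y.
Proof. by move=> h; apply/ffunP => l; have [a [b ->]] := box_fun_ex l; apply: h. Qed.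

Lemma ffun_box (g : nat -> S) :
  [ffun j : ubd box => g (val (val j))] = box_fun (g 0%N) (g 2).
Proof. by apply/ffunP => -[[[|[|[|[|//]]]] hj] uj]; rewrite !ffunE. Qed.

Lemma ffun_three (g : nat -> S) :
  [ffun j : ubd (true, 3%N) => g (val (val j))] = three_fun (g 0%N) (g 2) (g 4).
Proof. by apply/ffunP => -[[[|[|[|[|[|[|//]]]]]] hj] uj]; rewrite !ffunE. Qed.

Lemma ffun_strand (g : nat -> S) :
  [ffun j : ubd (true, 1%N) => g (val (val j))] = strand_fun (g 0%N).
Proof. by apply/ffunP => -[[[|[|//]] hj] uj]; rewrite !ffunE. Qed.

Section NumberedBoxes.
Variables (k : nat) (t : dtype) (T : tangle (fun _ : 'I_k => box) t).
Variables (u : nat) (rgs : seq (seq nat)) (num : reg T -> nat).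
Hypothesis num_inj : injective num.
Hypothesis num_unsh : forall r, reg_unsh T r = (num r < u)%N.
Hypothesis num_rg : forall d (j : 'I_(nint (disc_t (fun _ : 'I_k => box) t d))),
  num (rg T d j) = nth 0%N (nth [::] rgs (dnum d)) j.
Variable a0 : S.

Definition outer_labels (w : seq S) : {ffun ubd t -> S} :=
  [ffun j : ubd t => nth a0 w (nth 0%N (nth [::] rgs 0) (val j))].

Definition box_value (w : seq S) (x : spin_space F S box) (rs : seq nat) : F :=
  matrix_of x (nth a0 w (nth 0%N rs 0)) (nth a0 w (nth 0%N rs 2)).

Lemma box_valueE (f : 'I_k -> spin_space F S box) w (i : 'I_k) :
  (f i : {ffun {ffun ubd box -> S} -> F^o})
    (restr (Some i) (region_state num a0 w)) =
  box_value w (f i) (nth [::] rgs i.+1).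
Proof.
rewrite (restr_region_state num_rg) /box_value /matrix_of; congr (f i _).
exact: (ffun_box (fun j => nth a0 w (nth 0%N (nth [::] rgs i.+1) j))).
Qed.

Lemma boxes_closed (f : 'I_k -> spin_space F S box) w :
  all (on_boundary t rgs) (iota 0 u) ->
  spin_act T f (outer_labels w) = \prod_i box_value w (f i) (nth [::] rgs i.+1).
Proof.
move=> h; rewrite /outer_labels -(restr_region_state num_rg a0 None).
rewrite (spin_act_closed num_inj num_unsh num_rg) //.
by apply: eq_bigr => i _; rewrite box_valueE.
Qed.

Lemma boxes_open (f : 'I_k -> spin_space F S box) w (r0 : reg T) :
  num r0 = size w -> u = (size w).+1 ->
  all (on_boundary t rgs) (iota 0 (size w)) -> ~~ on_boundary t rgs (size w) ->
  spin_act T f (outer_labels w) =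
  \sum_x \prod_i box_value (rcons w x) (f i) (nth [::] rgs i.+1).
Proof.
move=> h1 h2 h3 h4; rewrite /outer_labels -(restr_region_state num_rg a0 None).
rewrite (spin_act_open num_inj num_unsh num_rg _ _ h1) //.
by apply: eq_bigr => x _; apply: eq_bigr => i _; rewrite box_valueE.
Qed.

End NumberedBoxes.

Lemma outer_box rgs a w :
  outer_labels box rgs a w =
  box_fun (nth a w (nth 0%N (nth [::] rgs 0) 0)) (nth a w (nth 0%N (nth [::] rgs 0) 2)).
Proof. exact: (ffun_box (fun j => nth a w (nth 0%N (nth [::] rgs 0) j))). Qed.

Lemma outer_three rgs a w :
  outer_labels (true, 3%N) rgs a w =
  three_fun (nth a w (nth 0%N (nth [::] rgs 0) 0))
    (nth a w (nth 0%N (nth [::] rgs 0) 2)) (nth a w (nth 0%N (nth [::] rgs 0) 4)).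
Proof. exact: (ffun_three (fun j => nth a w (nth 0%N (nth [::] rgs 0) j))). Qed.

Lemma outer_strand rgs a w :
  outer_labels (true, 1%N) rgs a w = strand_fun (nth a w (nth 0%N (nth [::] rgs 0) 0)).
Proof. exact: (ffun_strand (fun j => nth a w (nth 0%N (nth [::] rgs 0) j))). Qed.

Lemma D_eval (x : 'I_3 -> spin_space F S box) a b c :
  spin_act D_tangle x (three_fun a b c) =
  matrix_of (x ord0) a b * matrix_of (x (lift ord0 ord0)) b c *
  matrix_of (x (lift ord0 (lift ord0 ord0))) c a.
Proof.
have := @boxes_closed _ _ D_tangle 3 _ (@nat_of_ord _) val_inj (fun=> erefl)
  (fun _ _ => erefl) a x [:: a; b; c] isT.
by rewrite outer_three !big_ord_recl big_ord0 mulr1 mulrA.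
Qed.

Lemma U_eval (x : 'I_3 -> spin_space F S box) a b c :
  spin_act U_tangle x (three_fun a b c) =
  \sum_d matrix_of (x ord0) a d * matrix_of (x (lift ord0 ord0)) b d *
         matrix_of (x (lift ord0 (lift ord0 ord0))) c d.
Proof.
have := @boxes_open _ _ U_tangle 4 _ (@nat_of_ord _) val_inj (fun=> erefl)
  (fun _ _ => erefl) a x [:: a; b; c] (Ordinal (isT : 3 < 7)%N) erefl erefl isT isT.
rewrite outer_three => ->; apply: eq_bigr => d _.
by rewrite !big_ord_recl big_ord0 mulr1 mulrA.
Qed.

Lemma stack_eval (x : 'I_2 -> spin_space F S box) a b :
  spin_act stack_tangle x (box_fun a b) =
  matrix_of (x ord0) a b * matrix_of (x (lift ord0 ord0)) a b.
Proof.
have := @boxes_closed _ _ stack_tangle 2 _ (@nat_of_ord _) val_inj (fun=> erefl)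
  (fun _ _ => erefl) a x [:: a; b] isT.
by rewrite outer_box !big_ord_recl big_ord0 mulr1.
Qed.

Lemma id_eval (x : 'I_0 -> spin_space F S box) a b :
  spin_act id_tangle x (box_fun a b) = 1.
Proof.
have := @boxes_closed _ _ id_tangle 2 _ (@nat_of_ord _) val_inj (fun=> erefl)
  (fun _ _ => erefl) a x [:: a; b] isT.
by rewrite outer_box big_ord0.
Qed.

Lemma e_eval (x : 'I_0 -> spin_space F S box) a b :
  spin_act e_tangle x (box_fun a b) = (a == b)%:R.
Proof.
have [<-|ab] := eqVneq a b.
  have := @boxes_closed _ _ e_tangle 1 _ (@nat_of_ord _) val_inj (fun=> erefl)
    (fun _ _ => erefl) a x [:: a] isT.
  by rewrite outer_box big_ord0.
(* The left and right intervals meet the same region. *)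
rewrite ffunE big1 // => s /eqP e; case/eqP: ab.
have /ffunP h := e.
have := h (mk_ubd (t := box) (j := Ordinal (isT : (0 < 4)%N)) isT).
have := h (mk_ubd (t := box) (j := Ordinal (isT : (2 < 4)%N)) isT).
rewrite !ffunE /= => <- <-; congr (s _); apply: val_inj; exact: val_inj.
Qed.

Lemma strand_eval (x : 'I_0 -> spin_space F S box) a :
  spin_act strand_tangle x (strand_fun a) = 1.
Proof.
have := @boxes_closed _ _ strand_tangle 1 _ (@nat_of_ord _) val_inj (fun=> erefl)
  (fun _ _ => erefl) a x [:: a] isT.
by rewrite outer_strand big_ord0.
Qed.

Definition half_turn_tangle : tangle (fun _ : 'I_1 => box) box :=
  (@diagram 1 box box 2 4
    [:: [:: 0; 1; 2; 3]; [:: 2; 3; 0; 1]]%N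
    [:: [:: 0; 2; 1; 3]; [:: 1; 3; 0; 2]]%N
    [:: (0, 2); (1, 2); (1, 3); (0, 3)]%N
    4 (region_label [:: [:: 0; 2; 1; 3]; [:: 1; 3; 0; 2]]%N
    [:: (0, 2); (1, 2); (1, 3); (0, 3)]%N) ltac:(by vm_compute)).

Lemma half_turn_eval (x : 'I_1 -> spin_space F S box) a b :
  spin_act half_turn_tangle x (box_fun a b) = matrix_of (x ord0) b a.
Proof.
have := @boxes_closed _ _ half_turn_tangle 2 _ (@nat_of_ord _) val_inj (fun=> erefl)
  (fun _ _ => erefl) a x [:: a; b] isT.
by rewrite outer_box !big_ord_recl big_ord0 mulr1.
Qed.

Lemma empty_eval b (x : 'I_0 -> spin_space F S box) (a : S) :
  spin_act (empty_tangle b) x [ffun=> a] = 1.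
Proof.
have := @boxes_closed _ _ (empty_tangle b) b _ (@nat_of_ord _) val_inj (fun=> erefl)
  (fun _ _ => erefl) a x [:: a].
rewrite big_ord0 => <-; last by case: b x.
by congr (spin_act _ _ _); apply/ffunP => j; rewrite !ffunE; case: b x j => ? [[[|[]] ?] ?].
Qed.

Lemma loop_true_eval (x : 'I_0 -> spin_space F S box) (a : S) :
  spin_act (loop_tangle true) x [ffun=> a] = 1.
Proof.
have := @boxes_closed _ _ (loop_tangle true) 1 _ (@nat_of_ord _) val_inj (fun=> erefl)
  (fun _ _ => erefl) a x [:: a] isT.
rewrite big_ord0 => <-.
by congr (spin_act _ _ _); apply/ffunP => j; rewrite !ffunE; case: j => [[[|[]] ?] ?].
Qed.

Lemma loop_false_eval (x : 'I_0 -> spin_space F S box) (a : S) :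
  spin_act (loop_tangle false) x [ffun=> a] = #|S|%:R.
Proof.
have := @boxes_open _ _ (loop_tangle false) 1 _ (@nat_of_ord _) val_inj (fun=> erefl)
  (fun _ _ => erefl) a x [::] (Ordinal (isT : 0 < 2)%N) erefl erefl isT isT.
rewrite (eq_bigr (fun=> 1)) => [|y _]; last by rewrite big_ord0.
rewrite sumr_const => <-.
by congr (spin_act _ _ _); apply/ffunP => -[[[|[]] ?] ?].
Qed.

End Evaluation.

(** * Tournaments with regular triples *)

Lemma constant_on (X : finType) (Y : Type) (y0 : Y) (P : pred X) (f : X -> Y) :
  (forall x x', P x -> P x' -> f x = f x') ->
  exists y, forall x, P x -> f x = y.
Proof.
move=> h; case: (pickP P) => [x0 Px0|P0]; first by exists (f x0) => x Px; apply: h.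
by exists y0 => x; rewrite P0.
Qed.

Section Tournament.
Local Open Scope nat_scope.
Variables (S : finType) (E : rel S).
Hypothesis tournament : forall a b, E a b = (a != b) && ~~ E b a.

Definition common2 a b : nat := \sum_d E a d * E b d.
Definition common3 a b c : nat := \sum_d E a d * E b d * E c d.

Variables (k lam mu tau : nat).
Hypothesis outdegree : forall a, \sum_d E a d = k.
Hypothesis common2E : forall a b, a != b -> common2 a b = lam.
Hypothesis transitive3 : forall a b c, E a b -> E b c -> E a c -> common3 a b c = mu.
Hypothesis cyclic3 : forall a b c, E a b -> E b c -> E c a -> common3 a b c = tau.

Lemma arc_irrefl a : E a a = false. Proof. by rewrite tournament eqxx. Qed.

Lemma arc_total a b : E a b + E b a + (a == b) = 1.
Proof. by have := tournament a b; case: eqVneq => [<-|_ /= ->]; rewrite ?arc_irrefl //; case: (E b a). Qed.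

Lemma arc_asym a b : E a b -> E b a = false.
Proof. by rewrite tournament => /andP[_ /negbTE]. Qed.

Lemma arc_neq a b : E a b -> a != b.
Proof. by rewrite tournament => /andP[]. Qed.

Lemma sum_pred1 (a : S) (f : S -> nat) : \sum_b (b == a) * f b = f a.
Proof.
by rewrite (bigD1 a) //= eqxx mul1n big1 ?addn0 // => b /negbTE ->.
Qed.

Lemma sum_const (c : nat) : \sum_(a : S) c = #|S| * c.
Proof. by rewrite sum_nat_const. Qed.

Lemma degree_sum a : \sum_b E b a + k + 1 = #|S|.
Proof.
rewrite -(outdegree a) -big_split /=.
rewrite -[X in _ + X](sum_pred1 a (fun=> 1)) -big_split /= -sum1_card.
by apply: eq_bigr => b _; rewrite muln1 arc_total.
Qed.

(** Counting the arcs by source and by target gives n k = n (n - 1 - k). *)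
Lemma tournament_order : 0 < #|S| -> #|S| = 2 * k + 1.
Proof.
move=> n0; have e : \sum_a (\sum_b E b a + k + 1) = #|S| * #|S|.
  by rewrite (eq_bigr (fun=> #|S|)) ?sum_const // => a _; apply: degree_sum.
have e1 : \sum_a \sum_b E b a = #|S| * k.
  by rewrite exchange_big /= (eq_bigr (fun=> k)) ?sum_const.
move: e; rewrite !big_split /= e1 !sum_const => e.
by apply/eqP; rewrite -(eqn_pmul2l n0) -e; apply/eqP; lia.
Qed.

Lemma indegree a : \sum_b E b a = k.
Proof.
have n0 : 0 < #|S| by apply/card_gt0P; exists a.
by have := degree_sum a; rewrite tournament_order //; lia.
Qed.

Lemma common2_refl a : common2 a a = k.
Proof.
by rewrite -(outdegree a); apply: eq_bigr => d _; case: (E a d).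
Qed.

Variables (a b : S).
Hypothesis ab : E a b.

Lemma outdegree_gt0 : 0 < k.
Proof. by rewrite -(outdegree a) (bigD1 b) //= ab. Qed.

Lemma order_outdegree : #|S| = 2 * k + 1.
Proof. by apply: tournament_order; apply/card_gt0P; exists a. Qed.

(** Counting the pairs (c, d) with arcs from a to d and from c to d gives
    k^2 = k + (n - 1) lam. *)
Lemma outdegree_common2 : k = 2 * lam + 1.
Proof.
have e : \sum_c common2 a c = k * k.
  rewrite exchange_big /= -[X in X * _](outdegree a) big_distrl /=.
  by apply: eq_bigr => d _; rewrite -big_distrr /= indegree.
move: e; rewrite (bigD1 a) //= common2_refl.
rewrite (eq_bigr (fun=> lam)) => [|c ca]; last by rewrite common2E // eq_sym.
rewrite sum_nat_const (cardC1 a) order_outdegree.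
have := outdegree_gt0; nia.
Qed.

(** An out-neighbour c of v is equal to d, or else there is exactly one arc
    between c and d. *)
Lemma two_step v d : \sum_c E v c * E c d + common2 v d + E v d = k.
Proof.
rewrite -[in RHS](outdegree v) -(sum_pred1 d (fun c => E v c)) -!big_split /=.
apply: eq_bigr => c _; rewrite -[RHS]muln1 -(arc_total c d); nia.
Qed.

Lemma common3C x y z : common3 x y z = common3 x z y.
Proof. by apply: eq_bigr => d _; lia. Qed.

Lemma common3A x y z : common3 x y z = common3 y z x.
Proof. by apply: eq_bigr => d _; lia. Qed.

Lemma common3_refl x y : common3 x y y = common2 x y.
Proof. by apply: eq_bigr => d _; case: (E x d) (E y d) => [] []. Qed.

(** Count the pairs (c, d) where c is an out-neighbour of a and d is a common
    out-neighbour of a, b and c. For a fixed d there are lam choices of c by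
    [two_step]. In the other order, c = b contributes lam, and the k - 1 remaining
    c form transitive triples with a and b. *)
Lemma common2_transitive : lam = 0 \/ lam = 2 * mu + 1.
Proof.
have e : \sum_c E a c * common3 a b c = lam * lam.
  rewrite -{1}(common2E (arc_neq ab)) big_distrl /=.
  under eq_bigr => c _ do rewrite big_distrr /=.
  rewrite exchange_big /=; apply: eq_bigr => d _.
  transitivity (E a d * E b d * \sum_c E a c * E c d).
    by rewrite big_distrr; apply: eq_bigr => c _ /=; lia.
  case: (boolP (E a d)) => // ad; congr (_ * _).
  have := two_step a d; rewrite common2E ?arc_neq // ad outdegree_common2; lia.
have o : \sum_(c | c != b) E a c + 1 = k.
  by rewrite -(outdegree a) [in RHS](bigD1 b) //= ab addnC.
move: e; rewrite (bigD1 b) //= ab mul1n common3_refl common2E ?arc_neq //.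
rewrite (eq_bigr (fun c => E a c * mu)) => [|c cb].
  rewrite -big_distrl /= => e.
  have o' := outdegree_common2; nia.
case: (boolP (E a c)) => // ac; rewrite !mul1n.
have := arc_total b c; rewrite eq_sym (negbTE cb) addn0.
case: (boolP (E b c)) => [bc _|_ /= cb']; first exact: transitive3.
by rewrite common3C transitive3 //; case: (E c b) cb'.
Qed.

(** Count the pairs (c, d) where d is a common out-neighbour of a, b and c. A
    vertex c is a or b, or one of lam + 1 vertices completing the arc from a to b
    to a cyclic triple, or one of 3 lam vertices completing it to a transitive
    one. *)
Lemma common2_cyclic : lam * k = 2 * lam + (lam + 1) * tau + 3 * lam * mu.
Proof.
have <- : \sum_c common3 a b c = lam * k.
  rewrite -(common2E (arc_neq ab)) big_distrl /= exchange_big /=.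
  by apply: eq_bigr => d _; rewrite -big_distrr /= indegree.
have cyc : \sum_c E b c * E c a = lam + 1.
  have := two_step b a; rewrite arc_asym // common2E 1?eq_sym ?arc_neq //.
  by have := outdegree_common2; lia.
(* Subtractions are avoided by adding [mu] for each non-transitive c. *)
have key c : common3 a b c + (E b c * E c a + (c == a) + (c == b)) * mu =
   (c == a) * lam + (c == b) * lam + E b c * E c a * tau + mu.
  have [-> {c}|ca] := eqVneq c a.
    rewrite common3A common3_refl common2E; last by rewrite eq_sym arc_neq.
    by rewrite arc_asym // (negbTE (arc_neq ab)); lia.
  have [-> {c ca}|cb] := eqVneq c b.
    rewrite common3_refl common2E ?arc_neq // arc_irrefl; lia.
  have := arc_total b c; have := arc_total c a.
  rewrite (negbTE ca) eq_sym in cb *; rewrite (negbTE cb).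
  case: (boolP (E b c)) => bc; case: (boolP (E c a)) => ca' /= h1 h2.
  - rewrite (cyclic3 ab bc ca'); lia.
  - rewrite transitive3 //; first lia. by case: (E a c) h1.
  - have cb' : E c b by case: (E c b) h2.
    rewrite -common3A transitive3 //; lia.
  have cb' : E c b by case: (E c b) h2.
  have ac : E a c by case: (E a c) h1.
  rewrite common3C transitive3 //; lia.
have : \sum_c (common3 a b c + (E b c * E c a + (c == a) + (c == b)) * mu) =
  \sum_c ((c == a) * lam + (c == b) * lam + E b c * E c a * tau + mu).
  by apply: eq_bigr => c _; apply: key.
rewrite !big_split /= -!big_distrl /= !big_split /= cyc sum_const.
have s1 x : \sum_c (c == x :> S) = 1.
  by rewrite -[RHS](sum_pred1 x (fun=> 1)); apply: eq_bigr => c _; rewrite muln1.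
rewrite !s1 order_outdegree outdegree_common2; nia.
Qed.

(** If lam is not 0, then lam = 2 mu + 1 and the last count, divided by mu + 1,
    becomes 2 tau = 2 mu + 1, against parity. *)
Lemma triply_regular_tournament : #|S| = 3.
Proof.
have h1 := common2_transitive; have h2 := common2_cyclic; have h3 := outdegree_common2.
rewrite order_outdegree; case: h1 => [l0|l]; first by rewrite h3 l0.
have : (mu + 1) * (2 * tau) = (mu + 1) * (2 * mu + 1) by nia.
by move/eqP; rewrite eqn_pmul2l ?addn1 //; lia.
Qed.

End Tournament.

(** * Tangles whose regions are discs *)

Lemma connect_homo (A B : finType) (e : rel A) (e' : rel B) (h : A -> B) :
  (forall x y, e x y -> connect e' (h x) (h y)) ->
  forall x y, connect e x y -> connect e' (h x) (h y).
Proof.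
move=> he x y /connectP[p]; elim: p x => [|z p IH] x /=; first by move=> _ ->.
by case/andP => /he xz /IH h' /h'; apply: connect_trans.
Qed.

Section Regions.
Variables (I : finType) (ti : I -> dtype) (t : dtype) (str reg : finType).
Local Notation dt := (disc_t ti t).
Variable pt : forall d, 'I_(npt (dt d)) -> str.
Variable rg : forall d, 'I_(nint (dt d)) -> reg.
Variable side : str -> bool -> reg.
Hypothesis touch_side : forall d (p : 'I_(npt (dt d))) (j : 'I_(nint (dt d))),
    touch p j -> rg j = side (pt p) (unsh (dt d) j).

(** The pieces of which the boundaries of regions are made: intervals on discs
    and sides of strings. *)
Definition piece : finType := (bint ti t + str * bool)%type.

Definition piece_region (x : piece) : reg :=
  match x with
  | inl a => rg (tagged a)
  | inr s => side s.1 s.2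
  end.

Lemma piece_region_adj x y : bd_adj pt x y -> piece_region x = piece_region y.
Proof.
have h a s : bd_touch pt a s -> piece_region (inl a) = piece_region (inr s).
  by case/existsP => p /andP[/touch_side h /eqP ->].
by case: x y => [a|s] [a'|s'] //= /h.
Qed.

(** Every region has exactly one boundary component. The Euler characteristic
    condition then only counts regions. *)
Definition disc_regions : Prop :=
  (forall r, exists x, piece_region x = r) /\
  (forall x y, piece_region x = piece_region y -> connect (bd_adj pt) x y).

Lemma disc_regions_n_comp : disc_regions -> n_comp (bd_adj pt) predT = #|reg|.
Proof.
case=> surj conn.
have ex r : exists x, piece_region x == r by have [x <-] := surj r; exists x.
apply: (@n_comp_label _ _ _ (fun x => enum_rank (piece_region x))
  (fun i => xchoose (ex (enum_val i)))).
- exact: bd_adj_sym.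
- by move=> x y /piece_region_adj ->.
- by move=> i; rewrite (eqP (xchooseP (ex _))) enum_valK.
by move=> x; apply: conn; rewrite (eqP (xchooseP (ex _))) enum_rankK.
Qed.

End Regions.

Lemma sum_disc_sizes (I : finType) (tin t : dtype) :
  (\sum_(d : option I) (disc_t (fun _ : I => tin) t d).2 = t.2 + #|I| * tin.2)%N.
Proof.
rewrite (bigD1 None) //=; congr (_ + _)%N.
rewrite (eq_bigr (fun=> tin.2)) => [|[i|]] //.
by rewrite sum_nat_const (cardC1 None) card_option.
Qed.

Section Neighbours.
Local Open Scope nat_scope.
Variable t : dtype.
Hypothesis t_gt0 : 0 < t.2.

Lemma nint_npt : nint t = npt t.
Proof. by apply/maxn_idPr; rewrite /npt; lia. Qed.

Lemma ltn_npt (j : 'I_(nint t)) : j < npt t.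
Proof. by rewrite -nint_npt ltn_ord. Qed.

Definition right_pt (j : 'I_(nint t)) : 'I_(npt t) := Ordinal (ltn_npt j).
Definition left_pt (j : 'I_(nint t)) : 'I_(npt t) := ord_pred (right_pt j).

Lemma touchE (p : 'I_(npt t)) j :
  touch p j = (p == right_pt j) || (p == left_pt j).
Proof.
rewrite /touch eq_sym; congr orb.
rewrite -(inj_eq (@ordS_inj _)) /left_pt ord_predK eq_sym.
by rewrite -[RHS](inj_eq val_inj).
Qed.

Lemma unsh_ordS (p : 'I_(npt t)) : unsh t (ordS p) = ~~ unsh t p.
Proof. by have := unsh_mod p p.+1; rewrite (nintE p) /= => ->; rewrite /unsh /= addbN. Qed.

Lemma unsh_left j : unsh t (left_pt j) = ~~ unsh t j.
Proof.
have := unsh_ordS (left_pt j); rewrite /left_pt ord_predK.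
by rewrite -[unsh t (right_pt j)]/(unsh t j) => ->; rewrite negbK.
Qed.

Lemma touch_point (p : 'I_(npt t)) j :
  touch p j -> p = if unsh t p == unsh t j then right_pt j else left_pt j.
Proof.
rewrite touchE => /orP[/eqP ->|/eqP ->]; first by rewrite eqxx.
by rewrite unsh_left; case: (unsh t j).
Qed.

Lemma touch_side_of (p : 'I_(npt t)) j : touch p j -> j = pairing_side p (unsh t j).
Proof. by move=> tj; apply: (pairing_touch_side (d := Some ord0) tj). Qed.

Definition shaded_interval : finType := {j : 'I_(nint t) | ~~ unsh t j}.

Lemma pairing_side_shaded (p : 'I_(npt t)) : ~~ unsh t (pairing_side p false).
Proof. by rewrite pairing_side_unsh. Qed.

Definition shaded_at (p : 'I_(npt t)) : shaded_interval :=
  @exist _ (fun j : 'I_(nint t) => ~~ unsh t j) _ (pairing_side_shaded p).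

Lemma shaded_at_touch p j : touch p j -> unsh t j = false -> val (shaded_at p) = j.
Proof. by move=> tj uj; rewrite /= [RHS](touch_side_of tj) uj. Qed.

Lemma touch_shaded_at p : touch p (val (shaded_at p)).
Proof.
rewrite /touch /= /pairing_side.
have e m : m %% nint t = m %% npt t by rewrite nint_npt.
case: ifP => _ /=; rewrite e ?eqxx ?orbT //.
by rewrite modn_small ?eqxx.
Qed.

End Neighbours.

Section Base.
Local Open Scope nat_scope.
Variable t : dtype.
Hypothesis t_gt0 : 0 < t.2.
Local Notation ti := (fun _ : 'I_0 => box).
Local Notation dt := (disc_t ti t).
Local Notation shaded := (shaded_interval t).

(** A string cuts each shaded boundary interval off from a central unshaded
    region; strings are thus indexed by the shaded intervals, and regions by these
    and [None], the central one. *)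
Definition base_pt (d : option 'I_0) : 'I_(npt (dt d)) -> shaded :=
  match d with
  | None => fun p => shaded_at p
  | Some i => fun _ => False_rect _ (notF (ltn_ord i))
  end.

Definition base_rg (d : option 'I_0) : 'I_(nint (dt d)) -> option shaded :=
  match d with
  | None => fun j => insub j
  | Some i => fun _ => None
  end.

Definition base_side (s : shaded) (b : bool) : option shaded :=
  if b then None else Some s.

Lemma base_side_unsh s b : ~~ base_side s b = b.
Proof. by case: b. Qed.

Lemma base_rg_unsh d (j : 'I_(nint (dt d))) : ~~ base_rg j = unsh (dt d) j.
Proof.
case: d j => [[]//|] j /=.
by case: insubP => [s u _|]; [rewrite (negbTE u)|rewrite negbK => ->].
Qed.

Lemma base_touch_side d (p : 'I_(npt (dt d))) (j : 'I_(nint (dt d))) :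
  touch p j -> base_rg j = base_side (base_pt p) (unsh (dt d) j).
Proof.
case: d p j => [[]//|] p j tj /=.
case: insubP => [s u sj|]; last by rewrite negbK => ->.
rewrite (negbTE u) /=; congr Some; apply: val_inj.
by rewrite sj -(shaded_at_touch tj) // (negbTE u).
Qed.

Lemma base_string_ends (x : bpoint ti t) (b : bool) :
  exists! y : bpoint ti t,
    base_pt (tagged y) = base_pt (tagged x) /\ outward y = b.
Proof.
case: x => -[[]//|] p; set s := base_pt _.
pose q : 'I_(npt t) := if b then right_pt t_gt0 (val s) else left_pt t_gt0 (val s).
have us : unsh t (val s) = false by apply/negbTE; case: s {q}.
exists (Tagged (fun d => 'I_(npt (dt d))) (q : 'I_(npt (dt None)))); split.
  split.
    rewrite /=; apply: val_inj; apply: shaded_at_touch => //.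
    by rewrite touchE /q; case: (b); rewrite eqxx ?orbT.
  rewrite /outward /= /q; case: (b); first by rewrite -[unsh t _]/(unsh t (val s)) us.
  by rewrite unsh_left us.
case=> -[[]//|] r /= [rs ob]; congr Tagged.
have tr : touch r (val s) by rewrite -rs; apply: (touch_shaded_at t_gt0).
rewrite (touch_point t_gt0 tr) us /q -ob /outward /=.
by case: (unsh t r).
Qed.

Lemma base_connected r r' : connect (reg_adj base_side) r r'.
Proof.
have ce := sym_connect_sym (reg_adj_sym base_side).
have h x : connect (reg_adj base_side) None x.
  case: x => [s|//]; apply: connect1; apply/existsP; exists s.
  by apply/existsP; exists true; rewrite /= !eqxx.
by apply: connect_trans (h r'); rewrite ce.
Qed.

Lemma base_touch_adj (a : bint ti t) (p : 'I_(npt (dt (tag a)))) :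
  touch p (tagged a) ->
  bd_adj base_pt (inl a) (inr (base_pt p, unsh (dt (tag a)) (tagged a))).
Proof. by move=> tp; apply/existsP; exists p; rewrite tp eqxx. Qed.

(** The boundary of the central region alternates between unshaded intervals and
    strings around shaded ones, which follow each other around the outer disc. *)
Lemma base_disc_regions : disc_regions base_pt base_rg base_side.
Proof.
have cs : connect_sym (bd_adj base_pt) by apply: sym_connect_sym; apply: bd_adj_sym.
have npt0 : 0 < npt t by rewrite /npt; lia.
pose nd (j : 'I_(nint t)) : piece ti t shaded :=
  inl (Tagged (fun d => 'I_(nint (dt d))) (j : 'I_(nint (dt None)))).
have adj (p : 'I_(npt t)) j : touch p j ->
    connect (bd_adj base_pt) (nd j) (inr (shaded_at p, unsh t j)).
  by move=> tp; apply: connect1; apply: base_touch_adj.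
have lt0 : 0 < nint t by rewrite nint_npt.
pose s0 : shaded := shaded_at (Ordinal npt0).
pose x0 : piece ti t shaded := inr (s0, true).
(* Piece number m is the interval m if it is unshaded, and otherwise the
   unshaded side of the string around it. *)
have chain (m : nat) : (forall j : 'I_(nint t), j = m :> nat -> unsh t j -> connect (bd_adj base_pt) x0 (nd j))
   /\ (forall s : shaded, val s = m :> nat -> connect (bd_adj base_pt) x0 (inr (s, true))).
  elim: m => [|m [IH1 IH2]].
    split=> [j j0 uj|s v0].
      rewrite cs (_ : x0 = inr (s0, unsh t j)); last by rewrite uj.
      by apply: adj; rewrite /touch /= j0 eqxx.
    rewrite (_ : s = s0) ?connect0 //; apply: val_inj; apply/esym.
    apply: shaded_at_touch; last by apply/negbTE; case: (s).
    by rewrite /touch /= v0 eqxx.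
  split=> [j jm uj|s sm].
    have hm : m < npt t by have := ltn_ord j; rewrite jm nint_npt // => /ltnW.
    have tp : touch (Ordinal hm) j.
      by rewrite /touch /= jm modn_small ?eqxx ?orbT // -jm ltn_npt.
    apply: connect_trans (_ : connect _ (inr (shaded_at (Ordinal hm), true)) _).
      apply: IH2; have hm' : m < nint t by rewrite nint_npt.
      rewrite (_ : val (shaded_at _) = Ordinal hm') //.
      apply: shaded_at_touch; first by rewrite /touch /= eqxx.
      by move: uj; rewrite jm /unsh /= addbN => /negbTE.
    by rewrite cs -uj; apply: adj.
  have hm : m < nint t by have := ltn_ord (val s); rewrite sm => /ltnW.
  have hm' : m < npt t by rewrite -(nint_npt t_gt0).
  have us : unsh t (val s) = false by apply/negbTE; case: (s).
  have um : unsh t m by move: us; rewrite sm /unsh /= addbN => /negbFE.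
  have tp : touch (Ordinal hm') (Ordinal hm) by rewrite /touch /= eqxx.
  apply: connect_trans (IH1 (Ordinal hm) _ um) _ => //.
  have := adj _ _ tp; rewrite [unsh t _]um (_ : shaded_at _ = s) //.
  apply: val_inj; apply: shaded_at_touch => //.
  by rewrite /touch /= sm modn_small ?eqxx ?orbT // -sm ltn_npt.
split.
  case=> [s|]; first by exists (inr (s, false)).
  by exists x0.
have rep x : connect (bd_adj base_pt) x
    (if piece_region base_rg base_side x is Some s then inr (s, false) else x0).
  case: x => [[[[]//|] j]|[s [|]]] /=; last exact: connect0.
    case: insubP => [s us sj|].
      have tp : touch (right_pt t_gt0 j) j by rewrite touchE eqxx.
      have := adj _ _ tp; rewrite (negbTE us) (_ : shaded_at _ = s) //.
      by apply: val_inj; rewrite sj; apply: shaded_at_touch; rewrite ?(negbTE us).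
    by rewrite negbK => uj; rewrite cs; apply: (proj1 (chain j)).
  by rewrite cs; apply: (proj2 (chain (val (val s)))).
by move=> x y e; apply: connect_trans (rep x) _; rewrite e cs; apply: rep.
Qed.

Lemma card_shaded : #|{: shaded}| = t.2.
Proof.
rewrite card_sig -sum1_card big_mkcond /=.
transitivity (\sum_(j < nint t) nat_of_bool (~~ unsh t j)).
  by apply: eq_bigr => j _; rewrite inE; case: (unsh t j).
rewrite -(big_mkord xpredT (fun j => nat_of_bool (~~ unsh t j))) nint_npt // /npt.
elim: (t.2) => [|i IH]; first by rewrite big_geq.
rewrite doubleS !big_nat_recr //= IH /unsh /= odd_double.
by case: (t.1); rewrite /= ?addn0 ?addn1.
Qed.

Lemma base_euler : #|'I_0|.+1 + #|{: option shaded}|.*2 =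
  \sum_(d : option 'I_0) (dt d).2 + n_comp (bd_adj base_pt) predT + 2.
Proof.
rewrite (disc_regions_n_comp base_touch_side base_disc_regions).
by rewrite sum_disc_sizes card_option card_shaded card_ord; lia.
Qed.

Definition base_tangle : tangle ti t :=
  Tangle (reg_unsh := fun r : option shaded => ~~ r) base_side_unsh base_rg_unsh base_touch_side
    base_string_ends base_connected base_euler.

End Base.

(** All boundary labels are the label a of the central region. *)
Lemma base_eval (F : fieldType) (S : finType) t (t_gt0 : (0 < t.2)%N)
    (x : 'I_0 -> spin_space F S box) (l : {ffun ubd t -> S}) :
  spin_act (base_tangle t_gt0) x l = \sum_a (l == [ffun=> a])%:R.
Proof.
pose T := base_tangle t_gt0.
pose r0 : ureg T := exist (fun r : reg T => reg_unsh T r) None isT.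
have r0E (r : ureg T) : r = r0 by case: r => -[s|] ur //; apply: val_inj.
rewrite ffunE (reindex (fun a => [ffun=> a] : {ffun ureg T -> S})) /=; last first.
  exists (fun s : {ffun ureg T -> S} => s r0) => [a _|s _]; rewrite ?ffunE //.
  by apply/ffunP => r; rewrite ffunE [in RHS](r0E r).
rewrite big_mkcond; apply: eq_bigr => a _; rewrite big_ord0.
rewrite (_ : restr None _ = [ffun=> a]) 1?eq_sym; first by case: eqP.
by apply/ffunP => j; rewrite !ffunE.
Qed.

(** * Attaching a box to a boundary region *)

Section Attach.
Local Open Scope nat_scope.
Variables (I : finType) (t : dtype) (T : tangle (fun _ : I => box) t).
Hypothesis t_gt0 : 0 < t.2.
Variable j0 : 'I_(nint t).
Hypothesis j0_unsh : unsh t j0.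
Local Notation ti := (fun _ : option I => box).
Local Notation dt := (disc_t ti t).

(** The two points at the ends of j0, told apart by the shading of the interval
    that precedes them clockwise. *)
Definition end_pt (b : bool) : 'I_(npt t) :=
  if b then right_pt t_gt0 j0 else left_pt t_gt0 j0.

Definition end_str (b : bool) : str T := pt T None (end_pt b).

(** A box is placed between the interval j0 and the rest of the diagram, with its
    left side towards j0. Its points 1 and 2 take over the strings that ended on
    j0; its points 0 and 3 are joined to the outer disc by two new strings, indexed
    like the points of [end_pt]. The region [None] lies between j0 and the box. *)
Definition attach_pt (d : option (option I)) :
    'I_(npt (dt d)) -> str T + bool :=
  match d with
  | None => fun p => if touch p j0 then inr (unsh t p) else inl (pt T None p)
  | Some None => fun p =>
      nth (inr true) [:: inr true; inl (end_str true); inl (end_str false); inr false] p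
  | Some (Some i) => fun p => inl (pt T (Some i) p)
  end.

Definition attach_rg (d : option (option I)) :
    'I_(nint (dt d)) -> option (reg T) :=
  match d with
  | None => fun j => if j == j0 then None else Some (rg T None j)
  | Some None => fun j =>
      nth None [:: None; Some (side T (end_str true) false); Some (rg T None j0);
                   Some (side T (end_str false) false)] j
  | Some (Some i) => fun j => Some (rg T (Some i) j)
  end.

Definition attach_side (s : str T + bool) (b : bool) : option (reg T) :=
  match s with
  | inl s => Some (side T s b)
  | inr q => if b then None else Some (side T (end_str q) false)
  end.

Definition attach_unsh (r : option (reg T)) : bool :=
  if r is Some r then reg_unsh T r else true.

Lemma end_touch b : touch (end_pt b) j0.
Proof. by rewrite (touchE t_gt0) /end_pt; case: b; rewrite eqxx ?orbT. Qed.

Lemma end_unsh b : unsh t (end_pt b) = b.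
Proof. by rewrite /end_pt; case: b => //; rewrite unsh_left j0_unsh. Qed.

Lemma end_ptE (p : 'I_(npt t)) : touch p j0 -> p = end_pt (unsh t p).
Proof.
move=> tp; rewrite [LHS](touch_point t_gt0 tp) j0_unsh /end_pt.
by case: (unsh t p).
Qed.

Lemma end_rg b : rg T None j0 = side T (end_str b) true.
Proof. by rewrite (touch_side T (d := None) (end_touch b)) j0_unsh. Qed.

Lemma touch_other (p : 'I_(npt t)) j : touch p j0 -> touch p j -> j != j0 ->
  unsh t j = false.
Proof.
move=> tp0 tp; apply: contraNF => uj.
by rewrite (touch_side_of tp) uj [j0 in X in _ == X](touch_side_of tp0) j0_unsh.
Qed.

Lemma attach_side_unsh s b : attach_unsh (attach_side s b) = b.
Proof. by case: s => [s|q]; [apply: side_unsh|case: b => //; apply: side_unsh]. Qed.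

Lemma attach_rg_unsh d (j : 'I_(nint (dt d))) : attach_unsh (attach_rg j) = unsh (dt d) j.
Proof.
case: d j => [[i|]|] j /=.
- exact: rg_unsh.
- by case: j => -[|[|[|[|//]]]] ? //=; rewrite ?side_unsh ?rg_unsh.
by case: eqVneq => [->|_] /=; [rewrite j0_unsh|apply: rg_unsh].
Qed.

Lemma attach_touch_side d (p : 'I_(npt (dt d))) (j : 'I_(nint (dt d))) :
  touch p j -> attach_rg j = attach_side (attach_pt p) (unsh (dt d) j).
Proof.
case: d p j => [[i|]|] p j /= tp.
- by rewrite (touch_side T (d := Some i) tp).
- move: tp; case: p j => -[|[|[|[|//]]]] hp [] [|[|[|[|//]]]] hj //= _.
  + by rewrite (end_rg true).
  + by rewrite (end_rg false).
case: eqVneq => [jj|jj].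
  by rewrite -jj tp jj j0_unsh.
case: ifP => [tp0|_] /=; last by rewrite (touch_side T (d := None) tp).
by rewrite (touch_other tp0 tp jj) /end_str -end_ptE // (touch_side T (d := None) tp) (touch_other tp0 tp jj).
Qed.

Local Notation bp := (fun d => 'I_(npt (dt d))).

(** The endpoints on j0 of old strings move to the box; each string keeps its
    direction there. *)
Definition old_point (x : bpoint (fun _ : I => box) t) : bpoint ti t :=
  match x with
  | existT None p =>
      if touch p j0 then
        @existT _ bp (Some None) (if unsh t p then Ordinal (isT : 1 < 4) else Ordinal (isT : 2 < 4))
      else @existT _ bp None p
  | existT (Some i) p => @existT _ bp (Some (Some i)) p
  end.

Lemma old_point_pt x : attach_pt (tagged (old_point x)) = inl (pt T (tag x) (tagged x)).
Proof.
case: x => -[i|] p //=.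
case: (boolP (touch p j0)) => [tp|/negbTE tp] /=; last by rewrite tp.
by rewrite [in RHS](end_ptE tp); case: (unsh t p).
Qed.

Lemma old_point_outward x : outward (old_point x) = outward x.
Proof.
case: x => -[i|] p //=.
case: (boolP (touch p j0)) => [tp|/negbTE tp] //=.
by rewrite /outward /=; case: (unsh t p).
Qed.

Lemma old_point_surj (x : bpoint ti t) s : attach_pt (tagged x) = inl s ->
  exists y, old_point y = x.
Proof.
case: x => -[[i|]|] p /=.
- by exists (@existT _ (fun d => 'I_(npt (disc_t (fun _ : I => box) t d))) (Some i) p).
- have h b : old_point (@existT _ (fun d => 'I_(npt (disc_t (fun _ : I => box) t d))) None (end_pt b))
    = @existT _ bp (Some None) (if b then Ordinal (isT : 1 < 4) else Ordinal (isT : 2 < 4)).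
    by rewrite /= end_touch end_unsh.
  case: p => -[|[|[|[|//]]]] hp //= _.
    by exists (@existT _ (fun d => 'I_(npt (disc_t (fun _ : I => box) t d))) None (end_pt true));
    rewrite h; congr existT; apply: val_inj.
  by exists (@existT _ (fun d => 'I_(npt (disc_t (fun _ : I => box) t d))) None (end_pt false));
    rewrite h; congr existT; apply: val_inj.
case: ifP => // tp _.
exists (@existT _ (fun d => 'I_(npt (disc_t (fun _ : I => box) t d))) None p).
by rewrite /= tp.
Qed.

Lemma attach_string_ends (x : bpoint ti t) (b : bool) :
  exists! y : bpoint ti t,
    attach_pt (tagged y) = attach_pt (tagged x) /\ outward y = b.
Proof.
case E: (attach_pt (tagged x)) => [s|q].
  have [x0 x0E] := old_point_surj E.
  have [y [[py oy] yu]] := string_ends T x0 b.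
  have sE : s = pt T (tag x0) (tagged x0).
    by move: E; rewrite -x0E old_point_pt => -[].
  exists (old_point y); split; first by rewrite old_point_pt old_point_outward py sE.
  move=> z [pz oz]; have [z0 z0E] := old_point_surj pz.
  rewrite -z0E; congr old_point; apply: yu; split.
    by move: pz; rewrite -z0E old_point_pt sE => -[].
  by rewrite -old_point_outward z0E.
pose y : bpoint ti t :=
  if b == q then @existT _ bp (Some None) (if q then Ordinal (isT : 0 < 4) else Ordinal (isT : 3 < 4))
  else @existT _ bp None (end_pt q).
exists y; split.
  rewrite /y; case: eqP => [->|] /=; first by case: (q).
  by rewrite end_touch end_unsh /outward /= end_unsh; case: (b) (q) => [] [].
case=> -[[i|]|] p /= [eq oy].
- by [].
- rewrite /y -oy; case: p eq {oy} => -[|[|[|[|//]]]] hp //= [<-];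
    by congr existT; apply: val_inj.
move: eq oy; case: ifP => // tp [eq]; rewrite /y /outward /= -eq => <-.
by rewrite -end_ptE //; case: (unsh t p).
Qed.

Lemma attach_connected r r' : connect (reg_adj attach_side) r r'.
Proof.
have ce := sym_connect_sym (reg_adj_sym attach_side).
have h x : connect (reg_adj attach_side) (Some (side T (end_str true) false)) x.
  case: x => [x|].
    apply: (@connect_homo _ _ (reg_adj (side T)) (reg_adj attach_side)
      (@Some (reg T))); last exact: connected.
    move=> {}x y.
    case/existsP => s /existsP[b /andP[/eqP -> /eqP ->]].
    apply: connect1; apply/existsP; exists (inl s); apply/existsP; exists b.
    by rewrite /= !eqxx.
  apply: connect1; apply/existsP; exists (inr true); apply/existsP; exists false.
  by rewrite /= !eqxx.
by apply: connect_trans (h r'); rewrite ce.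
Qed.

Hypothesis T_regions : disc_regions (pt T) (rg T) (side T).
Local Notation old_piece := (piece (fun _ : I => box) t (str T)).
Local Notation new_piece := (piece ti t (str T + bool)%type).
Local Notation bi := (fun d => 'I_(nint (dt d))).
Local Notation conn := (connect (bd_adj attach_pt)).

Definition box_piece (m : 'I_4) : new_piece := inl (@existT _ bi (Some None) m).
Local Notation box_at m := (Ordinal (isT : m < 4)).

(** An old region that met j0 now meets the right side of the box instead. *)
Definition old_piece_in (x : old_piece) : new_piece :=
  match x with
  | inl (existT None j) =>
      if j == j0 then box_piece (box_at 2) else inl (@existT _ bi None j)
  | inl (existT (Some i) j) => inl (@existT _ bi (Some (Some i)) j)
  | inr s => inr (inl s.1, s.2)
  end.

Lemma conn_sym : connect_sym (bd_adj attach_pt).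
Proof. by apply: sym_connect_sym; apply: bd_adj_sym. Qed.

Lemma touch_conn d (p : 'I_(npt (dt d))) (j : 'I_(nint (dt d))) :
  touch p j ->
  conn (inl (@existT _ bi d j)) (inr (attach_pt p, unsh (dt d) j)).
Proof. by move=> tp; apply/connect1/existsP; exists p; rewrite tp eqxx. Qed.

Lemma box_conn (m p : 'I_4) : touch (t := box) p m ->
  conn (box_piece m) (inr (attach_pt (d := Some None) p, ~~ odd m)).
Proof. exact: (touch_conn (d := Some None)). Qed.

Lemma shaded_end_conn q :
  conn (inr (inr q, false)) (inr (inl (end_str q), false)).
Proof.
rewrite conn_sym; case: q.
  apply: (@connect_trans _ _ (box_piece (box_at 1))).
    by rewrite conn_sym; apply: (@box_conn (box_at 1) (box_at 1) isT).
  exact: (@box_conn (box_at 1) (box_at 0) isT).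
apply: (@connect_trans _ _ (box_piece (box_at 3))).
  by rewrite conn_sym; apply: (@box_conn (box_at 3) (box_at 2) isT).
exact: (@box_conn (box_at 3) (box_at 3) isT).
Qed.

Lemma old_piece_conn x y :
  bd_adj (pt T) x y -> conn (old_piece_in x) (old_piece_in y).
Proof.
have key a s : bd_touch (pt T) a s -> conn (old_piece_in (inl a)) (old_piece_in (inr s)).
  case: a => -[i|] j /existsP[p /andP[tp /eqP ->]] /=.
    exact: (touch_conn (d := Some (Some i)) tp).
  case: eqVneq => [jj|jj].
    move: tp; rewrite jj => tp; rewrite j0_unsh (end_ptE tp).
    case: (unsh t p).
      exact: (@box_conn (box_at 2) (box_at 1) isT).
    exact: (@box_conn (box_at 2) (box_at 2) isT).
  have := touch_conn (d := None) tp.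
  rewrite /=; case: ifP => // tp0; rewrite (touch_other tp0 tp jj) => h.
  apply: connect_trans h _.
  by rewrite [X in inl (pt T None X)](end_ptE tp0); apply: shaded_end_conn.
case: x y => [a|s] [a'|s'] //; first exact: key.
by move=> h; rewrite conn_sym; apply: key.
Qed.

Lemma old_piece_region x :
  piece_region attach_rg attach_side (old_piece_in x) =
  Some (piece_region (rg T) (side T) x).
Proof.
case: x => [[[i|] j]|[s b]] //=.
by case: eqVneq => [->|/negbTE jj] //=; rewrite jj.
Qed.

Lemma new_region_conn x : piece_region attach_rg attach_side x = None ->
  conn x (box_piece (box_at 0)).
Proof.
have h q : conn (inr (inr q, true)) (box_piece (box_at 0)).
  rewrite conn_sym; case: q.
    exact: (@box_conn (box_at 0) (box_at 0) isT).
  exact: (@box_conn (box_at 0) (box_at 3) isT).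
case: x => [[[[i|]|] j]|[[s|q] [|]]] //=.
- case: j => -[|[|[|[|//]]]] hj //= _.
  by rewrite (_ : inl _ = box_piece (box_at 0)) ?connect0 //;
    congr (inl (existT _ _ _)); apply: val_inj.
- case: (eqVneq j j0) => // -> _.
  have e b : conn (inl (@existT _ bi None j0)) (inr (inr b, true)).
    have := touch_conn (d := None) (end_touch b).
    by rewrite /= end_touch j0_unsh end_unsh.
  exact: connect_trans (e true) (h _).
Qed.

Lemma old_region_conn x : piece_region attach_rg attach_side x != None ->
  exists y, conn x (old_piece_in y).
Proof.
case: x => [[[[i|]|] j]|[[s|q] b]] /=.
- move=> _; exists (inl (@existT _ (fun d => 'I_(nint (disc_t (fun _ : I => box) t d))) (Some i) j)).
  exact: connect0.
- rewrite -/(box_piece j).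
  case: j => -[|[|[|[|//]]]] hj //= _.
  + exists (inr (end_str true, false)); rewrite (_ : Ordinal hj = (box_at 1)); last exact: val_inj.
    exact: (@box_conn (box_at 1) (box_at 1) isT).
  + exists (inl (@existT _ (fun d => 'I_(nint (disc_t (fun _ : I => box) t d))) None j0)).
    by rewrite (_ : Ordinal hj = (box_at 2)) /= ?eqxx ?connect0 //; apply: val_inj.
  exists (inr (end_str false, false)); rewrite (_ : Ordinal hj = (box_at 3)); last exact: val_inj.
  exact: (@box_conn (box_at 3) (box_at 2) isT).
- case: (eqVneq j j0) => // /negbTE jj _.
  exists (inl (@existT _ (fun d => 'I_(nint (disc_t (fun _ : I => box) t d))) None j)).
  by rewrite /= jj connect0.
- by move=> _; exists (inr (s, b)); exact: connect0.
case: b => // _; exists (inr (end_str q, false)); exact: shaded_end_conn.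
Qed.

(** In the boundary of an old region, the right side of the box replaces j0, or
    the top or bottom side of the box and a new string are inserted. The new region
    is bounded by j0, the left side of the box and the two new strings. *)
Lemma attach_disc_regions : disc_regions attach_pt attach_rg attach_side.
Proof.
case: T_regions => surj conn_T; split.
  case=> [r|]; last by exists (box_piece (box_at 0)).
  by have [x <-] := surj r; exists (old_piece_in x); rewrite old_piece_region.
have adj_eq := @piece_region_adj _ _ _ _ _ _ _ _ attach_touch_side.
have region_conn x y : conn x y ->
    piece_region attach_rg attach_side x = piece_region attach_rg attach_side y.
  by case/connectP => p; elim: p x => [|z p IH] x /=; [move=> _ -> |
    case/andP => /adj_eq -> /IH h /h].
move=> x y e.
have [x0|x1] := eqVneq (piece_region attach_rg attach_side x) None.
  apply: connect_trans (new_region_conn x0) _.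
  by rewrite conn_sym; apply: new_region_conn; rewrite -e.
have [x' xx'] := old_region_conn x1.
have [y' yy'] : exists y', conn y (old_piece_in y') by apply: old_region_conn; rewrite -e.
apply: (connect_trans xx'); rewrite conn_sym; apply: (connect_trans yy').
rewrite conn_sym.
apply: (@connect_homo _ _ (bd_adj (pt T)) (bd_adj attach_pt) old_piece_in old_piece_conn).
apply: conn_T; apply/Some_inj; rewrite -!old_piece_region.
by rewrite -(region_conn _ _ xx') -(region_conn _ _ yy').
Qed.

Lemma attach_euler : #|{: option I}|.+1 + #|{: option (reg T)}|.*2 =
  \sum_(d : option (option I)) (dt d).2 + n_comp (bd_adj attach_pt) predT + 2.
Proof.
rewrite (disc_regions_n_comp attach_touch_side attach_disc_regions).
have := euler T.
rewrite (disc_regions_n_comp (touch_side T) T_regions).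
rewrite !sum_disc_sizes !card_option /=; lia.
Qed.

Definition attach_tangle : tangle ti t :=
  Tangle (reg_unsh := attach_unsh) attach_side_unsh attach_rg_unsh
    attach_touch_side attach_string_ends attach_connected attach_euler.

End Attach.

Section AttachEval.
Variables (F : fieldType) (S : finType).
Variables (I : finType) (t : dtype) (T : tangle (fun _ : I => box) t).
Hypothesis t_gt0 : (0 < t.2)%N.
Variable j0 : ubd t.
Hypothesis T_regions : disc_regions (pt T) (rg T) (side T).
Variables (x : spin_space F S box) (g : S -> S).
Hypothesis xE : forall a b, matrix_of x a b = (b == g a)%:R.

Definition update (l : {ffun ubd t -> S}) (a : S) : {ffun ubd t -> S} :=
  [ffun j => if j == j0 then a else l j].

Local Notation T' := (attach_tangle t_gt0 (valP j0) T_regions).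

Definition extend_state (v : S) (s : {ffun ureg T -> S}) : {ffun ureg T' -> S} :=
  [ffun r : ureg T' =>
     oapp s v (obind (fun r1 : reg T => insub r1) (val r : option (reg T)))].

Lemma extend_new v s (r : ureg T') : val r = None -> extend_state v s r = v.
Proof. by move=> e; rewrite ffunE e. Qed.

Lemma extend_old v s (r : ureg T') (r1 : ureg T) :
  val r = Some (val r1) -> extend_state v s r = s r1.
Proof. by move=> e; rewrite ffunE e /= valK. Qed.

Lemma extend_None v s : restr None (extend_state v s) =
  [ffun j => if j == j0 then v else s (urg T (d := None) j)].
Proof.
apply/ffunP => j; rewrite [LHS]ffunE [RHS]ffunE; case: eqVneq => [->|jj].
  by rewrite extend_new //= eqxx.
by rewrite (@extend_old _ _ _ (urg T (d := None) j)) //= (negbTE (_ : val j != val j0)).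
Qed.

Lemma extend_box v s : restr (Some None) (extend_state v s) = box_fun v (s (urg T (d := None) j0)).
Proof.
apply/ffunP => -[[[|[|[|[|//]]]] hj] uj] //; rewrite [LHS]ffunE [RHS]ffunE /=.
  exact: extend_new.
exact: extend_old.
Qed.

Lemma extend_Some v s i : restr (Some (Some i)) (extend_state v s) = restr (Some i) s.
Proof. by apply/ffunP => j; rewrite [LHS]ffunE [RHS]ffunE; exact: extend_old. Qed.

Lemma extend_bij : bijective (fun vs => extend_state vs.1 vs.2).
Proof.
pose r0 : ureg T' := exist (fun r : reg T' => reg_unsh T' r) None isT.
pose old (r : ureg T) : ureg T' :=
  exist (fun r : reg T' => reg_unsh T' r) (Some (val r)) (valP r).
exists (fun s : {ffun ureg T' -> S} => (s r0, [ffun r => s (old r)])) => [[v s]|s] /=.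
  rewrite extend_new //; congr pair; apply/ffunP => r; rewrite ffunE.
  exact: extend_old.
apply/ffunP => -[[r|] u]; last by rewrite extend_new //; congr (s _); apply: val_inj.
rewrite (@extend_old _ _ _ (mk_ureg (T := T) u)) // ffunE.
by congr (s _); apply: val_inj.
Qed.

(** The matrix of the box is the graph of a map g, so the sum over the label
    behind the box has one term, and the box applies g to one boundary label. *)
Lemma attach_eval l :
  spin_act T' (fun _ => x) l = spin_act T (fun _ => x) (update l (g (l j0))).
Proof.
rewrite !ffunE (reindex _ (onW_bij _ extend_bij)) /=.
pose G (s : {ffun ureg T -> S}) := \prod_i x (restr (Some i) s).
have prodE v s : \prod_(i : option I) x (restr (Some i) (extend_state v s)) =
    (s (urg T (d := None) j0) == g v)%:R * G s.
  rewrite (bigD1 None) //= extend_box -/(matrix_of x _ _) xE; congr (_ * _).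
  rewrite /G (reindex_omap (@Some I) id) => [|[]//] /=.
  apply: eq_big => [i|i _]; first by rewrite eqxx.
  by rewrite extend_Some.
under eq_bigr => vs _ do rewrite prodE.
rewrite big_mkcond [RHS]big_mkcond -(pair_big xpredT xpredT (fun v s =>
  if restr None (extend_state v s) == l then (s (urg T (d := None) j0) == g v)%:R * G s else 0)) /=.
rewrite exchange_big /=; apply: eq_bigr => s _.
rewrite (bigD1 (l j0)) //= big1 ?addr0 => [|v vl]; last first.
  case: eqP => // e; case/eqP: vl; rewrite -e extend_None ffunE eqxx //.
rewrite extend_None.
have [sg|sg] := eqVneq (s (urg T (d := None) j0)) (g (l j0)); last first.
  rewrite mul0r if_same; case: eqP => // /ffunP/(_ j0).
  by rewrite !ffunE eqxx => e; case/eqP: sg.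
rewrite mul1r -sg; congr (if _ then _ else _).
apply/eqP/eqP => /ffunP e; apply/ffunP => j; have := e j; rewrite !ffunE.
  by case: eqVneq => [->|].
by case: eqVneq => [->|_ ->].
Qed.

End AttachEval.

(** * Diagrams span the translation-invariant functions *)

Section Span.
Variables (F : fieldType) (W : lmodType F) (X : W -> Prop).

Lemma in_span_gen w : X w -> in_span X w.
Proof.
by move=> Xw; exists 1%N, (fun=> 1), (fun=> w); rewrite big_ord1 scale1r.
Qed.

Lemma in_span0 : in_span X 0.
Proof.
by exists 0%N, (fun=> 0), (fun=> 0); split=> [[]|] //; rewrite big_ord0.
Qed.

Lemma in_spanD u v : in_span X u -> in_span X v -> in_span X (u + v).
Proof.
move=> [m [c [y [Xy ->]]]] [m' [c' [y' [Xy' ->]]]].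
exists (m + m')%N, (fun k => match split k with inl i => c i | inr i => c' i end),
  (fun k => match split k with inl i => y i | inr i => y' i end).
split=> [k|]; first by case: split.
rewrite big_split_ord /=; congr (_ + _); apply: eq_bigr => i _.
  by rewrite (unsplitK (inl i)).
by rewrite (unsplitK (inr i)).
Qed.

Lemma in_spanZ a u : in_span X u -> in_span X (a *: u).
Proof.
move=> [m [c [y [Xy ->]]]]; exists m, (fun k => a * c k), y; split=> //.
by rewrite scaler_sumr; apply: eq_bigr => k _; rewrite scalerA.
Qed.

Lemma in_span_sum (K : finType) (c : K -> F) (y : K -> W) :
  (forall k, in_span X (y k)) -> in_span X (\sum_k c k *: y k).
Proof.
move=> Xy; elim/big_rec: _ => [|k s _ IH]; first exact: in_span0.
by apply: in_spanD => //; apply: in_spanZ.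
Qed.

Lemma in_span_linear (W' : lmodType F) (f : W' -> W) (Y : W' -> Prop) w :
  linear f -> (forall x, Y x -> in_span X (f x)) -> in_span Y w -> in_span X (f w).
Proof.
move=> lf Yf [m [c [y [Yy ->]]]].
have f0 : f 0 = 0 by have := lf (-1) 0 0; rewrite scaler0 addr0 scaleN1r addNr.
elim/big_rec: _ => [|k s _ IH]; first by rewrite f0; apply: in_span0.
by rewrite lf; apply: in_spanD => //; apply/in_spanZ/Yf.
Qed.

Lemma in_span_preimage (W' : lmodType F) (f : {linear W' -> W}) (Y : W' -> Prop) w :
  (forall x, X x -> exists y, Y y /\ f y = x) -> in_span X w ->
  exists w', in_span Y w' /\ f w' = w.
Proof.
move=> XY [m [c [y [Xy ->]]]].
have [y' y'P] := fin_all_exists (fun k => XY _ (Xy k)).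
exists (\sum_k c k *: y' k); split.
  by exists m, c, y'; split=> // k; case: (y'P k).
rewrite linear_sum; apply: eq_bigr => k _; rewrite linearZ.
by have [_ ->] := y'P k.
Qed.

End Span.

Lemma has_dim_coord (F : fieldType) (W : lmodType F) (K : finType)
    (ev : K -> W -> F^o) (mk : (K -> F) -> W) :
  (forall k, linear (ev k)) ->
  (forall w w', (forall k, ev k w = ev k w') -> w = w') ->
  (forall c k, ev k (mk c) = c k) -> has_dim W #|K|.
Proof.
move=> ev_lin ev_inj ev_mk.
pose b (i : 'I_#|K|) := mk (fun k => (k == enum_val i)%:R).
have ev_b c (i : 'I_#|K|) : ev (enum_val i) (\sum_j c j *: b j) = c i.
  transitivity (\sum_j c j * (i == j)%:R).
    elim/big_rec2: _ => [|j s w _ <-].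
      have := ev_lin (enum_val i) (-1) 0 0.
      by rewrite scaler0 addr0 scaleN1r addNr.
    by rewrite ev_lin ev_mk (inj_eq enum_val_inj).
  rewrite (bigD1 i) //= eqxx mulr1 big1 ?addr0 // => j ji.
  by rewrite eq_sym (negbTE ji) mulr0.
exists b => w; exists [ffun i => ev (enum_val i) w : F]; split.
  apply: ev_inj => k; rewrite -(enum_rankK k).
  by rewrite (ev_b (fun i => [ffun i => ev (enum_val i) w : F] i)) ffunE.
by move=> c ->; apply/ffunP => i; rewrite ffunE ev_b.
Qed.

Lemma closed_fun_ex (S : Type) (b : bool) (a0 : S) (l : {ffun ubd (b, 0%N) -> S}) :
  exists a, l = [ffun=> a].
Proof.
exists (oapp l a0 [pick j : ubd (b, 0%N)]); apply/ffunP => j; rewrite ffunE.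
case: pickP => [j' _|/(_ j)//]; congr (l _); apply: val_inj; apply: val_inj.
by case: j j' => -[[|//] ?] ? [[[|//] ?] ?].
Qed.

Section Spanning.
Variables (F : fieldType).
Local Notation G := 'Z_3.

Definition diagram_of (S : finType) (x : spin_space F S box) t (y : spin_space F S t) : Prop :=
  exists (I : finType) (T : tangle (fun _ : I => box) t), y = spin_act T (fun _ => x).

Variable x : spin_space F G box.
Hypothesis xE : forall a b, matrix_of x a b = (b == a + 1)%:R.

(** If there is an unshaded interval, the indicator function of the labellings l
    with l + m constant, which form an orbit of the diagonal translations. *)
Definition orbit_indicator t (m : {ffun ubd t -> G}) : spin_space F G t :=
  [ffun l : {ffun ubd t -> G} => \sum_(a : G) (l + m == [ffun=> a])%:R].

(** Each box shifts one label by one, so m is reached from 0 by inserting as many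
    boxes as the sum of its values in 0, 1, 2. *)
Lemma orbit_diagram t (t_gt0 : (0 < t.2)%N) (m : {ffun ubd t -> G}) :
  exists (I : finType) (T : tangle (fun _ : I => box) t),
    disc_regions (pt T) (rg T) (side T) /\
    orbit_indicator m = spin_act T (fun _ => x).
Proof.
have [k km] : exists k, (\sum_j val (m j) <= k)%N by exists (\sum_j val (m j))%N.
elim: k m km => [|k IH] m km.
  exists 'I_0, (base_tangle t_gt0); split; first exact: base_disc_regions.
  apply/ffunP => l; rewrite base_eval ffunE (_ : m = 0) ?addr0 //.
  apply/ffunP => j; apply: val_inj; rewrite ffunE /=; move: km.
  by rewrite leqn0 sum_nat_eq0 => /forallP/(_ j)/eqP.
case: (pickP (fun j => m j != 0)) => [j mj|m0]; last first.
  by apply: IH; rewrite big1 // => j _; have /negbFE/eqP -> := m0 j.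
pose m' : {ffun ubd t -> G} := m - [ffun i => (i == j)%:R].
have [|I [T [rT eT]]] := IH m'.
  rewrite -ltnS; apply: leq_trans km; rewrite (bigD1 j) //= [X in (_ < X)%N](bigD1 j) //=.
  rewrite !ffunE eqxx (eq_bigr (fun i => val (m i))) => [|i ij].
    by rewrite ltn_add2r; case: (m j) mj => -[|[|[|//]]].
  by rewrite !ffunE (negbTE ij) oppr0 addr0.
exists (option I), (attach_tangle t_gt0 (valP j) rT); split.
  exact: (attach_disc_regions t_gt0 (valP j) rT).
apply/ffunP => l; rewrite (attach_eval t_gt0 j rT xE) -eT !ffunE.
apply: eq_bigr => a _; congr ((_ == _)%:R); apply/ffunP => i; rewrite !ffunE.
by case: eqVneq => [->|_]; rewrite ?subr0 //= mulr1n -addrA (addrC 1) subrK.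
Qed.

(** Each orbit indicator occurs for three values of m, which differ by constants;
    hence the division by 3. *)
Lemma invariant_span t (f : spin_space F G t) (three : 3%:R != 0 :> F) :
  f \in @translation_invariant F G t -> in_span (diagram_of x (t := t)) f.
Proof.
move/invP => fI.
case: t f fI => b [|i] f fI.
  have fE l : f l = f [ffun=> 0].
    have [a ->] := closed_fun_ex 0 l; rewrite -(fI a [ffun=> 0]).
    by congr (f _); apply/ffunP => j; rewrite !ffunE FinRing.zmodMgE addr0.
  have -> : f = \sum_(k : unit) f [ffun=> 0] *: spin_act (empty_tangle b) (fun _ => x).
    rewrite big_const card_unit /= addr0; apply/ffunP => l; rewrite fE [RHS]ffunE.
    by have [a ->] := closed_fun_ex 0 l; rewrite empty_eval /GRing.scale /= mulr1.
  by apply: in_span_sum => _; apply: in_span_gen; exists 'I_0, (empty_tangle b).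
pose h (m : {ffun ubd (b, i.+1) -> G}) : F := f m.
have hI a m : h (m - [ffun=> a]) = h m.
  rewrite /h -(fI (- a) m); congr (f _); apply/ffunP => j.
  by rewrite !ffunE FinRing.zmodMgE addrC.
have -> : f = \sum_(m : {ffun ubd (b, i.+1) -> G})
    (h (- m) / 3%:R) *: (orbit_indicator m : {ffun _ -> F^o}).
  apply/ffunP => l; rewrite sum_ffunE.
  transitivity (\sum_(a : G) \sum_(m : {ffun ubd (b, i.+1) -> G})
      h (- m) / 3%:R * (l + m == [ffun=> a])%:R : F); last first.
    rewrite exchange_big /=; apply: eq_bigr => m _; rewrite !ffunE /GRing.scale /=.
    by rewrite mulr_sumr.
  rewrite (eq_bigr (fun=> h l / 3%:R)) => [|a _].
    by rewrite sumr_const card_ord -[RHS]mulr_natr divfK.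
  rewrite (bigD1 ([ffun=> a] - l)) //= (addrC l) subrK eqxx mulr1 big1 => [|m ml].
    by rewrite addr0 opprB hI.
  by case: eqP => [e|_]; rewrite ?mulr0 //; case/eqP: ml; rewrite -e addrC addKr.
apply: in_span_sum => m; apply: in_span_gen.
have [I [T [_ ->]]] := @orbit_diagram (b, i.+1) isT m.
by exists I, T.
Qed.
End Spanning.

(** * The group planar algebra of the cyclic group of order three *)

Section Mirror.
Variable t : dtype.

(** The second disc of the pairing sees the labels of the first one in mirror
    order. *)
Definition mirror (j : ubd t) : ubd t :=
  urg (pairing_tangle t) (d := Some ord_max) j.

Lemma val_mirror j : val (val (mirror j)) = ((nint t - val j) %% nint t)%N.
Proof. by []. Qed.

Lemma mirrorK : involutive mirror.
Proof.
move=> [[m hm] um]; apply: val_inj; apply: val_inj; rewrite !val_mirror /=.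
have n0 := nint_gt0 t; case: (posnP m) => [->|m0].
  by rewrite subn0 modnn subn0 modnn.
have e : ((nint t - m) %% nint t = nint t - m)%N by rewrite modn_small //; lia.
by rewrite e subKn 1?ltnW // modn_small.
Qed.

End Mirror.

Section CyclicGroup.
Variables (F : numClosedFieldType).
Local Notation G := 'Z_3.
Local Notation V := (group_planar_algebra F G).

Definition val_map_fun t (x : V t) : spin_space F G t := val x.

Lemma val_map_linear t : linear (@val_map_fun t).
Proof. by []. Qed.

HB.instance Definition _ t :=
  GRing.isLinear.Build F (V t) (spin_space F G t) _ (@val_map_fun t) (@val_map_linear t).

Definition val_map : planar_map V (GPA F G) :=
  @PlanarMap F V (GPA F G) (fun t => @val_map_fun t) (fun _ _ _ _ _ => erefl).

Definition entry (x : V box) (a b : G) : F := matrix_of (val x) a b.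
Definition entry3 (w : V (true, 3%N)) (a b c : G) : F :=
  (val w : {ffun {ffun ubd (true, 3%N) -> G} -> F^o}) (three_fun a b c).

Lemma entry_linear a b k u v : entry (k *: u + v) a b = k * entry u a b + entry v a b.
Proof. by rewrite /entry /matrix_of /= !ffunE. Qed.

Lemma entry3_linear a b c k u v :
  entry3 (k *: u + v) a b c = k * entry3 u a b c + entry3 v a b c.
Proof. by rewrite /entry3 /= !ffunE. Qed.

Lemma entry_inv x a b : entry x a b = entry x 0 (b - a).
Proof.
have /invP h := valP x; rewrite /entry /matrix_of -(h (- a)); congr (val x _).
apply/ffunP => j; rewrite !ffunE FinRing.zmodMgE; case: ifP => _.
  by rewrite addNr.
by rewrite addrC.
Qed.

Lemma entry3_inv x a b c : entry3 x a b c = entry3 x 0 (b - a) (c - a).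
Proof.
have /invP h := valP x; rewrite /entry3 -(h (- a)); congr (val x _).
apply/ffunP => -[[[|[|[|[|[|[|//]]]]]] ?] ?]; rewrite !ffunE FinRing.zmodMgE //= ?addNr // addrC //.
Qed.

Lemma entry_inj x y : (forall q, entry x 0 q = entry y 0 q) -> x = y.
Proof.
move=> h; apply: val_inj; apply: matrix_of_inj => a b.
by rewrite -!/(entry _ _ _) entry_inv h -entry_inv.
Qed.

Lemma entry3_inj x y : (forall r s, entry3 x 0 r s = entry3 y 0 r s) -> x = y.
Proof.
move=> h; apply: val_inj; apply/ffunP => l; have [a [b [c ->]]] := three_fun_ex l.
by rewrite -!/(entry3 _ _ _ _) entry3_inv h -entry3_inv.
Qed.

Lemma addKA (g x y : G) : (g + x) - (g + y) = x - y.
Proof. by rewrite (addrC g x) addrKA. Qed.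

Definition left_end : ubd box := mk_ubd (t := box) (j := Ordinal (isT : (0 < 4)%N)) isT.
Definition right_end : ubd box := mk_ubd (t := box) (j := Ordinal (isT : (2 < 4)%N)) isT.

Lemma circulant_subproof (h : G -> F) :
  ([ffun l : {ffun ubd box -> G} => h (l right_end - l left_end)] : spin_space F G box)
    \in @translation_invariant F G box.
Proof. by apply/invP => g l; rewrite !ffunE !FinRing.zmodMgE addKA. Qed.

Definition circulant (h : G -> F) : V box := GroupSpace (circulant_subproof h).

Lemma circulantE h a b : entry (circulant h) a b = h (b - a).
Proof. by rewrite /entry /matrix_of /= !ffunE. Qed.

Local Notation three_end m :=
  (mk_ubd (t := (true, 3%N)) (j := Ordinal (isT : (m < 6)%N)) isT).

Lemma circulant3_subproof (h : G -> G -> F) :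
  ([ffun l : {ffun ubd (true, 3%N) -> G} =>
     h (l (three_end 2) - l (three_end 0)) (l (three_end 4) - l (three_end 0))] : spin_space F G (true, 3%N))
    \in @translation_invariant F G (true, 3%N).
Proof. by apply/invP => g l; rewrite !ffunE !FinRing.zmodMgE !addKA. Qed.

Definition circulant3 (h : G -> G -> F) : V (true, 3%N) :=
  GroupSpace (circulant3_subproof h).

Lemma circulant3E h r s : entry3 (circulant3 h) 0 r s = h r s.
Proof. by rewrite /entry3 /= !ffunE /= !subr0. Qed.

Lemma entry_id a b : entry (id_elt V) a b = 1.
Proof. exact: id_eval. Qed.

Lemma entry_e a b : entry (e_elt V) a b = (a == b)%:R.
Proof. exact: e_eval. Qed.

Lemma entry_stack x y a b : entry (stack x y) a b = entry x a b * entry y a b.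
Proof. exact: stack_eval. Qed.

Lemma entry_D x y z a b c :
  entry3 (D_elt x y z) a b c = entry x a b * entry y b c * entry z c a.
Proof. exact: D_eval. Qed.

Lemma entry_U x y z a b c :
  entry3 (U_elt x y z) a b c = \sum_d entry x a d * entry y b d * entry z c d.
Proof. exact: U_eval. Qed.

Definition step (q : G) : V box := circulant (fun r => (r == q)%:R).

Lemma stepE q a b : entry (step q) a b = (b - a == q)%:R.
Proof. by rewrite circulantE. Qed.

Definition shift_box : V box := step 1.

Lemma shift_boxE a b : entry shift_box a b = (b == a + 1)%:R.
Proof. by rewrite stepE subr_eq addrC. Qed.

Local Notation P := shift_box.
Local Notation basic := (fun y : V box => y = P \/ y = id_elt V \/ y = e_elt V).

Lemma box_span x : in_span basic x.
Proof.
pose c q := entry x 0 q.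
have -> : x = (c 1 - c 2%:R) *: P + (c 2%:R *: id_elt V + ((c 0 - c 2%:R) *: e_elt V + 0)).
  apply: entry_inj => q; rewrite !entry_linear shift_boxE entry_id entry_e.
  have -> : entry (0 : V box) 0 q = 0 by rewrite /entry /matrix_of /= ffunE.
  rewrite -/(c q) add0r mulr1 addr0; case: q => -[|[|[|//]]] hq.
  - rewrite (_ : Ordinal hq = 0) ?eqxx; last exact: val_inj.
    by rewrite /= mulr0 add0r mulr1 addrC subrK.
  - rewrite (_ : Ordinal hq = 1) ?eqxx; last exact: val_inj.
    by rewrite /= mulr0 addr0 mulr1 subrK.
  rewrite (_ : Ordinal hq = 2%:R); last exact: val_inj.
  by rewrite /= !mulr0 addr0 add0r.
do 2?[apply: in_spanD; first by apply/in_spanZ/in_span_gen; auto].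
by apply: in_spanD; [apply/in_spanZ/in_span_gen; auto|apply: in_span0].
Qed.

Lemma group_generated : generated_by (fun y : V box => y = P).
Proof.
move=> t x.
have three : 3%:R != 0 :> F by rewrite pnatr_eq0.
have [|x' [x'P /val_inj <- //]] := in_span_preimage (f := val_map t)
  (Y := fun y => exists (I : finType) (T : tangle (fun _ : I => box) t)
                             (lab : I -> V box), (forall i, lab i = P) /\ y = act V T lab)
  _ (invariant_span (x := val P) shift_boxE three (valP x)).
move=> _ [I [T ->]]; exists (act V T (fun _ => P)); split=> //.
by exists I, T, (fun _ => P).
Qed.

(** Pairing x with the mirror image of its complex conjugate gives a sum of
    squared absolute values of values of x. *)
Lemma group_nondegenerate : nondegenerate V.
Proof.
move=> t x h; have xI := valP x.
pose y0 : spin_space F G t :=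
  [ffun m : {ffun ubd t -> G} => ((val x : {ffun {ffun ubd t -> G} -> F^o}) [ffun j => m (mirror j)])^*].
have y0I : y0 \in @translation_invariant F G t.
  apply/invP => g l; rewrite !ffunE; congr (_^*); have /invP xg := xI.
  rewrite -(xg g [ffun j => l (mirror j)]).
  by congr (val x _); apply/ffunP => j; rewrite !ffunE.
apply: val_inj; apply/ffunP => s; rewrite [RHS]ffunE.
have := h (GroupSpace y0I) => /(congr1 val) /ffunP/(_ (restr (T := pairing_tangle t) None s)).
rewrite [LHS]ffunE [RHS]ffunE.
under eq_bigr => s' _.
  rewrite !big_ord_recl big_ord0 mulr1 /=.
  have -> : restr (T := pairing_tangle t) (Some ord0) s' = s'.
    by apply/ffunP => j; rewrite ffunE; congr (s' _); apply: val_inj; apply: val_inj.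
  rewrite ffunE.
  have -> : [ffun j => restr (T := pairing_tangle t) (Some (lift ord0 ord0)) s' (mirror j)] = s'.
    apply/ffunP => j; rewrite !ffunE; congr (s' _); rewrite -[RHS]mirrorK.
    by apply: val_inj; apply: val_inj.
  over.
move=> /eqP; rewrite psumr_eq0 => [|s' _]; last exact: mul_conjC_ge0.
move/allP/(_ s); rewrite mem_index_enum eqxx => /(_ isT).
by rewrite mul_conjC_eq0 => /eqP.
Qed.

Lemma group_dim_closed b : has_dim (V (b, 0%N)) 1.
Proof.
have cI (c : F) : ([ffun=> c] : spin_space F G (b, 0%N)) \in @translation_invariant F G (b, 0%N).
  by apply/invP => g l; rewrite !ffunE.
suff : has_dim (V (b, 0%N)) #|{: unit}| by rewrite card_unit.
apply: (@has_dim_coord F (V (b, 0%N)) unit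
  (fun _ x => (val x : {ffun {ffun ubd (b, 0%N) -> G} -> F^o}) [ffun=> 0])
  (fun c => GroupSpace (cI (c tt)))).
- by move=> _ k u v; rewrite /= !ffunE.
- move=> w w' /(_ tt) e; apply: val_inj; apply/ffunP => l.
  have [a ->] := closed_fun_ex 0 l.
  have cE (x : V (b, 0%N)) : (val x : {ffun {ffun ubd (b, 0%N) -> G} -> F^o}) [ffun=> a] =
     (val x : {ffun {ffun ubd (b, 0%N) -> G} -> F^o}) [ffun=> 0].
    have /invP xI := valP x; rewrite -(xI a [ffun=> 0]); congr (val x _).
    by apply/ffunP => j; rewrite !ffunE FinRing.zmodMgE addr0.
  by rewrite !cE.
by move=> c [] /=; rewrite ffunE.
Qed.

Lemma group_dim_box : has_dim (V box) 3.
Proof.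
suff : has_dim (V box) #|{: G}| by rewrite card_ord.
apply: (@has_dim_coord F (V box) G (fun q x => entry x 0 q) circulant).
- by move=> q k u v; rewrite entry_linear.
- exact: entry_inj.
by move=> c q; rewrite circulantE subr0.
Qed.

Lemma group_dim_three : has_dim (V (true, 3%N)) 9.
Proof.
suff : has_dim (V (true, 3%N)) #|{: G * G}| by rewrite card_prod !card_ord.
apply: (@has_dim_coord F (V (true, 3%N)) (G * G)%type
  (fun p x => entry3 x 0 p.1 p.2) (fun c => circulant3 (fun r s => c (r, s)))).
- by move=> p k u v; rewrite entry3_linear.
- by move=> w w' h; apply: entry3_inj => r s; apply: (h (r, s)).
by move=> c [r s]; rewrite circulant3E.
Qed.

Lemma group_strand x : exists c, x = c *: strand_elt V.
Proof.
exists ((val x : {ffun {ffun ubd (true, 1%N) -> G} -> F^o}) (strand_fun 0)).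
apply: val_inj; apply/ffunP => l; have [a ->] := strand_fun_ex l.
rewrite [RHS]ffunE [X in _ *: X]strand_eval /GRing.scale /= mulr1.
have /invP xI := valP x; rewrite -(xI a (strand_fun 0)); congr (val x _).
by apply/ffunP => j; rewrite !ffunE FinRing.zmodMgE addr0.
Qed.

Lemma in_span_trilinear (W : lmodType F) (f : V box -> V box -> V box -> W) x y z :
  (forall y z, linear (fun x => f x y z)) ->
  (forall x z, linear (fun y => f x y z)) ->
  (forall x y, linear (fun z => f x y z)) ->
  in_span (fun w => exists x' y' z', [/\ basic x', basic y', basic z' & w = f x' y' z'])
    (f x y z).
Proof.
move=> l1 l2 l3.
apply: (in_span_linear (l1 y z) _ (box_span x)) => x' bx.
apply: (in_span_linear (l2 x' z) _ (box_span y)) => y' bY.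
apply: (in_span_linear (l3 x' y') _ (box_span z)) => z' bz.
by apply: in_span_gen; exists x', y', z'.
Qed.

Lemma entry3_sum (K : finType) (c : K -> F) (w : K -> V (true, 3%N)) a b d :
  entry3 (\sum_k c k *: w k) a b d = \sum_k c k * entry3 (w k) a b d.
Proof.
elim/big_rec2: _ => [|k s v _ <-]; first by rewrite /entry3 /= ffunE.
exact: entry3_linear.
Qed.

Lemma sum_delta (K : finType) (k0 : K) (c : K -> F) :
  \sum_k c k * (k0 == k)%:R = c k0.
Proof.
rewrite (bigD1 k0) //= eqxx mulr1 big1 ?addr0 // => k kk.
by rewrite eq_sym (negbTE kk) mulr0.
Qed.

(** The diagram D(step r, step (s - r), id) is the indicator function of the
    triples (a, a + r, a + s), and these functions form a basis. *)
Lemma D_span w :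
  in_span (fun w => exists x' y' z', [/\ basic x', basic y', basic z' & w = D_elt x' y' z']) w.
Proof.
have -> : w = \sum_(p : G * G) entry3 w 0 p.1 p.2 *:
    D_elt (step p.1) (step (p.2 - p.1)) (id_elt V).
  apply: entry3_inj => r s; rewrite entry3_sum -[LHS](sum_delta (r, s) (fun p => entry3 w 0 p.1 p.2)).
  apply: eq_bigr => -[r' s'] _; congr (_ * _); rewrite entry_D !stepE entry_id mulr1 subr0.
  rewrite xpair_eqE -natrM mulnb; congr (_%:R); congr nat_of_bool.
  by case: eqP => [->|//]; rewrite (inj_eq (addIr _)).
apply: in_span_sum => p; apply: in_span_trilinear => *; move=> k u v; apply: entry3_inj => r s;
 rewrite entry3_linear !entry_D entry_linear; ring.
Qed.

(** In U(step 0, step (- r), step (- s)) the first box forces the central label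
    to be a, which leaves the indicator function of the triples
    (a, a + r, a + s). *)
Lemma U_span w :
  in_span (fun w => exists x' y' z', [/\ basic x', basic y', basic z' & w = U_elt x' y' z']) w.
Proof.
have -> : w = \sum_(p : G * G) entry3 w 0 p.1 p.2 *:
    U_elt (step 0) (step (- p.1)) (step (- p.2)).
  apply: entry3_inj => r s; rewrite entry3_sum -[LHS](sum_delta (r, s) (fun p => entry3 w 0 p.1 p.2)).
  apply: eq_bigr => -[r' s'] _; congr (_ * _); rewrite entry_U (bigD1 0) //= big1 ?addr0.
    rewrite !stepE subrr eqxx mul1r !sub0r !eqr_opp.
    by rewrite xpair_eqE -natrM mulnb.
  by move=> d d0; rewrite !stepE subr0 (negbTE d0) !mul0r.
apply: in_span_sum => p; apply: in_span_trilinear => *; move=> k u v; apply: entry3_inj => r s;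
 rewrite entry3_linear !entry_U mulr_sumr -big_split /=; apply: eq_bigr => d _;
 rewrite entry_linear; ring.
Qed.

(** The local relations hold because the elements on their right-hand sides span
    the spaces in which they are written. *)
Lemma group_singly_generated : singly_generated 3%:R P.
Proof.
split; last exact: box_span.
  split.
  - exact: group_nondegenerate.
  - exact: group_dim_closed.
  - apply: val_inj; apply/ffunP => l; have [a ->] := closed_fun_ex 0 l.
    by rewrite [LHS]loop_true_eval [RHS]empty_eval.
  - apply: val_inj; apply/ffunP => l; have [a ->] := closed_fun_ex 0 l.
    by rewrite [LHS]loop_false_eval [RHS]ffunE [X in _ *: X]empty_eval card_ord /GRing.scale /= mulr1.
  - exact: group_generated.
  split.
  - by move=> *; apply: group_strand.
  - by move=> *; apply: group_strand.
  - by move=> *; apply: box_span.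
  - by move=> *; apply: box_span.
  by split=> *; [apply: D_span|apply: U_span].
move=> P0; have := shift_boxE 0 1; rewrite P0 add0r eqxx /entry /matrix_of /= ffunE.
by move/eqP; rewrite eq_sym oner_eq0.
Qed.

Lemma shift_minimal : minimal_idempotent P.
Proof.
split; first by case: group_singly_generated.
  by apply: entry_inj => q; rewrite entry_stack shift_boxE -natrM mulnb andbb.
move=> x; exists (entry x 0 1); apply: entry_inj => q.
have -> : entry (entry x 0 1 *: P) 0 q = entry x 0 1 * entry P 0 q.
  by rewrite {1}/entry /matrix_of /= ffunE.
rewrite !entry_stack shift_boxE add0r; case: eqP => [->|_]; last by rewrite !mulr0.
by rewrite mul1r.
Qed.

Lemma shift_orthogonal : orthogonal_to_e P.
Proof.
have h a b : entry P a b * entry (e_elt V) a b = 0.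
  rewrite shift_boxE entry_e; case: (eqVneq a b) => [->|_]; last by rewrite mulr0.
  by rewrite -subr_eq0 opprD addrA subrr add0r oppr_eq0 oner_eq0 mul0r.
split; apply: entry_inj => q; rewrite entry_stack ?[_ * entry P _ _]mulrC h;
  by rewrite /entry /matrix_of /= ffunE.
Qed.

End CyclicGroup.

(** * Relabelling and faithfulness of spin models *)

Section Relabel.
Variables (F : fieldType) (S S' : finType) (v : S' -> S).
Hypothesis v_bij : bijective v.

Definition relabel_fun t (f : spin_space F S t) : spin_space F S' t :=
  [ffun l : {ffun ubd t -> S'} => (f : {ffun {ffun ubd t -> S} -> F^o}) [ffun j => v (l j)]].

Lemma relabel_linear t : linear (@relabel_fun t).
Proof. by move=> a f g; apply/ffunP => l; rewrite !ffunE. Qed.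

HB.instance Definition _ t := GRing.isLinear.Build F (spin_space F S t)
  (spin_space F S' t) _ (@relabel_fun t) (@relabel_linear t).

Lemma relabel_act (I : finType) (ti : I -> dtype) t (T : tangle ti t)
    (x : forall i, spin_space F S (ti i)) :
  relabel_fun (spin_act T x) = spin_act T (fun i => relabel_fun (x i)).
Proof.
have v_inj := bij_inj v_bij.
pose h (A : finType) (l : {ffun A -> S'}) : {ffun A -> S} := [ffun j => v (l j)].
have h_inj A : injective (@h A).
  by move=> l l' /ffunP e; apply/ffunP => j; have := e j; rewrite !ffunE => /v_inj.
have h_bij : bijective (@h (ureg T)).
  case: v_bij => u uv vu; exists (fun l : {ffun ureg T -> S} => [ffun j => u (l j)]) => l;
  by apply/ffunP => j; rewrite !ffunE.
have hE d (s : {ffun ureg T -> S'}) : restr d (h _ s) = h _ (restr d s).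
  by apply/ffunP => j; rewrite !ffunE.
apply/ffunP => l; rewrite !ffunE (reindex _ (onW_bij _ h_bij)) /=.
apply: eq_big => [s|s _]; first by rewrite hE (inj_eq (@h_inj _)).
by apply: eq_bigr => i _; rewrite hE ffunE.
Qed.

Definition relabel : planar_map (GPA F S) (GPA F S') :=
  @PlanarMap F (GPA F S) (GPA F S') (fun t => @relabel_fun t) relabel_act.

Lemma relabel_matrix x a b :
  matrix_of (relabel box x) a b = matrix_of (x : spin_space F S box) (v a) (v b).
Proof.
rewrite /matrix_of ffunE; congr (x _); apply/ffunP => j; rewrite !ffunE.
by case: ifP.
Qed.

Lemma relabel_inj t : injective (@relabel_fun t).
Proof.
move=> f g /ffunP e; apply/ffunP => l; case: v_bij => u uv vu.
have := e [ffun j => u (l j)]; rewrite !ffunE.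
by rewrite (_ : [ffun j => v _] = l) //; apply/ffunP => j; rewrite !ffunE vu.
Qed.

End Relabel.

Definition comp_map (F : fieldType) (A B C : planar_algebra F)
    (g : planar_map B C) (f : planar_map A B) : planar_map A C.
Proof.
exists (fun t => (g t \o f t : {linear _ -> _})) => I ti t T x /=.
by rewrite !pmap_act.
Defined.

Lemma bij_of_surj (A : choiceType) (B : eqType) (f : A -> B) :
  injective f -> (forall y, exists x, f x = y) -> bijective f.
Proof.
move=> f_inj f_surj.
have ex y : exists x, f x == y by have [x <-] := f_surj y; exists x.
exists (fun y => xchoose (ex y)) => [x|y]; last exact/eqP/(xchooseP (ex y)).
exact/f_inj/eqP/(xchooseP (ex (f x))).
Qed.

Lemma has_dim_bij (F : fieldType) (W W' : lmodType F) (f : {linear W -> W'}) d :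
  bijective f -> has_dim W' d -> has_dim W d.
Proof.
case=> g fK gK [b bP]; exists (g \o b) => w.
have e (c : {ffun 'I_d -> F}) : f (\sum_k c k *: g (b k)) = \sum_k c k *: b k.
  by rewrite linear_sum; apply: eq_bigr => k _; rewrite linearZ /= gK.
have [c [wc cu]] := bP (f w); exists c; split=> [|c' w'].
  by apply: (can_inj fK); rewrite e.
by apply: cu; rewrite w' e.
Qed.

Section Faithful.
Variables (F : fieldType) (V : planar_algebra F) (S : finType).
Variable Phi : spin_model V S.
Variable a0 : S.
Hypothesis V_eval : evaluable V.
Hypothesis V_nondeg : nondegenerate V.

Lemma spin_model_inj0 b (x : V (b, 0%N)) : Phi _ x = 0 -> x = 0.
Proof.
have [e eP] := V_eval b.
have PhiE : Phi _ (empty_elt V b) = spin_act (empty_tangle b) (fun=> Phi _ 0).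
  exact: pmap_act.
have [c [xc _]] := eP x; have [c' [ec' _]] := eP (empty_elt V b).
rewrite !big_ord1 in xc ec'.
have e1 : (Phi _ (empty_elt V b) : {ffun {ffun ubd (b, 0%N) -> S} -> F^o}) [ffun=> a0] = 1.
  by rewrite PhiE empty_eval.
have c'0 : c' ord0 != 0.
  apply/eqP => c0; move: e1; rewrite ec' c0 scale0r linear0 ffunE => /eqP.
  by rewrite eq_sym oner_eq0.
have -> : x = (c ord0 / c' ord0) *: empty_elt V b by rewrite ec' scalerA divfK.
rewrite linearZ /= => /ffunP/(_ [ffun=> a0]) h.
suff -> : c ord0 / c' ord0 = 0 by rewrite scale0r.
by move: h; rewrite !ffunE e1 /GRing.scale /= mulr1.
Qed.

(** A spin model is not zero on an empty diagram, so it is injective on the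
    one-dimensional spaces of closed diagrams. If it kills x, it also kills all
    pairings of x, which are therefore zero. *)
Lemma spin_model_inj t : injective (Phi t).
Proof.
suff k (x : V t) : Phi t x = 0 -> x = 0.
  by move=> x y e; apply/subr0_eq/k; rewrite linearB /= e subrr.
move=> x0; apply: V_nondeg => y; apply: spin_model_inj0; rewrite pmap_act.
apply/ffunP => l; rewrite !ffunE big1 // => s _.
by rewrite big_ord_recl /= x0 ffunE mul0r.
Qed.

End Faithful.

(** * The digraph of a non-symmetric spin model *)

Section Realization.
Variables (F : numClosedFieldType) (S : finType) (C : S -> S -> F).
Variables (V : planar_algebra F) (P : V box) (Phi : spin_model V S).
Hypothesis real : nonsymmetric_realization C P Phi.

Local Notation gen := (fun x => x = P \/ x = id_elt V \/ x = e_elt V).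

Definition spin3 (w : V (true, 3%N)) (a b c : S) : F :=
  (Phi _ w : {ffun {ffun ubd (true, 3%N) -> S} -> F^o}) (three_fun a b c).

Lemma spin_matrix_sum m (c : 'I_m -> F) (y : 'I_m -> V box) a b :
  spin_matrix Phi (\sum_k c k *: y k) a b = \sum_k c k * spin_matrix Phi (y k) a b.
Proof.
rewrite /spin_matrix linear_sum sum_ffunE; apply: eq_bigr => k _.
by rewrite linearZ ffunE.
Qed.

Lemma spin3_sum m (c : 'I_m -> F) (y : 'I_m -> V (true, 3%N)) a b d :
  spin3 (\sum_k c k *: y k) a b d = \sum_k c k * spin3 (y k) a b d.
Proof.
rewrite /spin3 linear_sum sum_ffunE; apply: eq_bigr => k _.
by rewrite linearZ ffunE.
Qed.

Lemma spin_id a b : spin_matrix Phi (id_elt V) a b = 1.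
Proof. by rewrite /spin_matrix pmap_act [LHS]id_eval. Qed.

Lemma spin_e a b : spin_matrix Phi (e_elt V) a b = (a == b)%:R.
Proof. by rewrite /spin_matrix pmap_act [LHS]e_eval. Qed.

Lemma spin_stack x y a b :
  spin_matrix Phi (stack x y) a b = spin_matrix Phi x a b * spin_matrix Phi y a b.
Proof. by rewrite /spin_matrix pmap_act [LHS]stack_eval. Qed.

Lemma spin_half_turn x a b :
  spin_matrix Phi (act V half_turn_tangle (fun=> x)) a b = spin_matrix Phi x b a.
Proof. by rewrite /spin_matrix pmap_act [LHS]half_turn_eval. Qed.

Lemma spin_D x y z a b c :
  spin3 (D_elt x y z) a b c =
  spin_matrix Phi x a b * spin_matrix Phi y b c * spin_matrix Phi z c a.
Proof. by rewrite /spin3 pmap_act [LHS]D_eval. Qed.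

Lemma spin_U x y z a b c :
  spin3 (U_elt x y z) a b c =
  \sum_d spin_matrix Phi x a d * spin_matrix Phi y b d * spin_matrix Phi z c d.
Proof. by rewrite /spin3 pmap_act [LHS]U_eval. Qed.

Definition arc (a b : S) : bool := spin_matrix Phi P a b == 1.

(** An idempotent for the entrywise product has entries 0 and 1. *)
Lemma spin_arc a b : spin_matrix Phi P a b = (arc a b)%:R.
Proof.
case: real => _ [[_ PP _] _] _ _.
have := congr1 (fun x => spin_matrix Phi x a b) PP; rewrite spin_stack /arc.
set c := spin_matrix _ _ _ _ => cc.
have [->//|c1] := eqVneq c 1; apply/eqP.
have : c * (c - 1) = 0 by rewrite mulrBr cc mulr1 subrr.
by move/eqP; rewrite mulf_eq0 subr_eq0 (negbTE c1) orbF.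
Qed.

Lemma arc_refl a : arc a a = false.
Proof.
case: real => _ [_ [Pe _]] _ _.
have := congr1 (fun x => spin_matrix Phi x a a) Pe.
rewrite spin_stack spin_e eqxx mulr1 spin_arc [RHS]/spin_matrix linear0 ffunE => /eqP.
by rewrite pnatr_eq0 eqb0 => /negbTE.
Qed.

(** This is all that P, id and e see of an ordered pair of labels. *)
Definition same_pair (p q : S * S) : bool :=
  ((p.1 == p.2) == (q.1 == q.2)) && (arc p.1 p.2 == arc q.1 q.2).

Lemma spin_same_pair x a b a' b' : gen x -> same_pair (a, b) (a', b') ->
  spin_matrix Phi x a b = spin_matrix Phi x a' b'.
Proof.
move=> gx /andP[/eqP /= e1 /eqP /= e2].
by case: gx => [->|[->|->]]; rewrite ?spin_arc ?spin_id ?spin_e ?e1 ?e2.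
Qed.

(** The rotated generator is a combination of P, id and e. *)
Lemma arc_reverse a b a' b' :
  same_pair (a, b) (a', b') -> arc b a = arc b' a'.
Proof.
case: real => [[m [_ _ span]] _ _ _] ab.
have [k [c [y [gy e]]]] := span (act V half_turn_tangle (fun=> P)).
rewrite /arc -!(spin_half_turn P) e !spin_matrix_sum.
by congr (_ == _); apply: eq_bigr => i _; rewrite (spin_same_pair (gy i) ab).
Qed.

(** The star-triangle relation turns U into a combination of diagrams D, whose
    values only involve entries at the three pairs. *)
Lemma U_same_type x y z a b c a' b' c' : gen x -> gen y -> gen z ->
  same_pair (a, b) (a', b') -> same_pair (b, c) (b', c') ->
  same_pair (c, a) (c', a') ->
  \sum_d spin_matrix Phi x a d * spin_matrix Phi y b d * spin_matrix Phi z c d =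
  \sum_d spin_matrix Phi x a' d * spin_matrix Phi y b' d * spin_matrix Phi z c' d.
Proof.
case: real => [[m [[_ _ _ _ _ [_ _ _ _ [star _]]] _ _]] _ _ _] gx gy gz ab bc ca.
rewrite -!spin_U; have [k [co [w [wP ->]]]] := star x y z gx gy gz.
rewrite !spin3_sum; apply: eq_bigr => i _; congr (_ * _).
have [x' [y' [z' [gx' gy' gz' ->]]]] := wP i; rewrite !spin_D.
by rewrite (spin_same_pair gx' ab) (spin_same_pair gy' bc) (spin_same_pair gz' ca).
Qed.

Lemma arc_exists : exists a b, arc a b && ~~ arc b a.
Proof.
case: real => _ _ nonsym _.
case: (pickP (fun p : S * S => arc p.1 p.2 && ~~ arc p.2 p.1)) => [[a b] /= ab|no].
  by exists a, b.
case: nonsym => a b; rewrite !spin_arc; congr ((nat_of_bool _)%:R).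
have /= h1 := no (a, b); have /= h2 := no (b, a).
by move: h1 h2; case: (arc a b); case: (arc b a).
Qed.

(** Off the diagonal, the entry at (b, a) is a function of the entry at (a, b).
    One pair of labels has different entries in the two orders, so this function
    exchanges 0 and 1. *)
Lemma arc_tournament a b : arc a b = (a != b) && ~~ arc b a.
Proof.
have [->|ab] := eqVneq a b; first by rewrite arc_refl.
have [a0 [b0 /andP[ab0 ba0]]] := arc_exists.
have ne0 : a0 != b0 by apply: contraTneq ab0 => ->; rewrite arc_refl.
case E: (arc a b).
  rewrite (@arc_reverse _ _ a0 b0) //.
  by rewrite /same_pair /= (negbTE ab) (negbTE ne0) E ab0.
rewrite (@arc_reverse _ _ b0 a0) ?ab0 //.
by rewrite /same_pair /= (negbTE ab) (eq_sym b0) (negbTE ne0) E (negbTE ba0).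
Qed.

Lemma same_pair_arc a b a' b' : arc a b -> arc a' b' -> same_pair (a, b) (a', b').
Proof.
move=> ab ab'; rewrite /same_pair /= ab ab'.
by rewrite !(negbTE (arc_neq arc_tournament _)).
Qed.

Lemma same_pair_rev a b a' b' : arc a b -> arc a' b' -> same_pair (b, a) (b', a').
Proof.
move=> ab ab'; rewrite /same_pair /= (arc_asym arc_tournament ab)
  (arc_asym arc_tournament ab').
by rewrite (eq_sym b) (eq_sym b') !(negbTE (arc_neq arc_tournament _)).
Qed.

Lemma same_pair_refl a b : same_pair (a, a) (b, b).
Proof. by rewrite /same_pair /= !eqxx !arc_refl. Qed.

Lemma gen_generator : gen P. Proof. by left. Qed.
Lemma gen_id : gen (id_elt V). Proof. by right; left. Qed.

Lemma outdegree_const a a' : (\sum_d arc a d = \sum_d arc a' d)%N.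
Proof.
have rr := same_pair_refl a a'.
have := U_same_type gen_generator gen_id gen_id rr rr rr.
have count x : \sum_d spin_matrix Phi P x d * spin_matrix Phi (id_elt V) x d *
    spin_matrix Phi (id_elt V) x d = (\sum_d arc x d)%N%:R.
  by rewrite natr_sum; apply: eq_bigr => d _; rewrite spin_arc !spin_id !mulr1.
by rewrite !count => /eqP; rewrite eqr_nat => /eqP.
Qed.

Lemma common2_const a b a' b' : arc a b -> arc a' b' ->
  common2 arc a b = common2 arc a' b'.
Proof.
move=> ab ab'.
have := U_same_type gen_generator gen_generator gen_id (same_pair_arc ab ab') (same_pair_rev ab ab')
  (same_pair_refl a a').
have count x y : \sum_d spin_matrix Phi P x d * spin_matrix Phi P y d *
    spin_matrix Phi (id_elt V) x d = (common2 arc x y)%:R.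
  by rewrite natr_sum; apply: eq_bigr => d _; rewrite !spin_arc spin_id mulr1 natrM.
by rewrite !count => /eqP; rewrite eqr_nat => /eqP.
Qed.

Lemma common3_const a b c a' b' c' : same_pair (a, b) (a', b') ->
  same_pair (b, c) (b', c') -> same_pair (c, a) (c', a') ->
  common3 arc a b c = common3 arc a' b' c'.
Proof.
move=> ab bc ca; have := U_same_type gen_generator gen_generator gen_generator ab bc ca.
have count x y z : \sum_d spin_matrix Phi P x d * spin_matrix Phi P y d *
    spin_matrix Phi P z d = (common3 arc x y z)%:R.
  by rewrite natr_sum; apply: eq_bigr => d _; rewrite !spin_arc !natrM.
by rewrite !count => /eqP; rewrite eqr_nat => /eqP.
Qed.

Lemma realization_regular :
  exists k lam mu tau, [/\ forall a, (\sum_d arc a d = k)%N,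
    forall a b, a != b -> common2 arc a b = lam,
    forall a b c, arc a b -> arc b c -> arc a c -> common3 arc a b c = mu &
    forall a b c, arc a b -> arc b c -> arc c a -> common3 arc a b c = tau].
Proof.
have [a0 [b0 /andP[ab0 _]]] := arc_exists.
have [|mu muP] := constant_on (X := (S * S * S)%type) 0%N
  (P := fun p => [&& arc p.1.1 p.1.2, arc p.1.2 p.2 & arc p.1.1 p.2])
  (f := fun p => common3 arc p.1.1 p.1.2 p.2).
  case=> [[a b] c] [[a' b'] c'] /and3P[/= h1 h2 h3] /and3P[/= h1' h2' h3'].
  by apply: common3_const; [apply: same_pair_arc|apply: same_pair_arc|apply: same_pair_rev].
have [|tau tauP] := constant_on (X := (S * S * S)%type) 0%N
  (P := fun p => [&& arc p.1.1 p.1.2, arc p.1.2 p.2 & arc p.2 p.1.1])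
  (f := fun p => common3 arc p.1.1 p.1.2 p.2).
  case=> [[a b] c] [[a' b'] c'] /and3P[/= h1 h2 h3] /and3P[/= h1' h2' h3'].
  by apply: common3_const; apply: same_pair_arc.
exists (\sum_d arc a0 d)%N, (common2 arc a0 b0), mu, tau; split.
- by move=> a; apply: outdegree_const.
- move=> a b ab; have [ab1|ba1] := boolP (arc a b); first exact: common2_const.
  transitivity (common2 arc b a); first by apply: eq_bigr => d _; rewrite mulnC.
  by apply: common2_const => //; rewrite arc_tournament eq_sym ab.
- by move=> a b c ab bc ac; apply: (muP (a, b, c)); rewrite /= ab bc ac.
by move=> a b c ab bc ca; apply: (tauP (a, b, c)); rewrite /= ab bc ca.
Qed.

Lemma realization_order : #|S| = 3%N.
Proof.
have [a0 [b0 /andP[ab0 _]]] := arc_exists.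
have [k [lam [mu [tau [h1 h2 h3 h4]]]]] := realization_regular.
exact: (triply_regular_tournament arc_tournament h1 h2 h3 h4 ab0).
Qed.

Lemma realization_cycle : is_adjacency_matrix directed_cycle3 C.
Proof.
have T := arc_tournament.
have [a [b /andP[ab _]]] := arc_exists.
have [k [_ [_ [_ [deg _ _ _]]]]] := realization_regular.
have k1 : k = 1%N.
  by have := order_outdegree T deg a; rewrite realization_order; lia.
have out2 x y z : arc x y -> arc x z -> y = z.
  move=> xy xz; apply/eqP; apply: contraT => yz.
  have := deg x; rewrite k1 (bigD1 y) //= (bigD1 z) 1?eq_sym //= xy xz.
  by rewrite addnA.
have [c bc] : exists c, arc b c.
  case: (pickP (arc b)) => [c bc|no]; first by exists c.
  by have := deg b; rewrite k1 big1 // => d _; rewrite no.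
have ba := arc_asym T ab.
(* The only out-neighbour of a is b, so the arc between a and c ends at a. *)
have ca : arc c a.
  have ac : a != c by apply: contraFneq ba => ->.
  have := T c a; rewrite eq_sym ac /=; case: (boolP (arc a c)) => // ac1 _.
  by have := arc_neq T bc; rewrite (out2 _ _ _ ab ac1) eqxx.
have cb := arc_asym T bc; have ac := arc_asym T ca.
pose v (i : 'I_3) := nth a [:: a; b; c] i.
have v_inj : injective v.
  have u : uniq [:: a; b; c].
    by rewrite /= !inE (negbTE (arc_neq T ab)) (negbTE (arc_neq T bc)) eq_sym (negbTE (arc_neq T ca)).
  by move=> i j /eqP; rewrite nth_uniq // => /eqP/val_inj.
exists v; split; first by apply: inj_card_bij => //; rewrite realization_order card_ord.
have CE x y : C x y = (arc x y)%:R.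
  by case: real => _ _ _ ->; rewrite spin_arc.
by move=> [[|[|[|//]]] hi] [[|[|[|//]]] hj]; rewrite CE /v /directed_cycle3 /=
  ?(arc_irrefl T) ?ab ?bc ?ca ?ba ?cb ?ac.
Qed.

End Realization.

(** * Identification with the group planar algebra *)

Section ToGroup.
Variables (F : numClosedFieldType) (V : planar_algebra F) (P : V box).
Local Notation G := 'Z_3.
Variable Psi : spin_model V G.
Hypothesis V_gen : generated_by (fun x => x = P).
Hypothesis PsiP : forall a b, matrix_of (Psi box P) a b = (b == a + 1)%:R.

Lemma Psi_diagram (I : finType) t (T : tangle (fun _ : I => box) t) (lab : I -> V box) :
  (forall i, lab i = P) ->
  Psi t (act V T lab) = spin_act T (fun _ => val (shift_box F)).
Proof.
move=> labP; rewrite pmap_act; apply: spin_act_ext => i; rewrite labP.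
by apply: matrix_of_inj => a b; rewrite PsiP -[LHS]shift_boxE.
Qed.

(** The elements of V are combinations of diagrams labelled by P, and P is mapped
    to the translation-invariant [shift_box]. *)
Lemma Psi_invariant t (x : V t) : Psi t x \in @translation_invariant F G t.
Proof.
have [m [c [y [yP ->]]]] := V_gen x; rewrite linear_sum.
apply: rpred_sum => k _; rewrite linearZ; apply: rpredZ.
have [I [T [lab [labP ->]]]] := yP k; rewrite Psi_diagram //.
exact: (group_act_subproof T (fun=> shift_box F)).
Qed.

Definition to_group_fun t (x : V t) : group_planar_algebra F G t :=
  GroupSpace (Psi_invariant x).

Lemma to_group_linear t : linear (@to_group_fun t).
Proof. by move=> a x y; apply: val_inj; rewrite /= linearP. Qed.

HB.instance Definition _ t := GRing.isLinear.Build F (V t)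
  (group_planar_algebra F G t) _ (@to_group_fun t) (@to_group_linear t).

Lemma to_group_act (I : finType) (ti : I -> dtype) t (T : tangle ti t)
    (x : forall i, V (ti i)) :
  to_group_fun (act V T x) =
  act (group_planar_algebra F G) T (fun i => to_group_fun (x i)).
Proof. by apply: val_inj; rewrite /= pmap_act. Qed.

Definition to_group : planar_map V (group_planar_algebra F G) :=
  @PlanarMap F V (group_planar_algebra F G) (fun t => @to_group_fun t) to_group_act.

(** The diagrams labelled by P already span the invariant functions. *)
Lemma to_group_surj t (y : group_planar_algebra F G t) : exists x, to_group t x = y.
Proof.
have three : 3%:R != 0 :> F by rewrite pnatr_eq0.
have [|x [_ xy]] := in_span_preimage (f := Psi t) (Y := fun _ => True)
  _ (invariant_span (x := val (shift_box F)) (@shift_boxE F) three (valP y)).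
  by move=> _ [I [T ->]]; exists (act V T (fun=> P)); rewrite Psi_diagram.
by exists x; apply: val_inj.
Qed.

Lemma to_group_bij t : injective (Psi t) -> bijective (to_group t).
Proof.
move=> inj; apply: bij_of_surj; last exact: to_group_surj.
by move=> x y /(congr1 val) /inj.
Qed.

End ToGroup.

Lemma realization_isomorphic (F : numClosedFieldType) (S : finType)
    (C : S -> S -> F) (V : planar_algebra F) (P : V box) (Phi : spin_model V S) :
  nonsymmetric_realization C P Phi ->
  [/\ has_dim (V (true, 2%N)) 3, has_dim (V (true, 3%N)) 9 &
      isomorphic V (bisch_jones9 F)].
Proof.
move=> real; have [v [v_bij CE]] := realization_cycle real.
have [[m [[nondeg evalV _ _ gen _] _ _]] _ _ CP] := real.
pose Psi : spin_model V 'Z_3 := comp_map (relabel F v_bij) Phi.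
have PsiP a b : matrix_of (Psi box P) a b = (b == a + 1)%:R.
  rewrite [LHS](relabel_matrix v_bij) -[LHS]/(spin_matrix Phi P (v a) (v b)) -CP CE.
  rewrite /directed_cycle3; congr ((nat_of_bool (b == _))%:R).
  by apply: val_inj; case: a => -[|[|[|]]].
have bij t : bijective (to_group gen PsiP t).
  apply: to_group_bij => x y /(relabel_inj v_bij).
  exact: (spin_model_inj (v 0) evalV nondeg).
split; last by exists (to_group gen PsiP).
- exact: (has_dim_bij (bij _) (group_dim_box F)).
- exact: (has_dim_bij (bij _) (group_dim_three F)).
Qed.

Lemma cycle_realized (F : numClosedFieldType) (S : finType) (C : S -> S -> F) :
  is_adjacency_matrix directed_cycle3 C ->
  exists (V : planar_algebra F) (P : V box) (Phi : spin_model V S),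
      nonsymmetric_realization C P Phi.
Proof.
case=> v [[u vK uK] CE].
have u_bij : bijective u by exists v.
exists (group_planar_algebra F 'Z_3), (shift_box F),
  (comp_map (relabel F (v := u : S -> 'Z_3) u_bij) (val_map F)).
have PE a b : spin_matrix (comp_map (relabel F (v := u : S -> 'Z_3) u_bij) (val_map F))
    (shift_box F) a b = ((u b : 'Z_3) == u a + 1)%:R.
  by rewrite [LHS](relabel_matrix u_bij) [LHS]shift_boxE.
split.
- by exists 3%:R; apply: group_singly_generated.
- by split; [apply: shift_minimal|apply: shift_orthogonal].
- move/(_ (v 0) (v 1)); rewrite !PE !vK /= => /eqP.
  by rewrite eqr_nat.
move=> a b; rewrite PE -{1}(uK a) -{1}(uK b) CE /directed_cycle3.
congr ((nat_of_bool (u b == _))%:R).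
by apply: val_inj; case: (u a) => -[|[|[|]]].
Qed.

Theorem theorem4 (R : realType) (n : nat) (S : finType) (C : S -> S -> R[i])
    (hn : (1 <= n)%N) (hS : #|S| = n) :
  ((exists (V : planar_algebra R[i]) (P : V box) (Phi : spin_model V S),
      nonsymmetric_realization C P Phi) <->
   (n = 3%N /\ is_adjacency_matrix directed_cycle3 C)) /\
  (forall (V : planar_algebra R[i]) (P : V box) (Phi : spin_model V S),
      nonsymmetric_realization C P Phi ->
      [/\ has_dim (V (true, 2%N)) 3, has_dim (V (true, 3%N)) 9 &
          isomorphic V (bisch_jones9 R[i])]).
Proof.
split; last by move=> V P Phi; apply: realization_isomorphic.
split=> [[V [P [Phi real]]]|[_ cyc]]; last exact: cycle_realized.
by split; [rewrite -hS (realization_order real)|apply: realization_cycle real].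
Qed.
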